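(* Let $\Omega\subset\mathbb{R}^3$ be a bounded $C^2$-smooth domain. (1) Linear phase. Let $\rho,\rho^\perp\in\mathbb{S}^2$ with $\rho\cdot\rho^\perp=0$. Then for all sufficiently large $\tau>0$ and all $t\in\mathbb{R}$ there exist $w$ and $g$ satisfying the system (S) of the context in $\Omega$, of the form $$w=e^{\tau((x\cdot\rho-t)+ix\cdot\rho^\perp)}(a_0+\tau^{-1}a_1+\tau^{-2}a_2+r),\qquad g=e^{\tau((x\cdot\rho-t)+ix\cdot\rho^\perp)}(b_0+\tau^{-1}b_1+\tau^{-2}b_2+s),$$ where $a_0,a_1,a_2:\overline\Omega\to\mathbb{C}^3$ and $b_0,b_1,b_2:\overline\Omega\to\mathbb{C}$ are smooth functions on $\overline\Omega$ independent of $\tau$ and $t$, and $a_0$ is non-vanishing on $\overline\Omega$. (2) Logarithmic phase. Let $x_0\in\mathbb{R}^3\setminus\overline{ch(\Omega)}$, where $ch(\Omega)$ is the convex hull of $\Omega$, and let $\omega_0\in\mathbb{S}^2$ be such that $\{x\in\mathbb{R}^3: x-x_0=m\omega_0,\ m\in\mathbb{R}\}\cap\partial\Omega=\emptyset$. Let $\psi(x):=d_{\mathbb{S}^2}\big(\frac{x-x_0}{|x-x_0|},\omega_0\big)$, with $d_{\mathbb{S}^2}$ the distance function on $\mathbb{S}^2$. Then for all sufficiently large $\tau>0$ and all $t\in\mathbb{R}$ there exist $w$ and $g$ satisfying (S) in $\Omega$, of the form $$w=e^{\tau(t-\log|x-x_0|)-i\tau\psi(x)}(a_0+\tau^{-1}a_1+\tau^{-2}a_2+r),\qquad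 g=e^{\tau(t-\log|x-x_0|)-i\tau\psi(x)}(b_0+\tau^{-1}b_1+\tau^{-2}b_2+s),$$ where $a_0,a_1,a_2:\overline\Omega\to\mathbb{C}^3$ and $b_0,b_1,b_2:\overline\Omega\to\mathbb{C}$ are smooth functions on $\overline\Omega$ independent of $\tau$ and $t$, and $a_0$ is non-vanishing on $\overline\Omega$. In addition, in both cases the remainder $R:=(r,s)^\top$ satisfies, with $C$ independent of $\tau$, $$\|\partial^\alpha R\|_{L^2(\Omega)}\le C\tau^{|\alpha|-3}\quad\text{for } |\alpha|\le2,$$ and, for every $\Omega_0\subset\subset\Omega$, $\|\nabla R\|_{H^2(\Omega_0)}\le C$ as $\tau\to\infty$. Finally, in both cases $u:=\mu_0^{-1/2}w+\mu_0^{-1}\nabla g$ is a solution of $\mu_0\Delta u+(\lambda_0+\mu_0)\nabla(\nabla\cdot u)+\kappa^2u=0$ in $\Omega$, and its $p$-part $u_p$ and $s$-part $u_s$ are given by $$u_p=-\kappa_p^{-2}\big[\mu_0^{-1/2}\nabla(\nabla\cdot w)+\mu_0^{-1}\nabla(\Delta g)\big],\qquad u_s=\kappa_s^{-2}\mu_0^{-1/2}\big[\nabla(\nabla\cdot w)-\Delta w\big].$$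
   Context: $\lambda_0,\mu_0$ are real constants with $\mu_0>0$, $2\mu_0+3\lambda_0>0$, and $\kappa>0$; $\kappa_p=\kappa/\sqrt{2\mu_0+\lambda_0}$, $\kappa_s=\kappa/\sqrt{\mu_0}$. System (S), for a $\mathbb{C}^3$-valued function $w$ and a $\mathbb{C}$-valued function $g$, is $$\Delta w+\frac{\kappa^2}{\mu_0}w=0,\qquad \Delta g+\frac{\lambda_0+\mu_0}{\lambda_0+2\mu_0}\mu_0^{1/2}\,\nabla\cdot w+\frac{\kappa^2}{\lambda_0+2\mu_0}g=0 .$$ For a solution $u$ of $\mu_0\Delta u+(\lambda_0+\mu_0)\nabla\operatorname{div}u+\kappa^2u=0$, its $p$-part is $u_p=-\kappa_p^{-2}\nabla\operatorname{div}u$ and its $s$-part is $u_s=\kappa_s^{-2}\operatorname{curl}\operatorname{curl}u$. The notation $\Omega_0\subset\subset\Omega$ means that $\overline{\Omega_0}$ is a compact subset of $\Omega$. *)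

(* Defs.v *)
From HB Require Import structures.
From mathcomp Require Import all_boot all_order all_algebra complex.
From mathcomp Require Import all_classical all_reals all_analysis.

Set Implicit Arguments.
Unset Strict Implicit.
Unset Printing Implicit Defensive.

Import Order.TTheory GRing.Theory Num.Theory.
Import numFieldNormedType.Exports.

Local Open Scope classical_set_scope.
Local Open Scope ring_scope.
Local Open Scope complex_scope.

(* The library norm on 'rV[R]_n is the sup norm; it gives the usual topology and
   the usual bounded sets.  Distances in the statement are Euclidean. *)
Section Euclidean.
Context {R : realType} {n : nat}.

Definition dot (x y : 'rV[R]_n) : R := \sum_i x 0 i * y 0 i.

Definition enorm (x : 'rV[R]_n) : R := Num.sqrt (dot x x).

Definition unit_sphere : set 'rV[R]_n := [set x | enorm x = 1].

(* geodesic distance on the unit sphere *)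
Definition dist_sphere (x y : 'rV[R]_n) : R := acos (dot x y).

Definition boundary (A : set 'rV[R]_n) : set 'rV[R]_n := closure A `\` A°.

Definition convex_hull (A : set 'rV[R]_n) : set 'rV[R]_n :=
  smallest (@convex_set R 'rV[R]_n) A.

Definition compactly_contained (A B : set 'rV[R]_n) : Prop :=
  compact (closure A) /\ closure A `<=` B.

End Euclidean.

Section Differentiation.
Context {R : realType} {n : nat}.
Local Notation V := 'rV[R]_n.
Local Notation C := R[i].

Definition partial (j : 'I_n) (f : V -> R) : V -> R := 'D_(delta_mx 0 j) f.

(* [Ck k U f]: on the open set U all partial derivatives of f of order at most
   k exist and are continuous.  The derivability clause is needed because 'D is
   a total operator. *)
Fixpoint Ck (k : nat) (U : set V) (f : V -> R) : Prop :=
  (forall x, U x -> {for x, continuous f}) /\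
  match k with
  | 0 => True
  | k'.+1 => forall j : 'I_n,
      (forall x, U x -> derivable f x (delta_mx 0 j)) /\ Ck k' U (partial j f)
  end.

Definition cpartial (j : 'I_n) (f : V -> C) : V -> C :=
  fun x => partial j (fun y => complex.Re (f y)) x +i*
           partial j (fun y => complex.Im (f y)) x.

Definition cCk (k : nat) (U : set V) (f : V -> C) : Prop :=
  Ck k U (fun y => complex.Re (f y)) /\ Ck k U (fun y => complex.Im (f y)).

Definition mCk (k : nat) (U : set V) (p q : nat) (F : V -> 'M[C]_(p, q)) : Prop :=
  forall i j, cCk k U (fun y => F y i j).

(* smooth on a closed set: restriction of a function that is smooth on an open
   neighbourhood of it *)
Definition csmooth_on (A : set V) (f : V -> C) : Prop :=
  exists U (h : V -> C), [/\ open U, A `<=` U,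
    (forall k, cCk k U h) & forall x, A x -> f x = h x].

Definition msmooth_on (A : set V) (p q : nat) (F : V -> 'M[C]_(p, q)) : Prop :=
  forall i j, csmooth_on A (fun y => F y i j).

(* the derivative of multi-index alpha *)
Definition cderiv (alpha : 'I_n -> nat) (f : V -> C) : V -> C :=
  foldr (fun j h => iter (alpha j) (cpartial j) h) f (enum 'I_n).

Definition mderiv (alpha : 'I_n -> nat) (p q : nat) (F : V -> 'M[C]_(p, q)) :
    V -> 'M[C]_(p, q) :=
  fun x => \matrix_(i, j) cderiv alpha (fun y => F y i j) x.

Definition mi_order (alpha : 'I_n -> nat) : nat := (\sum_i alpha i)%N.

Definition jacobian_mx (p : nat) (F : V -> 'cV[C]_p) : V -> 'M[C]_(p, n) :=
  fun x => \matrix_(i, j) cpartial j (fun y => F y i 0) x.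

Definition grad (g : V -> C) : V -> 'cV[C]_n := fun x => \col_j cpartial j g x.

Definition divergence (w : V -> 'cV[C]_n) : V -> C :=
  fun x => \sum_j cpartial j (fun y => w y j 0) x.

Definition lap (g : V -> C) : V -> C := fun x => \sum_j cpartial j (cpartial j g) x.

Definition vlap (p : nat) (w : V -> 'cV[C]_p) : V -> 'cV[C]_p :=
  fun x => \col_i lap (fun y => w y i 0) x.

End Differentiation.

Section Space.
Context {R : realType}.
Local Notation V := 'rV[R]_3.
Local Notation C := R[i].

(* the addition on 'I_3 is modulo 3 *)
Definition curl (w : V -> 'cV[C]_3) : V -> 'cV[C]_3 :=
  fun x => \col_(i < 3) (cpartial (i + 1) (fun y => w y (i + 2) 0) x
                        - cpartial (i + 2) (fun y => w y (i + 1) 0) x).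

(* Lebesgue measure on R^3 is the product measure on R * R * R. *)
Definition leb3 :
    {measure set (measurableTypeR R * measurableTypeR R * measurableTypeR R)%type
       -> \bar R} :=
  ((@lebesgue_measure R \x @lebesgue_measure R) \x @lebesgue_measure R)%E.

Definition coord3 (p : R * R * R) : V :=
  \row_(i < 3) tnth [tuple p.1.1; p.1.2; p.2] i.

Definition frobenius (p q : nat) (A : 'M[C]_(p, q)) : R :=
  Num.sqrt (\sum_i \sum_j
    (complex.Re (A i j) ^+ 2 + complex.Im (A i j) ^+ 2)).

Definition L2norm (U : set V) (p q : nat) (F : V -> 'M[C]_(p, q)) : \bar R :=
  Lnorm leb3 2%:E
    (fun z => (\1_U (coord3 z) * frobenius (F (coord3 z)))%:E).

Definition Hnorm (k : nat) (U : set V) (p q : nat) (F : V -> 'M[C]_(p, q)) :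
    \bar R :=
  ((\sum_(alpha : {ffun 'I_3 -> 'I_k.+1} | (mi_order (fun i => alpha i) <= k)%N)
      L2norm U (mderiv (fun i => alpha i) F) ^+ 2) `^ 2^-1)%E.

(* Near each boundary point and in suitable orthonormal coordinates y, the set
   is the part of a ball above the graph of a C^2 function of (y_1, y_2). *)
Definition C2_boundary (Omega : set V) : Prop :=
  forall p, boundary Omega p ->
    exists (Q : 'M[R]_3) (gamma : 'rV[R]_2 -> R) (e : R),
      [/\ Q *m Q^T = 1%:M, Ck 2 setT gamma, 0 < e &
          forall x, enorm (x - p) < e ->
            let y : 'rV[R]_(2 + 1) := x *m Q in
            Omega x <-> gamma (lsubmx y) < y 0 ord_max].

Definition bounded_C2_domain (Omega : set V) : Prop :=
  [/\ Omega !=set0, open Omega, connected Omega, bounded_set Omega &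
      C2_boundary Omega].

Definition cexp (z : C) : C :=
  (expR (complex.Re z))%:C * (cos (complex.Im z) +i* sin (complex.Im z)).

Definition linear_phase (rho rhop : V) (tau t : R) (x : V) : C :=
  (tau * (dot x rho - t)) +i* (tau * dot x rhop).

Definition log_phase (x0 omega0 : V) (tau t : R) (x : V) : C :=
  (tau * (t - ln (enorm (x - x0)))) +i*
  (- (tau * dist_sphere ((enorm (x - x0))^-1 *: (x - x0)) omega0)).

Section Elasticity.
Variables (lambda0 mu0 kappa : R).

Definition kappa_p : R := kappa / Num.sqrt (2 * mu0 + lambda0).

Definition kappa_s : R := kappa / Num.sqrt mu0.

Definition system_S (Omega : set V) (w : V -> 'cV[C]_3) (g : V -> C) : Prop :=
  forall x, Omega x ->
    vlap w x + (kappa ^+ 2 / mu0)%:C *: w x = 0 /\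
    lap g x
    + ((lambda0 + mu0) / (lambda0 + 2 * mu0) * Num.sqrt mu0)%:C * divergence w x
    + (kappa ^+ 2 / (lambda0 + 2 * mu0))%:C * g x = 0.

Definition navier (Omega : set V) (u : V -> 'cV[C]_3) : Prop :=
  forall x, Omega x ->
    mu0%:C *: vlap u x + (lambda0 + mu0)%:C *: grad (divergence u) x
    + (kappa ^+ 2)%:C *: u x = 0.

Definition elastic_p_part (u : V -> 'cV[C]_3) : V -> 'cV[C]_3 :=
  fun x => - (kappa_p ^- 2)%:C *: grad (divergence u) x.

Definition elastic_s_part (u : V -> 'cV[C]_3) : V -> 'cV[C]_3 :=
  fun x => (kappa_s ^- 2)%:C *: curl (curl u) x.

Definition displacement (w : V -> 'cV[C]_3) (g : V -> C) : V -> 'cV[C]_3 :=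
  fun x => ((Num.sqrt mu0)^-1)%:C *: w x + (mu0^-1)%:C *: grad g x.

Definition remainder (r : V -> 'cV[C]_3) (s : V -> C) : V -> 'cV[C]_(3 + 1) :=
  fun x => col_mx (r x) (s x)%:M.

(* The solutions attached to the phase phi.  They are classical: C^3 is the
   least regularity for which all the derivatives below exist pointwise. *)
Definition has_CGO_solutions (Omega : set V) (phi : R -> R -> V -> C) : Prop :=
  exists (a0 a1 a2 : V -> 'cV[C]_3) (b0 b1 b2 : V -> C),
  [/\ [/\ msmooth_on (closure Omega) a0, msmooth_on (closure Omega) a1 &
          msmooth_on (closure Omega) a2],
      [/\ csmooth_on (closure Omega) b0, csmooth_on (closure Omega) b1 &
          csmooth_on (closure Omega) b2],
      (forall x, closure Omega x -> a0 x != 0) &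
  exists (tau0 : R) (w r : R -> R -> V -> 'cV[C]_3) (g s : R -> R -> V -> C),
  [/\ 0 < tau0,
      forall tau t, tau0 <= tau ->
        let u := displacement (w tau t) (g tau t) in
        [/\ [/\ mCk 3 Omega (w tau t), cCk 3 Omega (g tau t),
                mCk 3 Omega (r tau t) & cCk 3 Omega (s tau t)],
            system_S Omega (w tau t) (g tau t),
            (forall x, Omega x ->
               w tau t x = cexp (phi tau t x) *:
                 (a0 x + (tau^-1)%:C *: a1 x + (tau ^- 2)%:C *: a2 x
                  + r tau t x) /\
               g tau t x = cexp (phi tau t x) *
                 (b0 x + (tau^-1)%:C * b1 x + (tau ^- 2)%:C * b2 x
                  + s tau t x)),
            navier Omega u &
            forall x, Omega x ->
              elastic_p_part u x = - (kappa_p ^- 2)%:C *: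
                 (((Num.sqrt mu0)^-1)%:C *: grad (divergence (w tau t)) x
                  + (mu0^-1)%:C *: grad (lap (g tau t)) x) /\
              elastic_s_part u x = (kappa_s ^- 2 * (Num.sqrt mu0)^-1)%:C *:
                 (grad (divergence (w tau t)) x - vlap (w tau t) x)],
      (exists M : R, forall alpha : 'I_3 -> nat, (mi_order alpha <= 2)%N ->
         forall tau t, tau0 <= tau ->
         (L2norm Omega (mderiv alpha (remainder (r tau t) (s tau t)))
          <= (M * tau ^ ((mi_order alpha)%:Z - 3))%:E)%E) &
      forall Omega0, compactly_contained Omega0 Omega ->
        exists M : R, \forall tau \near +oo, forall t,
          (Hnorm 2 Omega0 (jacobian_mx (remainder (r tau t) (s tau t)))
           <= M%:E)%E]].

End Elasticity.
End Space.

(* Main.v *)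
(* Divergence-free solutions with g = 0, and hence b_j = s = 0, suffice.  Write the phase
   as tau (al + ct + i be) with al and be satisfying the eikonal equations
   |grad al|^2 = |grad be|^2 = m and grad al . grad be = 0, and look for
   w = e^(tau (al + ct + i be)) X(al) Z(be) H with H a fixed real vector field.  In the
   linear case H = rho x rhop.  In the logarithmic case be is minus the polar angle about
   the axis x0 + R omega0 and H = r^(-3/2) N, where N is the rotation field of the axis
   and r the distance to it; the axis misses the closure of Omega.  In both cases H solves
   the transport equations for al and be, is orthogonal to their gradients and is
   divergence-free, so that w is divergence-free and the Helmholtz equation separates into
     X'' = - 2 tau X' + q_a X   and   Z'' = - 2 i tau Z' + q_b Z.
   These ordinary differential equations have solutions 1 + P1 / tau + P2 / tau^2 + e in
   which the k-th derivative of e is O(tau^(k - 3)) for k <= 3, so that no Carleman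
   estimate is needed. *)
Require Import Defs.
From mathcomp Require Import all_boot all_order all_algebra complex.
From mathcomp Require Import all_classical all_reals all_analysis.
From mathcomp Require Import ring lra.
Set Implicit Arguments.
Unset Strict Implicit.
Unset Printing Implicit Defensive.
Import Order.TTheory GRing.Theory Num.Theory.
Import numFieldNormedType.Exports.
Local Open Scope classical_set_scope.
Local Open Scope ring_scope.
Local Open Scope complex_scope.

(** The only non-degeneracy demanded is that a0 not vanish, which leaves room for g = 0. With m =
    |grad al|^2 and k2 = kappa^2 / mu0, separation asks that Delta H + k2 H = - m (q_a(al) +
    q_b(be)) H. In the linear case m = 1 and H is constant, so the constant k2 can be handed to one
    of the two equations. In the logarithmic case m = |x - x0|^(-2) = e^(2 al), so k2 = m k2 e^(-2
    al) goes to X, while Delta H = - (3/4) H / r^2 goes to Z because |x - x0|^2 / r^2 = 1 + cot^2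
    be. The exponent -3/2 is forced: transport along al = - log |x - x0| asks for homogeneity of
    degree -1/2 about x0, and N has degree 1. The obstacle is uniformity in tau, since the
    differential equations are stiff. Initial data for e are put at the left end of the range of al
    or be: to the right of it the leading homogeneous solution e^(sigma tau x), with sigma = -2 or
    -2 i, does not grow. All estimates are pointwise; third derivatives of the remainder then stay
    bounded, which is exactly what the interior estimate asks for. *)

Section ComplexDerivative.
Context {R : realType} {V : normedModType R}.
Implicit Types (x v : V) (f g : V -> R[i]) (c d e : R[i]).

Lemma cReM c d : complex.Re (c * d) =
  complex.Re c * complex.Re d - complex.Im c * complex.Im d.
Proof. by case: c; case: d. Qed.

Lemma cImM c d : complex.Im (c * d) =
  complex.Re c * complex.Im d + complex.Im c * complex.Re d.
Proof. by case: c; case: d. Qed.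

Lemma cReD c d : complex.Re (c + d) = complex.Re c + complex.Re d.
Proof. by case: c; case: d. Qed.

Lemma cImD c d : complex.Im (c + d) = complex.Im c + complex.Im d.
Proof. by case: c; case: d. Qed.

Lemma cReN c : complex.Re (- c) = - complex.Re c.
Proof. by case: c. Qed.

Lemma cImN c : complex.Im (- c) = - complex.Im c.
Proof. by case: c. Qed.

Lemma complex_ext c d : complex.Re c = complex.Re d ->
  complex.Im c = complex.Im d -> c = d.
Proof. by case: c; case: d => ? ? ? ? /= -> ->. Qed.

(** A directional derivative is a derivative at 0 along a line, so that the chain rule of one
    variable also serves in a normed space. *)
Lemma is_derive_line x v (f : V -> R) (d : R) :
  is_derive (0 : R) 1 (fun h => f (h *: v + x)) d <-> is_derive x v f d.
Proof.
have E : 'D_v f x = 'D_1 (fun h : R => f (h *: v + x)) 0.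
  rewrite /derive /=.
  suff -> : (fun h : R => h^-1 *: (f (h *: v + x) - f x)) =
      (fun h : R => h^-1 *: (f ((h *: (1 : R) + 0 : R) *: v + x) - f (0 *: v + x))) by [].
  by apply/funext => h; rewrite scale0r add0r addr0 /GRing.scale /= mulr1.
split=> -[h <-]; rewrite -?E ?E; split=> //; first exact/derivable1P.
by move/derivable1P: h.
Qed.

Lemma is_derive_comp_real (g : R -> R) (p : V -> R) x v (d e : R) :
  is_derive (p x) 1 g d -> is_derive x v p e ->
  is_derive x v (fun y => g (p y)) (d * e).
Proof.
move=> dg /is_derive_line dp; apply/is_derive_line.
apply: (@is_derive1_comp R g (fun h => p (h *: v + x)) 0) => //.
by rewrite scale0r add0r.
Qed.

(** Differentiation along a real direction, taken on real and imaginary parts separately to agree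
    with [cpartial]. *)
Definition cder x v f d : Prop :=
  is_derive x v (fun y => complex.Re (f y)) (complex.Re d) /\
  is_derive x v (fun y => complex.Im (f y)) (complex.Im d).

Lemma cder_eq x v f d e : cder x v f d -> d = e -> cder x v f e.
Proof. by move=> ? <-. Qed.

Lemma cder_cst x v c : cder x v (fun=> c) 0.
Proof. by split; exact: is_derive_cst. Qed.

Lemma cderD x v f g d e : cder x v f d -> cder x v g e ->
  cder x v (fun y => f y + g y) (d + e).
Proof.
move=> [f1 f2] [g1 g2]; split.
  rewrite (_ : (fun y => _) =
    (fun y => complex.Re (f y)) + (fun y => complex.Re (g y))) ?cReD.
    exact: is_deriveD.
  by apply/funext => y; rewrite cReD.
rewrite (_ : (fun y => _) =
  (fun y => complex.Im (f y)) + (fun y => complex.Im (g y))) ?cImD.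
  exact: is_deriveD.
by apply/funext => y; rewrite cImD.
Qed.

Lemma cderM x v f g d e : cder x v f d -> cder x v g e ->
  cder x v (fun y => f y * g y) (d * g x + f x * e).
Proof.
move=> [f1 f2] [g1 g2]; split.
  rewrite (_ : (fun y => _) =
    (fun y => complex.Re (f y)) * (fun y => complex.Re (g y)) -
    (fun y => complex.Im (f y)) * (fun y => complex.Im (g y))).
    apply: (is_derive_eq (is_deriveB (is_deriveM f1 g1) (is_deriveM f2 g2))).
    by rewrite cReD !cReM /GRing.scale /=; ring.
  by apply/funext => y; rewrite cReM.
rewrite (_ : (fun y => _) =
  (fun y => complex.Re (f y)) * (fun y => complex.Im (g y)) +
  (fun y => complex.Im (f y)) * (fun y => complex.Re (g y))).
  apply: (is_derive_eq (is_deriveD (is_deriveM f1 g2) (is_deriveM f2 g1))).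
  by rewrite cImD !cImM /GRing.scale /=; ring.
by apply/funext => y; rewrite cImM.
Qed.

Lemma cderMl x v f c d : cder x v f d -> cder x v (fun y => c * f y) (c * d).
Proof.
move=> df; apply: cder_eq (cderM (cder_cst x v c) df) _.
by rewrite mul0r add0r.
Qed.

Lemma cder_real x v (f : V -> R) (d : R) : is_derive x v f d ->
  cder x v (fun y => (f y)%:C) d%:C.
Proof. by move=> df; split => //=; exact: is_derive_cst. Qed.

End ComplexDerivative.

Lemma cder_comp {R : realType} {V : normedModType R} (x v : V)
    (g : R -> R[i]) (p : V -> R) (d : R[i]) (e : R) :
  cder (p x) 1 g d -> is_derive x v p e ->
  cder x v (fun y => g (p y)) (d * e%:C).
Proof.
move=> [g1 g2] dp; split.
  apply: (is_derive_eq (is_derive_comp_real g1 dp)).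
  by rewrite cReM /= mulr0 subr0.
apply: (is_derive_eq (is_derive_comp_real g2 dp)).
by rewrite cImM /= mulr0 add0r.
Qed.

(** * Antiderivatives on the real line and their weighted bounds *)

Section OneVariable.
Context {R : realType}.
Implicit Types (f g F : R -> R) (x y a c l : R).

Lemma is_derive1_continuous f x d : is_derive x 1 f d -> {for x, continuous f}.
Proof.
by move=> [fx _]; apply/differentiable_continuous/derivable1_diffP.
Qed.

Lemma is_derive_nondecreasing f f' a b : a <= b ->
  (forall x, a <= x <= b -> is_derive x 1 f (f' x)) ->
  (forall x, a <= x <= b -> 0 <= f' x) -> f a <= f b.
Proof.
move=> ab df f0; have [c] : exists2 c, c \in `[a, b] & f b - f a = f' c * (b - a).
  apply: MVT_segment => //.
    move=> x; rewrite in_itv /= => /andP[ax xb].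
    by apply: df; rewrite (ltW ax) (ltW xb).
  apply/continuous_in_subspaceT => x; rewrite inE /= in_itv /= => /df.
  exact: is_derive1_continuous.
rewrite in_itv /= => /f0 fc E.
by rewrite -subr_ge0 E mulr_ge0 // subr_ge0.
Qed.

(* The exponential weight that makes the Picard iteration contract on the whole line. *)
Definition wcosh (a l x : R) : R := expR (l * (x - a)) + expR (- (l * (x - a))).

Lemma wcosh_gt0 a l x : 0 < wcosh a l x.
Proof. by rewrite addr_gt0 // expR_gt0. Qed.

Lemma is_derive_expR_lin (l a x : R) :
  is_derive x 1 (fun y => expR (l * (y - a))) (l * expR (l * (x - a))).
Proof.
have h : is_derive x 1 (fun y => l * (y - a)) l.
  have h1 : is_derive x (1:R) (l *: (id - cst a)) (l *: (1 - 0)).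
    exact: is_deriveZ.
  rewrite (_ : (fun y => l * (y - a)) = l *: (id - cst a)) //.
  by apply: is_derive_eq h1 _; rewrite subr0 /GRing.scale /= mulr1.
have := @is_derive1_comp R expR (fun y => l * (y - a)) x _ _ (is_derive_expR _) h.
by rewrite mulrC.
Qed.

(** Integration gains a factor 1 / l in the norm weighted by [wcosh]. The comparison function [G] is
    the antiderivative of c [wcosh] that vanishes at a, a multiple of a hyperbolic sine; [G - F] and
    [G + F] are both nondecreasing and vanish at a. *)
Lemma derive_le_wcosh F f a c l : 0 < l ->
  (forall x, is_derive x 1 F (f x)) -> F a = 0 ->
  (forall x, `|f x| <= c * wcosh a l x) ->
  forall x, `|F x| <= c / l * wcosh a l x.
Proof.
move=> l0 dF Fa fc x.
have c0 : 0 <= c.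
  by have := le_trans (normr_ge0 _) (fc a); rewrite pmulr_lge0 // wcosh_gt0.
pose G y := c / l * (expR (l * (y - a)) - expR (- (l * (y - a)))).
have dG y : is_derive y 1 G (c * wcosh a l y).
  have h1 := is_derive_expR_lin l a y.
  have h2 := is_derive_expR_lin (- l) a y.
  rewrite (_ : G = (c / l) *: ((fun z => expR (l * (z - a)))
     - (fun z => expR (- l * (z - a))))); last first.
    by apply/funext => z; rewrite /G /GRing.scale /= /GRing.scale /= !fctE mulNr.
  apply: is_derive_eq; rewrite /wcosh /GRing.scale /= -(mulNr l).
  by field; exact: lt0r_neq0.
have Ga : G a = 0 by rewrite /G subrr mulr0 oppr0 expR0 subrr mulr0.
have dD y : is_derive y 1 (G - F) (c * wcosh a l y - f y) by exact: is_deriveB.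
have dS y : is_derive y 1 (G + F) (c * wcosh a l y + f y) by exact: is_deriveD.
have D0 y : 0 <= c * wcosh a l y - f y.
  by rewrite subr_ge0 (le_trans (ler_norm _)).
have S0 y : 0 <= c * wcosh a l y + f y.
  by rewrite -(opprK (f y)) subr_ge0 (le_trans (ler_norm _)) // normrN.
have FG : `|F x| <= `|G x|.
  have [ax|/ltW xa] := leP a x.
    have h1 : (G - F) a <= (G - F) x by apply: (@is_derive_nondecreasing _ (fun y => c * wcosh a l y - f y)).
    have h2 : (G + F) a <= (G + F) x by apply: (@is_derive_nondecreasing _ (fun y => c * wcosh a l y + f y)).
    move: h1 h2; rewrite !fctE Ga Fa => h1 h2.
    by apply: le_trans (ler_norm _); rewrite ler_norml; lra.
  have h1 : (G - F) x <= (G - F) a by apply: (@is_derive_nondecreasing _ (fun y => c * wcosh a l y - f y)).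
  have h2 : (G + F) x <= (G + F) a by apply: (@is_derive_nondecreasing _ (fun y => c * wcosh a l y + f y)).
  move: h1 h2; rewrite !fctE Ga Fa => h1 h2.
  by rewrite -(normrN (G x)); apply: le_trans (ler_norm _); rewrite ler_norml; lra.
apply: le_trans FG _; rewrite /G normrM ger0_norm ?divr_ge0 ?(ltW l0) //.
apply: ler_wpM2l; first by rewrite divr_ge0 ?(ltW l0).
rewrite /wcosh ler_norml.
have := expR_gt0 (l * (x - a)); have := expR_gt0 (- (l * (x - a))); lra.
Qed.

(** The bounded support makes f integrable on every left half-line, so the integral from -oo is an
    antiderivative on the whole line, on both sides of a. *)
Lemma primitive f c d a : continuous f ->
  (forall x, ~~ (c <= x <= d) -> f x = 0) ->
  exists2 F : R -> R, F a = 0 & forall x, is_derive x 1 F (f x).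
Proof.
move=> cf f0.
pose mu := @lebesgue_measure R.
have intf y : mu.-integrable `]-oo, y] (EFin \o f).
  have h : mu.-integrable `[c, d] (EFin \o f).
    apply: continuous_compact_integrable; first exact: segment_compact.
    exact: continuous_subspaceT.
  apply: (@integrableS _ _ _ _ setT) => //.
  rewrite (_ : EFin \o f = ((EFin \o f) \_ `[c, d])); last first.
    apply/funext => x; rewrite /patch; case: ifPn => //.
    by rewrite notin_setE /= in_itv /= => /negP xcd; rewrite f0.
  by rewrite -integrable_restrict // setTI.
pose F x := (\int[mu]_(t in `]-oo, x]) f t)%R.
exists (F - cst (F a)); first by rewrite !fctE subrr.
move=> x; have [h1 h2] : derivable F x 1 /\ F^`()%classic x = f x.
  apply: (@continuous_FTC1 _ f -oo%O x (x + 1)) ; do ?[exact: intf|exact: cf|exact: ltNyr|by rewrite ltrDl ltr01].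
have h : is_derive x 1 F (f x) by rewrite -h2 derive1E; exact: derivableP.
by apply: is_derive_eq; rewrite subr0.
Qed.

End OneVariable.

(** * Linear differential equations *)

Lemma cvg_sum_seq {R : realType} {T : Type} (F : set_system T) {FF : Filter F}
    (I : Type) (r : seq I) (f : I -> T -> R) (l : I -> R) :
  (forall i, f i x @[x --> F] --> l i) ->
  (\sum_(i <- r) f i x) @[x --> F] --> \sum_(i <- r) l i.
Proof.
move=> fl; elim: r => [|i r IH].
  rewrite big_nil; under eq_fun do rewrite big_nil; exact: cvg_cst.
rewrite big_cons; under eq_fun do rewrite big_cons; exact: cvgD.
Qed.

Section Picard.
Context {R : realType} (n : nat) (A : 'I_n -> 'I_n -> R -> R) (c d a L : R).
Hypothesis A_cont : forall i j, continuous (A i j).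
Hypothesis A_supp : forall i j x, ~~ (c <= x <= d) -> A i j x = 0.
Hypothesis L_gt0 : 0 < L.
Hypothesis A_bound : forall i x, \sum_j `|A i j x| <= L.

(** The right-hand side costs a factor L and the integration gains 1 / (2 L): the rate is chosen so
    that each step halves the weighted norm. *)
Let W := wcosh a (2 * L).
Let rhs (Y : 'I_n -> R -> R) i x := \sum_j A i j x * Y j x.

Let rhs_cont (Y : 'I_n -> R -> R) : (forall j, continuous (Y j)) -> forall i, continuous (rhs Y i).
Proof.
move=> cY i x; apply: cvg_sum_seq => j.
by apply: cvgM; [exact: A_cont|exact: cY].
Qed.

Let rhs_bound (Y : 'I_n -> R -> R) (x b : R) i : (forall j, `|Y j x| <= b) -> `|rhs Y i x| <= L * b.
Proof.
move=> Yb; apply: le_trans (ler_norm_sum _ _ _) _.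
have b0 : 0 <= b by exact: le_trans (normr_ge0 _) (Yb i).
apply: le_trans (_ : (\sum_j `|A i j x|) * b <= _); last exact: ler_wpM2r.
rewrite mulr_suml; apply: ler_sum => j _; rewrite normrM.
exact: ler_wpM2l.
Qed.

Let rhs_prim (Y : 'I_n -> R -> R) : (forall j, continuous (Y j)) -> forall i, exists F : R -> R,
  F a = 0 /\ forall x : R, is_derive x 1 F (rhs Y i x).
Proof.
move=> cY i; have [||F F0 dF] := @primitive R (rhs Y i) c d a; first exact: rhs_cont.
  by move=> x xcd; apply: big1 => j _; rewrite A_supp // mul0r.
by exists F.
Qed.

Let step (Y : 'I_n -> R -> R) : 'I_n -> R -> R := fun i =>
  get [set F : R -> R | F a = 0 /\ forall x : R, is_derive x 1 F (rhs Y i x)].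

Let stepP (Y : 'I_n -> R -> R) : (forall j, continuous (Y j)) -> forall i,
  step Y i a = 0 /\ forall x : R, is_derive x 1 (step Y i) (rhs Y i x).
Proof. by move=> cY i; have := getPex (rhs_prim cY i). Qed.

Variable y0 : 'I_n -> R.
(** These are the terms of the Neumann series; the Picard iterates are their partial sums [S]. *)
Let y k : 'I_n -> R -> R := iter k step (fun i => cst (y0 i)).

Let y_cont k j : continuous (y k j).
Proof.
elim: k j => [|k IH] j x; first exact: cvg_cst.
have [_ /(_ x) h] := stepP IH j; exact: is_derive1_continuous h.
Qed.

Let C : R := \sum_i `|y0 i|.

Let y_bound k i (x : R) : `|y k i x| <= C * 2^-1 ^+ k * W x.
Proof.
have W1 z : 1 <= W z.
  rewrite /W /wcosh; set u := _ * (_ - _); have [u0|u0] := leP 0 u.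
    rewrite -[leLHS]addr0; apply: lerD; last exact: expR_ge0.
    by apply: le_trans (expR_ge1Dx _); rewrite lerDl.
  rewrite -[leLHS]add0r; apply: lerD; first exact: expR_ge0.
  by apply: le_trans (expR_ge1Dx _); rewrite lerDl oppr_ge0 ltW.
elim: k i x => [|k IH] i x.
  rewrite expr0 mulr1 /y /= /C (bigD1 i) //=.
  apply: le_trans (_ : (`|y0 i| + \sum_(j | j != i) `|y0 j|) * 1 <= _).
    by rewrite mulr1 lerDl sumr_ge0.
  by rewrite ler_wpM2l // addr_ge0 // sumr_ge0.
have [h0 hd] := stepP (@y_cont k) i.
have := @derive_le_wcosh R _ _ a (L * (C * 2^-1 ^+ k)) (2 * L) _ hd h0.
rewrite /y iterS -/(y k) => /(_ _ _ x) h.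
have -> : C * 2^-1 ^+ k.+1 = L * (C * 2^-1 ^+ k) / (2 * L).
  by rewrite exprS; field; exact: lt0r_neq0.
apply: h; first by rewrite mulr_gt0.
by move=> z; rewrite -mulrA; apply: rhs_bound => j; exact: IH.
Qed.

Let S N i (x : R) : R := \sum_(k < N) y k i x.

Let S_cont N i : continuous (S N i).
Proof. by move=> x; apply: cvg_sum_seq => k; exact: y_cont. Qed.

Let dS N i (x : R) : is_derive x 1 (S N.+1 i) (rhs (S N) i x).
Proof.
have h : is_derive x (1:R) (\sum_(k < N) y k.+1 i) (\sum_(k < N) rhs (y k) i x).
  apply: is_derive_sum => k; have [_] := stepP (@y_cont k) i; exact.
rewrite (_ : S N.+1 i = cst (y0 i) + \sum_(k < N) y k.+1 i); last first.
  apply/funext => z; rewrite /S big_ord_recl !fctE; congr (_ + _).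
  by rewrite fct_sumE.
have h2 := is_deriveD (is_derive_cst (y0 i) x (1:R)) h.
apply: is_derive_eq h2 _; rewrite add0r /rhs exchange_big /=.
by apply: eq_bigr => j _; rewrite /S mulr_sumr.
Qed.

Let Sa N i : S N.+1 i a = y0 i.
Proof.
rewrite /S big_ord_recl /= big1 ?addr0 // => k _.
by have [] := stepP (@y_cont k) i.
Qed.

Let half_sum (N m : nat) :
  \sum_(k < m) 2^-1 ^+ (N + k) <= 2 * 2^-1 ^+ N :> R.
Proof.
suff -> : \sum_(k < m) 2^-1 ^+ (N + k) = 2 * 2^-1 ^+ N - 2 * 2^-1 ^+ (N + m) :> R.
  by rewrite gerBl mulr_ge0 // exprn_ge0.
elim: m => [|m IH]; first by rewrite big_ord0 addn0 subrr.
by rewrite big_ord_recr /= IH addnS exprS; field.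
Qed.

Let C_ge0 : 0 <= C. Proof. by rewrite /C sumr_ge0. Qed.

Let S_diff N m i (x : R) :
  `|S (N + m) i x - S N i x| <= 2 * C * 2^-1 ^+ N * W x.
Proof.
rewrite /S big_split_ord /= [X in X - _]addrC addrK.
apply: le_trans (ler_norm_sum _ _ _) _.
apply: le_trans (_ : \sum_(k < m) C * W x * 2^-1 ^+ (N + k) <= _).
  by apply: ler_sum => k _; apply: le_trans (y_bound _ _ _) _; rewrite mulrAC.
rewrite -mulr_sumr; apply: le_trans (ler_wpM2l _ (half_sum _ _)) _.
  by rewrite mulr_ge0 // ltW // wcosh_gt0.
by rewrite le_eqVlt; apply/orP; left; apply/eqP; ring.
Qed.

Let geo0 (b : R) : 2 * C * 2^-1 ^+ k * b @[k --> \oo] --> (0 : R).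
Proof.
rewrite -[X in _ --> X](mul0r b); apply: cvgMr_tmp.
rewrite -[X in _ --> X](mulr0 (2 * C)); apply: cvgMl_tmp.
by apply: cvg_expr; rewrite ger0_norm // invf_lt1 // ltr1n.
Qed.

Let Y_lim i (x : R) : R := limn (fun N => S N i x).

Let Y_lim_cvg i (x : R) : (fun N => S N i x) @ \oo --> Y_lim i x.
Proof.
suff : cvgn (fun N => S N i x) by [].
rewrite (_ : (fun N => S N i x) = series (fun k => y k i x)); last first.
  by apply/funext => N; rewrite /series /= big_mkord.
apply: normed_cvg; apply: (@series_le_cvg _ _ (geometric (C * W x) 2^-1)) => //.
- by move=> k; exact: normr_ge0.
- move=> k; rewrite /geometric /=; apply: mulr_ge0; last exact: exprn_ge0.
  by apply: mulr_ge0 => //; exact/ltW/wcosh_gt0.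
- by move=> k; rewrite /=; apply: le_trans (y_bound _ _ _) _; rewrite /geometric /= mulrAC.
by apply: is_cvg_geometric_series; rewrite ger0_norm // invf_lt1 // ltr1n.
Qed.

Let Y_lim_bound N i (x : R) : `|S N i x - Y_lim i x| <= 2 * C * 2^-1 ^+ N * W x.
Proof.
rewrite distrC; have : (fun m => `|S (m + N) i x - S N i x|) @ \oo --> `|Y_lim i x - S N i x|.
  apply: cvg_norm; apply: cvgB; last exact: cvg_cst.
  by rewrite (cvg_shiftn N (fun m => S m i x)); exact: Y_lim_cvg.
move/cvgr_to_le; apply; apply: nearW => m.
by rewrite addnC; exact: S_diff.
Qed.

Let W_cont : continuous W.
Proof.
move=> x; apply: cvgD.
  exact: is_derive1_continuous (is_derive_expR_lin (2 * L) a x).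
rewrite /continuous_at; under eq_fun do rewrite -mulNr; rewrite -mulNr.
exact: is_derive1_continuous (is_derive_expR_lin (- (2 * L)) a x).
Qed.

Let Y_lim_cont i : continuous (Y_lim i).
Proof.
move=> x; apply/cvgrPdist_lt => e e0.
have e30 : 0 < e / 3 by rewrite divr_gt0.
(* The convergence is uniform only where W is bounded, so N is chosen for the level W x + 1, below
   which W stays near x. *)
have [N _ /(_ N (leqnn N))] := (cvgrPdist_lt _ _).1 (geo0 (W x + 1)) _ e30.
rewrite /= sub0r normrN => hN.
have Wx : \forall z \near x, W z < W x + 1.
  by have /cvgr_lt := @W_cont x; apply; rewrite ltrDl.
have Sx : \forall z \near x, `|S N i x - S N i z| < e / 3.
  by have /cvgrPdist_lt := @S_cont N i x; apply.
have B0 : 0 <= 2 * C * 2^-1 ^+ N by rewrite mulr_ge0 ?exprn_ge0 // mulr_ge0.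
have hW z : W z <= W x + 1 -> `|S N i z - Y_lim i z| < e / 3.
  move=> Wz; apply: le_lt_trans (Y_lim_bound N i z) _; apply: le_lt_trans hN.
  by apply: le_trans (ler_norm _); exact: ler_wpM2l.
near=> z.
have h1 : `|S N i x - Y_lim i x| < e / 3 by apply: hW; rewrite lerDl.
have h2 : `|S N i z - Y_lim i z| < e / 3 by apply: hW; apply: ltW; near: z.
have h3 : `|S N i x - S N i z| < e / 3 by near: z.
move: h1 h2 h3; rewrite !ltr_norml; lra.
Unshelve. all: by end_near. Qed.

Lemma picard : exists Z : 'I_n -> R -> R,
  forall i, Z i a = y0 i /\
    forall x : R, is_derive x 1 (Z i) (\sum_j A i j x * Z j x).
Proof.
exists Y_lim => i; have [F [F0 dF]] := rhs_prim Y_lim_cont i.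
(* It suffices that the limit satisfies the integral equation. Both sides are limits of [S N.+1]:
   its distance to F + y0 is controlled by integrating the distance of [S N] to the limit. *)
suff -> : Y_lim i = F + cst (y0 i).
  split=> [|x]; first by rewrite fctE F0 add0r.
  by apply: is_derive_eq (is_deriveD (dF x) (is_derive_cst _ _ _)) _; rewrite addr0.
apply/funext => x; rewrite fctE.
have h N : `|S N.+1 i x - (F x + y0 i)| <= 2 * C * 2^-1 ^+ N * (2^-1 * W x).
  pose D := S N.+1 i - (F + cst (y0 i)).
  have dD (z : R) : is_derive z 1 D (rhs (fun j => S N j - Y_lim j) i z).
    apply: is_derive_eq (is_deriveB (dS N i z) (is_deriveD (dF z) (is_derive_cst _ _ _))) _.
    by rewrite addr0 /rhs -sumrB; apply: eq_bigr => j _; rewrite -mulrBr.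
  have Da : D a = 0 by rewrite /D !fctE Sa F0 add0r subrr.
  have := @derive_le_wcosh R _ _ a (L * (2 * C * 2^-1 ^+ N)) (2 * L) _ dD Da.
  move=> /(_ _ _ x) hh.
  have -> : 2 * C * 2^-1 ^+ N * (2^-1 * W x)
      = L * (2 * C * 2^-1 ^+ N) / (2 * L) * W x.
    by field; exact: lt0r_neq0.
  apply: hh; first by rewrite mulr_gt0.
  by move=> z; rewrite -mulrA; apply: rhs_bound => j; exact: Y_lim_bound.
have l1 : (fun N => `|S N.+1 i x - (F x + y0 i)|) @ \oo --> `|Y_lim i x - (F x + y0 i)|.
  apply: cvg_norm; apply: cvgB; last exact: cvg_cst.
  by rewrite (cvg_shiftS (fun m => S m i x)); exact: Y_lim_cvg.
have : `|Y_lim i x - (F x + y0 i)| <= 0.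
  by apply: (ler_cvg_to l1 (geo0 (2^-1 * W x))); exact: nearW.
by rewrite normr_le0 subr_eq0 => /eqP.
Qed.

End Picard.

(** * Second-order linear equations and Gronwall's inequality *)

Section SecondOrder.
Context {R : realType}.
Implicit Types (q f : R -> R) (a b x : R).

Lemma segment_bounded f a b :
  (forall x, a <= x <= b -> {for x, continuous f}) ->
  exists2 M, 0 <= M & forall x, a <= x <= b -> `|f x| <= M.
Proof.
move=> cf; have [ab|ba] := leP a b; last first.
  exists 0 => // x /andP[ax xb]; have := le_lt_trans (le_trans ax xb) ba.
  by rewrite ltxx.
have cnf : {within `[a, b], continuous (fun x => `|f x|)}.
  apply/continuous_in_subspaceT => x; rewrite inE /= in_itv /= => /cf cfx.
  by apply: continuous_comp; [exact: cfx|exact: norm_continuous].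
have [c _ fc] := EVT_max ab cnf; exists `|f c| => // x xab.
Qed.

Definition clamp a b x := Num.max a (Num.min b x).

Lemma clamp_in a b x : a <= b -> a <= clamp a b x <= b.
Proof.
by move=> ab; rewrite /clamp le_max lexx /= ge_max ab /= ge_min lexx.
Qed.

Lemma clampE a b x : a <= x <= b -> clamp a b x = x.
Proof. by move=> /andP[ax xb]; rewrite /clamp min_r // max_r. Qed.

Lemma clamp_continuous a b : continuous (clamp a b).
Proof.
move=> x; apply: continuous_max; first exact: cvg_cst.
by apply: continuous_min; [exact: cvg_cst|exact: cvg_id].
Qed.

(** [picard] needs coefficients that are continuous on the whole line and vanish outside a segment.
    Extending q by its end values and multiplying by a cut-off changes nothing on [a, b]. *)
Lemma linear_ode2 q a b (p y0 y1 : R[i]) : a <= b ->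
  (forall x, a <= x <= b -> {for x, continuous q}) ->
  exists Y0 Y1 : R -> R[i], [/\ Y0 a = y0, Y1 a = y1 &
    forall x, a <= x <= b ->
      cder x 1 Y0 (Y1 x) /\ cder x 1 Y1 (p * Y1 x + (q x)%:C * Y0 x)].
Proof.
move=> ab cq.
(* A trapezoid: 1 on [a, b], 0 outside [a - 1, b + 1]. *)
pose chi x : R := clamp 0 1 (Num.min (x - (a - 1)) (b + 1 - x)).
have chi_cont : continuous chi.
  move=> x; apply: (@continuous_comp _ _ _
    ((fun x => x - (a - 1)) \min (fun x => b + 1 - x)) (clamp 0 1)).
    by apply: continuous_min; apply: cvgB; [exact: cvg_id|exact: cvg_cst..|exact: cvg_id].
  exact: clamp_continuous.
have chi_supp x : ~~ (a - 1 <= x <= b + 1) -> chi x = 0.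
  move=> h; rewrite /chi /clamp max_l // ge_min; apply/orP; right.
  by rewrite ge_min; apply/orP; move: h; rewrite negb_and -!ltNge; case/orP => h;
    [left|right]; lra.
have chi1 x : a <= x <= b -> chi x = 1.
  move=> /andP[ax xb]; rewrite /chi /clamp min_l ?max_r ?ler01 //.
  by rewrite le_min; apply/andP; split; lra.
have chi_bound x : `|chi x| <= 1.
  have /andP[h1 h2] := @clamp_in 0 1 (Num.min (x - (a - 1)) (b + 1 - x)) ler01.
  by rewrite ger0_norm.
pose qt x := q (clamp a b x).
have qt_cont : continuous qt.
  move=> x; apply: (@continuous_comp _ _ _ (clamp a b) q).
    exact: clamp_continuous.
  exact/cq/clamp_in.
have [M M0 qM] := segment_bounded cq.
have qtM x : `|qt x| <= M by apply: qM; exact: clamp_in.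
(* The real system for (Re Y0, Im Y0, Re Y1, Im Y1); the block formed by Re p and Im p is
   multiplication by p. *)
pose B (i j : 'I_4) (x : R) : R :=
  match nat_of_ord i, nat_of_ord j with
  | 0, 2 => 1 | 1, 3 => 1 | 2, 0 => qt x | 3, 1 => qt x
  | 2, 2 => complex.Re p | 3, 3 => complex.Re p
  | 2, 3 => - complex.Im p | 3, 2 => complex.Im p
  | _, _ => 0 end.
pose K := 1 + M + `|complex.Re p| + `|complex.Im p|.
have K0 : 0 < K by rewrite /K ltr_wpDr // ltr_wpDr // ltr_wpDr.
have BK i j x : `|B i j x| <= K.
  have := qtM x; have := normr_ge0 (complex.Re p); have := normr_ge0 (complex.Im p).
  rewrite /K /B; case: i => [[|[|[|[|i]]]]] hi //=;
   case: j => [[|[|[|[|j]]]]] hj //=; rewrite ?normr0 ?normr1 ?normrN; lra.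
have B_cont i j : continuous (B i j).
  move=> x; rewrite /B; case: i => [[|[|[|[|i]]]]] hi //=;
   case: j => [[|[|[|[|j]]]]] hj //=; by [exact: cvg_cst|exact: qt_cont].
pose A i j x := chi x * B i j x.
(* A row has four entries, each at most K, whence the bound [K *+ 4]. *)
have [||||Z hZ] := @picard R 4 A (a - 1) (b + 1) a (K *+ 4) _ _ _ _
  (fun i => nth 0 [:: complex.Re y0; complex.Im y0; complex.Re y1; complex.Im y1] i).
- by move=> i j x; apply: cvgM; [exact: chi_cont|exact: B_cont].
- by move=> i j x /chi_supp; rewrite /A => ->; rewrite mul0r.
- by rewrite pmulrn_lgt0.
- move=> i x; apply: le_trans (_ : \sum_(j < 4) K <= _).
    apply: ler_sum => j _; rewrite normrM -[leRHS]mul1r.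
    by apply: ler_pM.
  by rewrite sumr_const card_ord.
pose o (k : nat) : 'I_4 := inord k.
have oE k (hk : (k < 4)%N) : nat_of_ord (o k) = k by rewrite inordK.
exists (fun x => Z (o 0%N) x +i* Z (o 1%N) x), (fun x => Z (o 2%N) x +i* Z (o 3%N) x).
have Z0 k : Z (o k) a = nth 0 [:: complex.Re y0; complex.Im y0; complex.Re y1; complex.Im y1] (o k).
  by have [-> _] := hZ (o k).
split.
- by rewrite !Z0 !oE //=; case: (y0).
- by rewrite !Z0 !oE //=; case: (y1).
move=> x xab.
have dZ (k : nat) : (k < 4)%N -> is_derive x 1 (Z (o k))
   (\sum_(j < 4) B (o k) j x * Z j x).
  move=> hk; have [_ /(_ x)] := hZ (o k).
  suff -> : \sum_(j < 4) A (o k) j x * Z j x = \sum_(j < 4) B (o k) j x * Z j x by [].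
  by apply: eq_bigr => j _; rewrite /A chi1 // mul1r.
have ZE j : Z j = Z (o j) by congr Z; apply: val_inj; rewrite /= oE.
have qE : qt x = q x by rewrite /qt clampE.
have sumE (k : nat) : (k < 4)%N -> \sum_(j < 4) B (o k) j x * Z j x =
   B (o k) (o 0%N) x * Z (o 0%N) x + B (o k) (o 1%N) x * Z (o 1%N) x
   + B (o k) (o 2%N) x * Z (o 2%N) x + B (o k) (o 3%N) x * Z (o 3%N) x.
  move=> hk; rewrite !big_ord_recr big_ord0 /= add0r.
  by congr (_ * _ + _ * _ + _ * _ + _ * _); (congr (B _ _ _) || congr (Z _ _));
    apply: val_inj; rewrite /= oE.
split; split.
- apply: is_derive_eq (dZ 0%N isT) _; rewrite sumE // /B !oE //=; ring.
- apply: is_derive_eq (dZ 1%N isT) _; rewrite sumE // /B !oE //=; ring.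
- apply: is_derive_eq (dZ 2%N isT) _; rewrite cReD. rewrite !cReM sumE // /B !oE //= qE; ring.
- apply: is_derive_eq (dZ 3%N isT) _; rewrite cImD !cImM sumE // /B !oE //= qE; ring.
Qed.

Lemma gronwall (E E' : R -> R) a b K B : 0 <= K -> 0 <= B -> E a <= 0 ->
  (forall x, a <= x <= b -> is_derive x 1 E (E' x)) ->
  (forall x, a <= x <= b -> E' x <= K * E x + B) ->
  forall x, a <= x <= b -> E x <= B * (b - a) * expR (K * (b - a)).
Proof.
move=> K0 B0 Ea dE hE x /andP[ax xb].
(* The integrating factor turns the hypothesis into monotonicity of [G], which is nonnegative at a
   because E a <= 0. *)
pose G y := B * (y - a) - E y * expR (- K * (y - a)).
pose G' y := B - (E' y - K * E y) * expR (- K * (y - a)).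
have dG y : a <= y <= x -> is_derive y 1 G (G' y).
  move=> /andP[ay yx].
  have dEy : is_derive y 1 E (E' y) by apply: dE; rewrite ay (le_trans yx).
  have h1 := is_derive_expR_lin (- K) a y.
  have h2 : is_derive y 1 (B *: (id - cst a)) (B *: (1 - 0)).
    exact: is_deriveZ.
  apply: is_derive_eq (is_deriveB h2 (is_deriveM dEy h1)) _.
  by rewrite /G' /GRing.scale /=; ring.
have G'0 y : a <= y <= x -> 0 <= G' y.
  move=> /andP[ay yx]; rewrite /G' subr_ge0.
  have hEy : E' y - K * E y <= B.
    by have := hE y; rewrite ay (le_trans yx) // => /(_ isT); lra.
  apply: le_trans (_ : B * expR (- K * (y - a)) <= _).
    by apply: ler_wpM2r => //; exact: expR_ge0.
  apply: ler_piMr => //; rewrite -expR0 ler_expR mulNr oppr_le0.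
  by rewrite mulr_ge0 // subr_ge0.
have := is_derive_nondecreasing ax dG G'0.
rewrite /G subrr !mulr0 expR0 mulr1 add0r => h.
have {h} : E x * expR (- K * (x - a)) <= B * (b - a).
  apply: le_trans (_ : B * (x - a) <= _); first lra.
  by apply: ler_wpM2l => //; lra.
move=> /(ler_wpM2r (expR_ge0 (K * (x - a)))).
have e1 : expR (- K * (x - a)) * expR (K * (x - a)) = 1.
  by rewrite -expRD mulNr addNr expR0.
rewrite -[X in X <= _]mulrA e1 mulr1 => /le_trans; apply.
apply: ler_wpM2l; first by rewrite mulr_ge0 // subr_ge0 (le_trans ax).
by rewrite ler_expR ler_wpM2l //; lra.
Qed.

End SecondOrder.

(** * A real-valued norm on the complex numbers *)

Section Cnorm.
Context {R : realType}.
Implicit Types (z w : R[i]).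

(** The l1 norm lies in R, unlike the norm of [R[i]]; it is submultiplicative, dominates both parts,
    and compares with the Euclidean energy up to the factor 2. *)
Definition cnorm z : R := `|complex.Re z| + `|complex.Im z|.

Lemma cnorm_ge0 z : 0 <= cnorm z.
Proof. by rewrite addr_ge0. Qed.

Lemma cnormD z w : cnorm (z + w) <= cnorm z + cnorm w.
Proof.
rewrite /cnorm cReD cImD.
have := ler_normD (complex.Re z) (complex.Re w).
have := ler_normD (complex.Im z) (complex.Im w); lra.
Qed.

Lemma cnormN z : cnorm (- z) = cnorm z.
Proof. by rewrite /cnorm cReN cImN !normrN. Qed.

Lemma cnormM z w : cnorm (z * w) <= cnorm z * cnorm w.
Proof.
rewrite /cnorm cReM cImM mulrDl !mulrDr.
have := ler_normB (complex.Re z * complex.Re w) (complex.Im z * complex.Im w).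
have := ler_normD (complex.Re z * complex.Im w) (complex.Im z * complex.Re w).
rewrite !normrM; lra.
Qed.

Lemma cnorm_real (x : R) : cnorm x%:C = `|x|.
Proof. by rewrite /cnorm /= normr0 addr0. Qed.

Lemma cnorm_sqr z : cnorm z ^+ 2 <= 2 * (complex.Re z ^+ 2 + complex.Im z ^+ 2).
Proof.
rewrite /cnorm -[in leRHS](real_normK (num_real (complex.Re z))).
rewrite -[in leRHS](real_normK (num_real (complex.Im z))).
set u := `|_|; set v := `|_|.
have := sqr_ge0 (u - v); nra.
Qed.

Lemma sqr_cnorm z : complex.Re z ^+ 2 + complex.Im z ^+ 2 <= cnorm z ^+ 2.
Proof.
rewrite /cnorm -[in leLHS](real_normK (num_real (complex.Re z))).
rewrite -[in leLHS](real_normK (num_real (complex.Im z))).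
set u := `|_|; set v := `|_|.
have : 0 <= u * v by exact: mulr_ge0 (normr_ge0 _) (normr_ge0 _).
nra.
Qed.

End Cnorm.

(** The algebra of the ansatz over an abstract field: s, t, v, k stand for sigma, tau, 1 / tau, 1 /
    sigma, and y0, y1 for the exact solution and its derivative. The two relations enter linearly,
    through the vanishing combination [z]. *)
Lemma wkb_residual {F : numFieldType} (s t v k y0 y1 q0 q1 q2 q3 : F) :
  s * t * v * k = 1 -> s * t * v ^+ 2 * k ^+ 2 = v * k ->
  s * t * y1 + q1 * y0 + (- v * (- k * q2)
    + - v ^+ 2 * (k ^+ 2 * (q1 * q1 + q0 * q2 - q3))) =
  s * t * (y1 + (- v * (- k * q1) + - v ^+ 2 * (k ^+ 2 * (q0 * q1 - q2))))
  + q1 * (y0 + (- 1 + (- v * (- k * q0)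
    + - v ^+ 2 * (k ^+ 2 * (q0 * q0 / 2 - q1)))))
  + v ^+ 2 * k ^+ 2 * (q1 * (q0 * q0) / 2 - 2 * (q1 * q1) - q0 * q2 + q3).
Proof.
move=> s1 s2; have z : 0 = (s * t * v * k - 1) * q1
    - (s * t * v ^+ 2 * k ^+ 2 - v * k) * (q0 * q1 - q2).
  by rewrite s1 s2 !subrr !mul0r subrr.
by rewrite -[LHS]addr0 [X in _ + X]z; field.
Qed.

(** The same cancellation read backwards: e0 and e1 are the correction and its derivative, from
    which the exact solution is reassembled. *)
Lemma wkb_system {F : numFieldType} (s t v k e0 e1 q0 q1 q2 q3 : F) :
  s * t * v * k = 1 -> s * t * v ^+ 2 * k ^+ 2 = v * k ->
  v * (- k * q2) + v ^+ 2 * (k ^+ 2 * (q1 * q1 + q0 * q2 - q3))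
  + (s * t * e1 + q1 * e0
     + v ^+ 2 * k ^+ 2 * (q1 * (q0 * q0) / 2 - 2 * (q1 * q1) - q0 * q2 + q3)) =
  s * t * (v * (- k * q1) + v ^+ 2 * (k ^+ 2 * (q0 * q1 - q2)) + e1)
  + q1 * (1 + v * (- k * q0) + v ^+ 2 * (k ^+ 2 * (q0 * q0 / 2 - q1)) + e0).
Proof.
move=> s1 s2; have z : 0 = (s * t * v * k - 1) * q1
    - (s * t * v ^+ 2 * k ^+ 2 - v * k) * (q0 * q1 - q2).
  by rewrite s1 s2 !subrr !mul0r subrr.
by rewrite -[RHS]addr0 [X in _ = _ + X]z; field.
Qed.

(** * WKB solutions of X'' = sigma tau X' + D_1 X *)

(* With c = 1 / sigma, the ansatz X = 1 + P1 / tau + P2 / tau^2 + e kills the orders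
   tau^0 and tau^(-1) for P1 = - c D_0 and P2 = c^2 (D_0^2 / 2 - D_1), and leaves
   e'' = sigma tau e' + D_1 e + c^2 wkb_res / tau^2.  As Re sigma <= 0, the energy
   |e'|^2 + |e' - sigma tau e|^2 obeys a Gronwall inequality uniform in tau. *)
Section WKB.
Context {R : realType}.
Variables (D : nat -> R -> R) (a b : R) (sigma : R[i]).
Hypothesis ab : a <= b.
Hypothesis dD : forall n x, a <= x <= b -> is_derive x 1 (D n) (D n.+1 x).
Hypothesis sigma_neq0 : sigma != 0.
Hypothesis sigma_le0 : complex.Re sigma <= 0.

(** [Q] and [q] are the values of [D 0] and [D 1]. The potential is [D 1]; the sequence starts at an
    antiderivative of it because the order tau^0 prescribes only the derivative of P1. *)
Definition wkb1 (c : R[i]) (Q : R) : R[i] := - c * Q%:C.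
Definition wkb2 (c : R[i]) (Q q : R) : R[i] := c ^+ 2 * (Q ^+ 2 / 2 - q)%:C.

Let c := sigma^-1.

(** Up to the factor c^2 this is D_1 P2 - P2'', the part of order tau^(-2) that the ansatz leaves
    over. Its first two derivatives follow, since [e 3] and [e 4] come from differentiating the
    equation for e. *)
Definition wkb_res (x : R) : R :=
  D 1 x * D 0 x ^+ 2 / 2 - 2 * D 1 x ^+ 2 - D 0 x * D 2 x + D 3 x.
Let res' (x : R) : R := D 2 x * D 0 x ^+ 2 / 2 + D 1 x ^+ 2 * D 0 x
  - 5 * D 1 x * D 2 x - D 0 x * D 3 x + D 4 x.
Let res'' (x : R) : R := D 3 x * D 0 x ^+ 2 / 2 + D 2 x * D 0 x * D 1 x
  + 2 * D 1 x * D 2 x * D 0 x + D 1 x ^+ 3 - 5 * D 2 x ^+ 2 - 5 * D 1 x * D 3 x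
  - D 1 x * D 3 x - D 0 x * D 4 x + D 5 x.

Let dDc n x : a <= x <= b -> cder x 1 (fun y => (D n y)%:C) (D n.+1 x)%:C.
Proof. by move=> xab; apply: cder_real; exact: dD. Qed.

Let dres x : a <= x <= b -> is_derive x 1 wkb_res (res' x).
Proof.
move=> xab.
have h n := dD n xab.
have := is_deriveD (is_deriveB (is_deriveB (is_deriveM (h 1%N) (is_deriveZ 2^-1 (is_deriveX 2 (h 0%N))))
 (is_deriveZ 2 (is_deriveX 2 (h 1%N)))) (is_deriveM (h 0%N) (h 2%N))) (h 3%N).
rewrite (_ : _ + D 3%N = wkb_res); last first.
  by apply/funext => y; rewrite /wkb_res !fctE; do 2! rewrite /GRing.scale /=; ring.
move=> H; apply: is_derive_eq H _; rewrite /res' /GRing.scale /= ?fctE /GRing.scale /=.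
by field.
Qed.

Let dres' x : a <= x <= b -> is_derive x 1 res' (res'' x).
Proof.
move=> xab.
have h n := dD n xab.
have := is_deriveD (is_deriveB (is_deriveB (is_deriveD
 (is_deriveM (h 2%N) (is_deriveZ 2^-1 (is_deriveX 2 (h 0%N))))
 (is_deriveM (is_deriveX 2 (h 1%N)) (h 0%N)))
 (is_deriveZ 5 (is_deriveM (h 1%N) (h 2%N)))) (is_deriveM (h 0%N) (h 3%N))) (h 4%N).
rewrite (_ : _ + D 4%N = res'); last first.
  by apply/funext => y; rewrite /res' !fctE; do 2! rewrite /GRing.scale /=; ring.
move=> H; apply: is_derive_eq H _; rewrite /res'' /GRing.scale /= ?fctE /GRing.scale /=.
by field.
Qed.

Let D_cont n x : a <= x <= b -> {for x, continuous (D n)}.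
Proof. by move=> /(dD n) /is_derive1_continuous. Qed.

Let P1 x := wkb1 c (D 0 x).
Let P1' x := - c * (D 1 x)%:C.
Let P2 x := wkb2 c (D 0 x) (D 1 x).
Let P2' x := c ^+ 2 * (D 0 x * D 1 x - D 2 x)%:C.
Let P2'' x := c ^+ 2 * (D 1 x ^+ 2 + D 0 x * D 2 x - D 3 x)%:C.

Let dP1 x : a <= x <= b -> cder x 1 P1 (P1' x).
Proof. by move=> xab; apply: cderMl; exact: dDc. Qed.

Let dP1' x : a <= x <= b -> cder x 1 P1' (- c * (D 2 x)%:C).
Proof. by move=> xab; apply: cderMl; exact: dDc. Qed.

Let dP2 x : a <= x <= b -> cder x 1 P2 (P2' x).
Proof.
move=> xab; apply: cderMl; apply: cder_real.
have h n := dD n xab.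
have := is_deriveB (is_deriveZ 2^-1 (is_deriveX 2 (h 0%N))) (h 1%N).
rewrite (_ : _ - D 1%N = fun y => D 0 y ^+ 2 / 2 - D 1 y); last first.
  by apply/funext => y; rewrite !fctE; do 2! rewrite /GRing.scale /=; ring.
move=> H; apply: is_derive_eq H _; rewrite /GRing.scale /= ?fctE /GRing.scale /=.
by field.
Qed.

Let dP2' x : a <= x <= b -> cder x 1 P2' (P2'' x).
Proof.
move=> xab; apply: cderMl; apply: cder_real.
have h n := dD n xab.
apply: is_derive_eq (is_deriveB (is_deriveM (h 0%N) (h 1%N)) (h 2%N)) _.
by rewrite /GRing.scale /= ?fctE /GRing.scale /=; ring.
Qed.

Section FixedFrequency.
Variable tau : R.
Hypothesis tau_ge1 : 1 <= tau.
Let u : R := tau^-1.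
Let T : R[i] := tau%:C.
Let U : R[i] := u%:C.

Let tau_gt0 : 0 < tau. Proof. exact: lt_le_trans tau_ge1. Qed.
Let TU : T * U = 1.
Proof. by rewrite /T /U -rmorphM /= /u mulfV // lt0r_neq0. Qed.
Let sc : sigma * c = 1. Proof. by rewrite mulfV. Qed.

(* [e k] is the k-th derivative of the correction term. *)
Lemma wkb_exists : exists e : nat -> R -> R[i], [/\
  e 0 a = 0, e 1 a = 0,
  (forall x, a <= x <= b -> e 2 x =
    sigma * T * e 1 x + (D 1 x)%:C * e 0 x + U ^+ 2 * c ^+ 2 * (wkb_res x)%:C),
  (forall x, a <= x <= b -> e 3 x =
    sigma * T * e 2 x + (D 2 x)%:C * e 0 x + (D 1 x)%:C * e 1 x
    + U ^+ 2 * c ^+ 2 * (res' x)%:C) &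
  forall k x, (k <= 3)%N -> a <= x <= b -> cder x 1 (e k) (e k.+1 x)].
Proof.
(* The initial data are those of 1 + P1 / tau + P2 / tau^2 at a, so that the correction and its
   derivative vanish there. *)
have [Y0 [Y1 [Y0a Y1a dY]]] := @linear_ode2 R (D 1) a b (sigma * T)
  (1 + (U * P1 a + U ^+ 2 * P2 a)) (U * P1' a + U ^+ 2 * P2' a) ab (@D_cont 1).
pose e0 x := Y0 x + (- 1 + (- U * P1 x + - U ^+ 2 * P2 x)).
pose e1 x := Y1 x + (- U * P1' x + - U ^+ 2 * P2' x).
(* From here on the derivatives are defined by the equation and by its formal derivatives; only [e0]
   and [e1] refer to the solution of the differential equation. *)
pose e2 x := sigma * T * e1 x + (D 1 x)%:C * e0 x
  + U ^+ 2 * c ^+ 2 * (wkb_res x)%:C.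
pose e3 x := sigma * T * e2 x + (D 2 x)%:C * e0 x + (D 1 x)%:C * e1 x
    + U ^+ 2 * c ^+ 2 * (res' x)%:C.
pose e4 x := sigma * T * e3 x + (D 3 x)%:C * e0 x + (D 2 x)%:C * e1 x
   + (D 2 x)%:C * e1 x + (D 1 x)%:C * e2 x + U ^+ 2 * c ^+ 2 * (res'' x)%:C.
have de0 x : a <= x <= b -> cder x 1 e0 (e1 x).
  move=> xab; have [h _] := dY x xab.
  apply: cder_eq (cderD h (cderD (cder_cst _ _ _) (cderD (cderMl _ (dP1 xab)) (cderMl _ (dP2 xab))))) _.
  by rewrite add0r.
have de1 x : a <= x <= b -> cder x 1 e1 (e2 x).
  move=> xab; have [_ h] := dY x xab.
  apply: cder_eq (cderD h (cderD (cderMl _ (dP1' xab)) (cderMl _ (dP2' xab)))) _.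
  rewrite /e2 /e1 /e0 /P1 /P1' /P2 /P2' /P2'' /wkb1 /wkb2 /wkb_res.
  set q0 := D 0 x; set q1 := D 1 x; set q2 := D 2 x; set q3 := D 3 x.
  rewrite !(rmorphB, rmorphD, rmorphM, rmorphXn) /=.
  have h2 : (2^-1 : R)%:C = 2^-1 :> R[i] by rewrite fmorphV rmorph_nat.
  rewrite h2.
  have s1 : sigma * T * U * c = 1.
    by rewrite -mulrA (mulrC U) mulrACA sc TU mulr1.
  have s2 : sigma * T * U ^+ 2 * c ^+ 2 = U * c by rewrite -[RHS]mul1r -s1; ring.
  exact: wkb_residual s1 s2.
exists (fun k => nth e4 [:: e0; e1; e2; e3] k); split => //.
- rewrite /= /e0 Y0a; ring.
- rewrite /= /e1 Y1a; ring.
move=> [|[|[|[|k]]]] x //= _ xab.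
- exact: de0.
- exact: de1.
- apply: cder_eq (cderD (cderD (cderMl _ (de1 x xab)) (cderM (dDc 1 xab) (de0 x xab)))
    (cderMl _ (cder_real (dres xab)))) _.
  by rewrite /e3; ring.
have de2 : cder x 1 e2 (e3 x).
  apply: cder_eq (cderD (cderD (cderMl _ (de1 x xab)) (cderM (dDc 1 xab) (de0 x xab)))
    (cderMl _ (cder_real (dres xab)))) _.
  by rewrite /e3; ring.
apply: cder_eq (cderD (cderD (cderD (cderMl _ de2) (cderM (dDc 2 xab) (de0 x xab)))
    (cderM (dDc 1 xab) (de1 x xab))) (cderMl _ (cder_real (dres' xab)))) _.
by rewrite /e4; ring.
Qed.

Variable e : nat -> R -> R[i].
Hypothesis ea0 : e 0 a = 0.
Hypothesis ea1 : e 1 a = 0.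
Hypothesis e2E : forall x, a <= x <= b -> e 2 x =
  sigma * T * e 1 x + (D 1 x)%:C * e 0 x + U ^+ 2 * c ^+ 2 * (wkb_res x)%:C.
Hypothesis e3E : forall x, a <= x <= b -> e 3 x =
  sigma * T * e 2 x + (D 2 x)%:C * e 0 x + (D 1 x)%:C * e 1 x
  + U ^+ 2 * c ^+ 2 * (res' x)%:C.
Hypothesis de : forall k x, (k <= 3)%N -> a <= x <= b -> cder x 1 (e k) (e k.+1 x).
Variables (M1 M2 N0 N1 : R).
Hypothesis D1M : forall x, a <= x <= b -> `|D 1 x| <= M1.
Hypothesis D2M : forall x, a <= x <= b -> `|D 2 x| <= M2.
Hypothesis resN : forall x, a <= x <= b -> `|wkb_res x| <= N0.
Hypothesis res'N : forall x, a <= x <= b -> `|res' x| <= N1.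

Let u_gt0 : 0 < u. Proof. by rewrite invr_gt0. Qed.
Let u_le1 : u <= 1. Proof. by rewrite invf_le1. Qed.
Let tauu : tau * u = 1. Proof. by rewrite mulfV // lt0r_neq0. Qed.
Let c1 : R := cnorm c.
Let g1 : R := cnorm sigma.
Let c1_ge0 : 0 <= c1. Proof. exact: cnorm_ge0. Qed.
Let g1_ge0 : 0 <= g1. Proof. exact: cnorm_ge0. Qed.
Let aab : a <= a <= b. Proof. by rewrite lexx. Qed.
Let M1_ge0 : 0 <= M1. Proof. exact: le_trans (normr_ge0 _) (D1M aab). Qed.
Let M2_ge0 : 0 <= M2. Proof. exact: le_trans (normr_ge0 _) (D2M aab). Qed.
Let N0_ge0 : 0 <= N0. Proof. exact: le_trans (normr_ge0 _) (resN aab). Qed.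
Let N1_ge0 : 0 <= N1. Proof. exact: le_trans (normr_ge0 _) (res'N aab). Qed.

(** Subtracting sigma tau e integrates the stiff term exactly: the derivative [src] of [d] has no
    factor tau. Moreover e 0 is (e 1 - d) / (sigma tau), which gains the third power of 1 / tau. *)
Let d x := e 1 x - sigma * T * e 0 x.
Let src x := (D 1 x)%:C * e 0 x + U ^+ 2 * c ^+ 2 * (wkb_res x)%:C.

Let e0E x : e 0 x = c * U * (e 1 x - d x).
Proof.
rewrite /d opprB addrC subrK.
have -> : c * U * (sigma * T * e 0 x) = sigma * c * (T * U) * e 0 x by ring.
by rewrite sc TU !mul1r.
Qed.

Let cnormU : cnorm U = u.
Proof. by rewrite cnorm_real gtr0_norm. Qed.

Let cnormT : cnorm T = tau.
Proof. by rewrite cnorm_real gtr0_norm. Qed.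

Let cnorm_e0 x : cnorm (e 0 x) <= c1 * u * (cnorm (e 1 x) + cnorm (d x)).
Proof.
rewrite e0E; apply: le_trans (cnormM _ _) _; apply: ler_pM; try exact: cnorm_ge0.
  by apply: le_trans (cnormM _ _) _; rewrite cnormU.
by apply: le_trans (cnormD _ _) _; rewrite cnormN.
Qed.

Let cnorm_res (y N : R) : `|y| <= N ->
  cnorm (U ^+ 2 * c ^+ 2 * y%:C) <= u ^+ 2 * (c1 ^+ 2 * N).
Proof.
move=> yN; rewrite mulrA; apply: le_trans (cnormM _ _) _; rewrite cnorm_real.
apply: ler_pM => //; first exact: cnorm_ge0.
apply: le_trans (cnormM _ _) _; rewrite !expr2; apply: ler_pM; try exact: cnorm_ge0.
  by apply: le_trans (cnormM _ _) _; rewrite cnormU.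
exact: cnormM.
Qed.

Let En x : R := complex.Re (e 1 x) ^+ 2 + complex.Im (e 1 x) ^+ 2
  + (complex.Re (d x) ^+ 2 + complex.Im (d x) ^+ 2).
Let En' x : R :=
  2 * (complex.Re (e 1 x) * complex.Re (e 2 x) + complex.Im (e 1 x) * complex.Im (e 2 x)
  + (complex.Re (d x) * complex.Re (src x) + complex.Im (d x) * complex.Im (src x))).

Let dd x : a <= x <= b -> cder x 1 d (src x).
Proof.
move=> xab; have h : cder x 1 (fun y => e 1 y + - (sigma * T) * e 0 y) (src x).
  apply: cder_eq (cderD (de _ xab) (cderMl _ (de _ xab))) _ => //.
  by rewrite e2E // /src; ring.
move: h; congr (cder _ _ _ _); apply/funext => y; rewrite /d; ring.
Qed.

Let dEn x : a <= x <= b -> is_derive x 1 En (En' x).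
Proof.
move=> xab; have [h1 h2] := @de 1 x isT xab; have [h3 h4] := dd xab.
have h := is_deriveD (is_deriveD (is_deriveX 2 h1) (is_deriveX 2 h2))
  (is_deriveD (is_deriveX 2 h3) (is_deriveX 2 h4)).
apply: is_derive_eq h _; rewrite /En' /GRing.scale /=.
by rewrite !expr1; ring.
Qed.

(** By 2 x.y <= |x|^2 + |y|^2 the derivative of [En] is at most [En] + 2 |src|^2; [K] and [B] are
    this 1 and twice the constants of [src_sqr]. *)
Let K : R := 1 + 16 * M1 ^+ 2 * c1 ^+ 2.
Let B : R := 4 * (u ^+ 2 * (c1 ^+ 2 * N0)) ^+ 2.

Let src_sqr x : a <= x <= b ->
  complex.Re (src x) ^+ 2 + complex.Im (src x) ^+ 2
  <= 8 * M1 ^+ 2 * c1 ^+ 2 * En x + 2 * (u ^+ 2 * (c1 ^+ 2 * N0)) ^+ 2.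
Proof.
move=> xab; apply: le_trans (sqr_cnorm _) _.
have h : cnorm (src x) <= M1 * c1 * (cnorm (e 1 x) + cnorm (d x))
   + u ^+ 2 * (c1 ^+ 2 * N0).
  apply: le_trans (cnormD _ _) _; apply: lerD; last exact/cnorm_res/resN.
  apply: le_trans (cnormM _ _) _; rewrite cnorm_real -mulrA.
  apply: ler_pM => //; [exact: cnorm_ge0|exact: D1M|].
  apply: le_trans (cnorm_e0 _) _; rewrite -mulrA; apply: ler_wpM2l => //.
  by apply: ler_piMl => //; rewrite addr_ge0 ?cnorm_ge0.
set s := cnorm (src x) in h *; set w := u ^+ 2 * _ in h *.
have s0 : 0 <= s by exact: cnorm_ge0.
have h2 : (cnorm (e 1 x) + cnorm (d x)) ^+ 2 <= 4 * En x.
  have := cnorm_sqr (e 1 x); have := cnorm_sqr (d x); rewrite /En.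
  have := sqr_ge0 (cnorm (e 1 x) - cnorm (d x)); lra.
set z := cnorm (e 1 x) + cnorm (d x) in h h2.
apply: le_trans (_ : (M1 * c1 * z + w) ^+ 2 <= _).
  by rewrite !expr2; apply: ler_pM.
apply: le_trans (_ : 2 * (M1 * c1) ^+ 2 * z ^+ 2 + 2 * w ^+ 2 <= _).
  have := sqr_ge0 (M1 * c1 * z - w); lra.
rewrite lerD2r.
apply: le_trans (ler_wpM2l _ h2) _; first by rewrite mulr_ge0 // sqr_ge0.
by rewrite le_eqVlt; apply/orP; left; apply/eqP; ring.
Qed.

Let En'_le x : a <= x <= b -> En' x <= K * En x + B.
Proof.
move=> xab; have h := src_sqr xab.
have e2s : e 2 x = sigma * T * e 1 x + src x by rewrite e2E // /src addrA.
(* In the real inner product of e 1 with sigma tau e 1 only Re sigma survives, and its sign is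
   favourable however large tau is. *)
have T1 : complex.Re (e 1 x) * complex.Re (e 2 x) + complex.Im (e 1 x) * complex.Im (e 2 x)
  = complex.Re sigma * tau * (complex.Re (e 1 x) ^+ 2 + complex.Im (e 1 x) ^+ 2)
  + (complex.Re (e 1 x) * complex.Re (src x) + complex.Im (e 1 x) * complex.Im (src x)).
  have RT : complex.Re T = tau by [].
  have IT : complex.Im T = 0 by [].
  by rewrite e2s cReD cImD !(cReM, cImM) RT IT; ring.
have T2 : complex.Re sigma * tau * (complex.Re (e 1 x) ^+ 2 + complex.Im (e 1 x) ^+ 2) <= 0.
  apply: mulr_le0_ge0; last by rewrite addr_ge0 // sqr_ge0.
  by apply: mulr_le0_ge0 => //; exact: ltW.
rewrite /En' T1 /K /B.
set ur := complex.Re (e 1 x) in T2 *; set ui := complex.Im (e 1 x) in T2 *.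
set fr := complex.Re (src x) in h *; set fi := complex.Im (src x) in h *.
have EE : En x = ur ^+ 2 + ui ^+ 2 + (complex.Re (d x) ^+ 2 + complex.Im (d x) ^+ 2) by [].
set dr := complex.Re (d x) in EE *; set di := complex.Im (d x) in EE *.
have := sqr_ge0 (ur - fr); have := sqr_ge0 (ui - fi).
have := sqr_ge0 (dr - fr); have := sqr_ge0 (di - fi); lra.
Qed.

(** The 8 is the 4 in [B] times the 2 of [cnorm_sqr]; the powers of u are pulled out, so that [G]
    does not depend on tau. *)
Let G : R := Num.sqrt (8 * (c1 ^+ 2 * N0) ^+ 2 * (b - a) * expR (K * (b - a))).

Let En_le x : a <= x <= b -> 2 * En x <= (G * u ^+ 2) ^+ 2.
Proof.
move=> xab; have K0 : 0 <= K.
  by rewrite /K addr_ge0 // mulr_ge0 ?sqr_ge0 // mulr_ge0 ?sqr_ge0.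
have B0 : 0 <= B by rewrite /B mulr_ge0 // sqr_ge0.
have Ea : En a <= 0.
  by rewrite /En /d ea0 ea1 mulr0 subrr /= expr0n /= !addr0.
have h := gronwall K0 B0 Ea dEn En'_le xab.
rewrite exprMn sqr_sqrtr; last first.
  by rewrite mulr_ge0 ?expR_ge0 // mulr_ge0 ?subr_ge0 // mulr_ge0 ?sqr_ge0.
apply: le_trans (_ : 2 * (B * (b - a) * expR (K * (b - a))) <= _).
  by apply: ler_wpM2l.
by rewrite le_eqVlt /B; apply/orP; left; apply/eqP; ring.
Qed.

Let G_ge0 : 0 <= G. Proof. exact: sqrtr_ge0. Qed.

Let small x z : a <= x <= b -> cnorm z ^+ 2 <= 2 * En x -> cnorm z <= G * u ^+ 2.
Proof.
move=> xab h; have := le_trans h (En_le xab).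
by rewrite ler_sqr // nnegrE ?cnorm_ge0 // mulr_ge0 // sqr_ge0.
Qed.

Let e1_le x : a <= x <= b -> cnorm (e 1 x) <= G * u ^+ 2.
Proof.
move=> xab; apply: (small xab); apply: le_trans (cnorm_sqr _) _.
by apply: ler_wpM2l => //; rewrite lerDl addr_ge0 // sqr_ge0.
Qed.

Let d_le x : a <= x <= b -> cnorm (d x) <= G * u ^+ 2.
Proof.
move=> xab; apply: (small xab); apply: le_trans (cnorm_sqr _) _.
by apply: ler_wpM2l => //; rewrite lerDr addr_ge0 // sqr_ge0.
Qed.

Let e0_le x : a <= x <= b -> cnorm (e 0 x) <= 2 * c1 * G * u ^+ 3.
Proof.
move=> xab; apply: le_trans (cnorm_e0 _) _.
apply: le_trans (_ : c1 * u * (G * u ^+ 2 + G * u ^+ 2) <= _).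
  apply: ler_wpM2l; first by rewrite mulr_ge0 // ltW.
  by apply: lerD; [exact: e1_le|exact: d_le].
by rewrite le_eqVlt; apply/orP; left; apply/eqP; ring.
Qed.

(** Read off from the equations for [e 2] and [e 3]: the term sigma tau e loses one power of tau,
    the others are no larger because u <= 1. *)
Let C2 : R := g1 * G + M1 * (2 * c1 * G) + c1 ^+ 2 * N0.
Let C3 : R := g1 * C2 + M2 * (2 * c1 * G) + M1 * G + c1 ^+ 2 * N1.

Let cnormsT z : cnorm (sigma * T * z) <= g1 * tau * cnorm z.
Proof.
apply: le_trans (cnormM _ _) _; apply: ler_wpM2r; first exact: cnorm_ge0.
by apply: le_trans (cnormM _ _) _; rewrite cnormT.
Qed.

Let cnormRM (y N C : R) z : `|y| <= N -> cnorm z <= C ->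
  cnorm (y%:C * z) <= N * C.
Proof.
move=> yN zC; apply: le_trans (cnormM _ _) _; rewrite cnorm_real.
by apply: ler_pM => //; exact: cnorm_ge0.
Qed.

Let u_pow (C : R) k : 0 <= C -> C * u ^+ k.+1 <= C * u.
Proof.
move=> C0; apply: ler_wpM2l => //; rewrite exprSr -[leRHS]mul1r.
by apply: ler_wpM2r; [exact: ltW|rewrite exprn_ile1 // ltW].
Qed.

Let e2_le x : a <= x <= b -> cnorm (e 2 x) <= C2 * u.
Proof.
move=> xab; rewrite e2E //.
apply: le_trans (cnormD _ _) _.
apply: le_trans (lerD (cnormD _ _) (cnorm_res (resN xab))) _.
apply: le_trans (lerD (lerD (cnormsT _) (cnormRM (D1M xab) (e0_le xab))) (lexx _)) _.
have -> : C2 * u = g1 * G * u + M1 * (2 * c1 * G) * u + c1 ^+ 2 * N0 * u.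
  by rewrite /C2; ring.
apply: lerD.
  apply: lerD.
    apply: le_trans (ler_wpM2l _ (e1_le xab)) _; first by rewrite mulr_ge0 // ltW.
    rewrite le_eqVlt; apply/orP; left; apply/eqP.
    have -> : g1 * tau * (G * u ^+ 2) = g1 * G * u * (tau * u) by ring.
    by rewrite tauu mulr1.
  by rewrite mulrA; apply: u_pow; rewrite !mulr_ge0.
by rewrite mulrC; apply: u_pow; rewrite mulr_ge0 // sqr_ge0.
Qed.

Let e3_le x : a <= x <= b -> cnorm (e 3 x) <= C3.
Proof.
move=> xab; rewrite e3E //.
apply: le_trans (cnormD _ _) _.
apply: le_trans (lerD (cnormD _ _) (cnorm_res (res'N xab))) _.
apply: le_trans (lerD (lerD (cnormD _ _) (cnormRM (D1M xab) (e1_le xab))) (lexx _)) _.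
apply: le_trans (lerD (lerD (lerD (cnormsT _) (cnormRM (D2M xab) (e0_le xab))) (lexx _)) (lexx _)) _.
have p1 (C : R) k : 0 <= C -> C * u ^+ k <= C.
  by move=> C0; rewrite -[leRHS]mulr1; apply: ler_wpM2l => //; rewrite exprn_ile1 // ltW.
rewrite /C3; apply: lerD; last by rewrite mulrC; apply: p1; rewrite mulr_ge0 // sqr_ge0.
apply: lerD; last by rewrite mulrA; apply: p1; rewrite mulr_ge0.
apply: lerD; last by rewrite mulrA; apply: p1; rewrite !mulr_ge0.
apply: le_trans (ler_wpM2l _ (e2_le xab)) _; first by rewrite mulr_ge0 // ltW.
rewrite le_eqVlt; apply/orP; left; apply/eqP.
have -> : g1 * tau * (C2 * u) = g1 * C2 * (tau * u) by ring.
by rewrite tauu mulr1.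
Qed.

(** The value of M is part of the statement so that [wkb] can see that it is free of tau. *)
Lemma wkb_bounds : exists2 M, forall k x, (k <= 3)%N -> a <= x <= b ->
  cnorm (e k x) <= M * (u ^+ 3 * tau ^+ k) &
  M = G + 2 * c1 * G + C2 + C3.
Proof.
eexists; last reflexivity.
have C20 : 0 <= C2 by rewrite /C2 !addr_ge0 // !mulr_ge0 // sqr_ge0.
have C30 : 0 <= C3 by rewrite /C3 !addr_ge0 // !mulr_ge0 // sqr_ge0.
have ut k j : u ^+ (k + j) * tau ^+ k = u ^+ j.
  by rewrite exprD mulrAC -exprMn [u * _]mulrC tauu expr1n mul1r.
have cG : 0 <= 2 * c1 * G by rewrite !mulr_ge0.
have step (C w z : R) : z <= C * w -> 0 <= w -> C <= G + 2 * c1 * G + C2 + C3 ->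
    z <= (G + 2 * c1 * G + C2 + C3) * w.
  by move=> h z0 CM; apply: le_trans h _; exact: ler_wpM2r.
have G0 : 0 <= G := G_ge0.
have u0 k : 0 <= u ^+ k by rewrite exprn_ge0 // ltW.
move=> [|[|[|[|k]]]] x //= _ xab.
- by rewrite expr0 mulr1; apply: step (e0_le xab) _ _ => //; lra.
- by rewrite (ut 1%N 2%N); apply: step (e1_le xab) _ _ => //; lra.
- by rewrite (ut 2%N 1%N) expr1; apply: step (e2_le xab) _ _; [exact: ltW|lra].
rewrite (ut 3%N 0%N) expr0; apply: step (_ : _ <= C3 * 1) _ _ => //; last lra.
by rewrite mulr1; exact: e3_le.
Qed.

End FixedFrequency.

Lemma wkb : exists (M : R) (e : R -> nat -> R -> R[i]), forall tau, 1 <= tau ->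
  forall x, a <= x <= b -> [/\
    e tau 2 x = sigma * tau%:C * e tau 1 x + (D 1 x)%:C * e tau 0 x
      + (tau^-1)%:C ^+ 2 * c ^+ 2 * (wkb_res x)%:C,
    forall k, (k <= 3)%N -> cder x 1 (e tau k) (e tau k.+1 x) &
    forall k, (k <= 3)%N -> cnorm (e tau k x) <= M * (tau^-1 ^+ 3 * tau ^+ k)].
Proof.
have [M1 _ hM1] := segment_bounded (@D_cont 1).
have [M2 _ hM2] := segment_bounded (@D_cont 2).
have [N0 _ hN0] := @segment_bounded R wkb_res a b
  (fun x xab => is_derive1_continuous (dres xab)).
have [N1 _ hN1] := @segment_bounded R res' a b
  (fun x xab => is_derive1_continuous (dres' xab)).
(* [choice] needs a witness for every tau; below 1 the zero function serves. *)
have : forall tau, exists e : nat -> R -> R[i], 1 <= tau -> [/\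
  e 0%N a = 0, e 1%N a = 0,
  (forall x, a <= x <= b -> e 2%N x =
    sigma * tau%:C * e 1%N x + (D 1 x)%:C * e 0%N x
      + (tau^-1)%:C ^+ 2 * c ^+ 2 * (wkb_res x)%:C),
  (forall x, a <= x <= b -> e 3%N x =
    sigma * tau%:C * e 2%N x + (D 2 x)%:C * e 0%N x + (D 1 x)%:C * e 1%N x
    + (tau^-1)%:C ^+ 2 * c ^+ 2 * (res' x)%:C) &
  forall k x, (k <= 3)%N -> a <= x <= b -> cder x 1 (e k) (e k.+1 x)].
  move=> tau; have [t1|] := leP 1 tau; last by exists (fun _ _ => 0).
  by have [e he] := wkb_exists t1; exists e.
move=> /choice[e he].
(* The constant stays open until [wkb_bounds] supplies its value, in which tau does not occur. *)
eexists; exists e => tau t1 x xab.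
have [h0 h1 h2 h3 h4] := he tau t1.
have [M hM ME] := wkb_bounds t1 h0 h1 h2 h3 h4 hM1 hM2 hN0 hN1.
split; [exact: h2|by move=> k k3; exact: h4|move=> k k3].
have := hM k x k3 xab; rewrite ME; exact.
Qed.

Definition wkb_sum (e : R -> nat -> R -> R[i]) (tau x : R) : R[i] :=
  1 + (tau^-1)%:C * wkb1 c (D 0 x) + (tau^-1)%:C ^+ 2 * wkb2 c (D 0 x) (D 1 x)
  + e tau 0%N x.

Lemma wkb_solution : exists (M : R) (e : R -> nat -> R -> R[i]) (y : R -> R -> R[i]),
  0 <= M /\ forall tau, 1 <= tau -> forall x, a <= x <= b -> [/\
    cder x 1 (wkb_sum e tau) (y tau x),
    cder x 1 (y tau) (sigma * tau%:C * y tau x + (D 1 x)%:C * wkb_sum e tau x),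
    forall k, (k <= 3)%N -> cder x 1 (e tau k) (e tau k.+1 x) &
    forall k, (k <= 3)%N -> cnorm (e tau k x) <= M * (tau^-1 ^+ 3 * tau ^+ k)].
Proof.
have [M [e he]] := wkb.
pose y tau x : R[i] := (tau^-1)%:C * (- c * (D 1 x)%:C)
  + (tau^-1)%:C ^+ 2 * (c ^+ 2 * (D 0 x * D 1 x - D 2 x)%:C) + e tau 1%N x.
exists M, e, y; split.
  (* M is nonnegative because it bounds a norm at tau = 1 and k = 0. *)
  have aab' : a <= a <= b by rewrite lexx.
  have [_ _ /(_ 0%N isT)] := he 1 (lexx 1) a aab'.
  rewrite invr1 expr1n expr0 !mulr1; apply: le_trans; exact: cnorm_ge0.
move=> tau t1 x xab; have [h1 h2 h3] := he tau t1 x xab; split => //.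
  apply: cder_eq (cderD (cderD (cderD (cder_cst _ _ 1) (cderMl _ (dP1 xab)))
    (cderMl _ (dP2 xab))) (h2 0%N isT)) _.
  by rewrite add0r.
apply: cder_eq (cderD (cderD (cderMl _ (dP1' xab)) (cderMl _ (dP2' xab))) (h2 1%N isT)) _.
have tau0 : tau != 0 by rewrite lt0r_neq0 // (lt_le_trans _ t1).
have TU : tau%:C * (tau^-1)%:C = 1 :> R[i] by rewrite -rmorphM /= mulfV.
have sc : sigma * c = 1 by rewrite mulfV.
have s1 : sigma * tau%:C * (tau^-1)%:C * c = 1.
  by rewrite -mulrA (mulrC (tau^-1)%:C) mulrACA sc TU mulr1.
have s2 : sigma * tau%:C * (tau^-1)%:C ^+ 2 * c ^+ 2 = (tau^-1)%:C * c.
  by rewrite -[RHS]mul1r -s1; ring.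
rewrite h1 /wkb_sum /y /P2'' /wkb1 /wkb2 /wkb_res.
set q0 := D 0 x; set q1 := D 1 x; set q2 := D 2 x; set q3 := D 3 x.
rewrite !(rmorphB, rmorphD, rmorphM, rmorphXn) /=.
have h4 : (2^-1 : R)%:C = 2^-1 :> R[i] by rewrite fmorphV rmorph_nat.
rewrite h4.
exact: wkb_system s1 s2.
Qed.

End WKB.

(** * Functions of class C^k on open sets *)

Section CkTheory.
Context {R : realType} {n : nat}.
Local Notation V := 'rV[R]_n.
Implicit Types (U : set V) (f g p : V -> R) (k : nat) (j : 'I_n) (x : V).

Lemma partial_val j f x (d : R) : is_derive x (delta_mx 0 j) f d -> partial j f x = d.
Proof. by move=> [_ <-]. Qed.

Lemma partialP j f x : derivable f x (delta_mx 0 j) ->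
  is_derive x (delta_mx 0 j) f (partial j f x).
Proof. exact: derivableP. Qed.

Lemma open_near U x : open U -> U x -> \near x, U x.
Proof. by move=> oU Ux; exact: open_nbhs_nbhs. Qed.

Lemma near_open_eq U f g x : open U -> U x -> (forall y, U y -> f y = g y) ->
  \near x, f x = g x.
Proof. by move=> oU Ux fg; apply: filterS fg _; exact: open_near. Qed.

Lemma continuous_eq_open U f g x : open U -> U x -> (forall y, U y -> f y = g y) ->
  {for x, continuous f} -> {for x, continuous g}.
Proof.
move=> oU Ux fg cf; rewrite /prop_for /continuous_at -(fg x Ux).
have h : \forall y \near x, f y = g y by exact: near_open_eq oU Ux fg.
by apply: cvg_trans cf; exact: (@near_eq_cvg _ _ (nbhs x) _ f g h).
Unshelve. all: by end_near.
Qed.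

Lemma partial_eq_open U f g j x : open U -> U x -> (forall y, U y -> f y = g y) ->
  partial j f x = partial j g x.
Proof.
by move=> oU Ux fg; apply: near_eq_derive; exact: near_open_eq oU Ux fg.
Qed.

Lemma Ck_continuous k U f : Ck k U f -> forall x, U x -> {for x, continuous f}.
Proof. by case: k => [[]|k []]. Qed.

Lemma Ck_is_derive k U f : Ck k.+1 U f -> forall j x, U x ->
  is_derive x (delta_mx 0 j) f (partial j f x).
Proof. by move=> [_ h] j x Ux; apply: partialP; apply: (h j).1. Qed.

Lemma Ck_partial k U f j : Ck k.+1 U f -> Ck k U (partial j f).
Proof. by move=> [_ /(_ j)[]]. Qed.

Lemma Ck_eq k U f g : open U -> (forall x, U x -> f x = g x) ->
  Ck k U f -> Ck k U g.
Proof.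
move=> oU; elim: k f g => [|k IH] f g fg [cf df]; split => //.
- by move=> x Ux; exact: continuous_eq_open oU Ux fg (cf x Ux).
- by move=> x Ux; exact: continuous_eq_open oU Ux fg (cf x Ux).
move=> j; have [df1 df2] := df j; split.
  move=> x Ux; apply: near_eq_derivable (df1 x Ux).
  exact: near_open_eq oU Ux fg.
by apply: IH df2 => x Ux; exact: partial_eq_open oU Ux fg.
Qed.

(** The inductive tool for regularity: derivatives are exhibited as formulas [g j], so that the
    induction runs on these formulas instead of on the total operator [partial]. *)
Lemma CkS k U f (g : 'I_n -> V -> R) : open U ->
  (forall x, U x -> {for x, continuous f}) ->
  (forall j, (forall x, U x -> is_derive x (delta_mx 0 j) f (g j x)) /\
    Ck k U (g j)) -> Ck k.+1 U f.
Proof.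
move=> oU cf dg; split => // j; have [df Cg] := dg j; split => [x Ux|].
  by have [] := df x Ux.
by apply: Ck_eq oU _ Cg => x Ux; rewrite (partial_val (df x Ux)).
Qed.

Lemma Ck_le k U f : Ck k.+1 U f -> Ck k U f.
Proof.
elim: k f => [|k IH] f [cf df]; split => // j.
by have [df1 df2] := df j; split => //; exact: IH.
Qed.

Lemma Ck_cst k U (c : R) : open U -> Ck k U (fun=> c).
Proof.
move=> oU; have cc (d : R) x : {for x, continuous (fun _ : V => d)}.
  exact: cst_continuous.
elim: k c => [|k IH] c; first by split => // x _; exact: cc.
apply: (@CkS k U _ (fun _ _ => 0 : R) oU).
- by move=> x _; apply: cc.
by move=> j; split; [move=> x _; exact: is_derive_cst|exact: IH].
Qed.

Lemma is_derive_coord j i x :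
  is_derive x (delta_mx 0 j) (fun y : V => y 0 i) (i == j)%:R.
Proof.
apply/is_derive_line.
have -> : (fun h : R => (h *: delta_mx 0 j + x : V) 0 i)
    = (i == j)%:R *: (id : R -> R) + cst (x 0 i).
  by apply/funext => h; rewrite !mxE eqxx /= !fctE /GRing.scale /= mulrC.
apply: is_derive_eq (is_deriveD (is_deriveZ _ (is_derive_id _ _)) (is_derive_cst _ _ _)) _.
by rewrite addr0 /GRing.scale /= mulr1.
Qed.

Lemma Ck_coord k U i : open U -> Ck k U (fun y => y 0 i).
Proof.
move=> oU; have c x : {for x, continuous (fun y : V => y 0 i)}.
  exact: coord_continuous.
case: k => [|k]; first by split => // x _; exact: c.
apply: (@CkS _ U _ (fun j _ => (i == j)%:R) oU).
- by move=> x _; exact: c.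
by move=> j; split; [move=> x _; exact: is_derive_coord|exact: Ck_cst].
Qed.

Lemma CkD k U f g : open U -> Ck k U f -> Ck k U g -> Ck k U (fun x => f x + g x).
Proof.
move=> oU; elim: k f g => [|k IH] f g cf cg.
  by split => // x Ux; apply: continuousD; [exact: (Ck_continuous cf Ux)|exact: (Ck_continuous cg Ux)].
apply: (@CkS _ U _ (fun j x => partial j f x + partial j g x) oU).
- by move=> x Ux; apply: continuousD; [exact: (Ck_continuous cf Ux)|exact: (Ck_continuous cg Ux)].
move=> j; split; first by move=> x Ux; exact: (is_deriveD (Ck_is_derive cf j Ux) (Ck_is_derive cg j Ux)).
by apply: IH; exact: Ck_partial.
Qed.

Lemma CkM k U f g : open U -> Ck k U f -> Ck k U g -> Ck k U (fun x => f x * g x).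
Proof.
move=> oU; elim: k f g => [|k IH] f g cf cg.
  by split => // x Ux; apply: continuousM; [exact: (Ck_continuous cf Ux)|exact: (Ck_continuous cg Ux)].
apply: (@CkS _ U _ (fun j x => f x * partial j g x + g x * partial j f x) oU).
- by move=> x Ux; apply: continuousM; [exact: (Ck_continuous cf Ux)|exact: (Ck_continuous cg Ux)].
move=> j; split; first by move=> x Ux; exact: (is_deriveM (Ck_is_derive cf j Ux) (Ck_is_derive cg j Ux)).
by apply: CkD => //; apply: IH; by [exact: Ck_partial|exact: Ck_le].
Qed.

Lemma CkMl k U c f : open U -> Ck k U f -> Ck k U (fun x => c * f x).
Proof. by move=> oU cf; apply: CkM => //; exact: Ck_cst. Qed.

Lemma CkN k U f : open U -> Ck k U f -> Ck k U (fun x => - f x).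
Proof.
move=> oU cf; apply: Ck_eq oU _ (CkMl (-1) oU cf) => x _.
by rewrite mulN1r.
Qed.

Lemma Ck_sum k U (I : Type) (r : seq I) (F : I -> V -> R) : open U ->
  (forall i, Ck k U (F i)) -> Ck k U (fun x => \sum_(i <- r) F i x).
Proof.
move=> oU cF; elim: r => [|i r IH].
  by apply: Ck_eq oU _ (Ck_cst k 0 oU) => x _; rewrite big_nil.
by apply: Ck_eq oU _ (CkD oU (cF i) IH) => x _; rewrite big_cons.
Qed.

(** A whole sequence of successive derivatives is composed with p, since differentiating [D m] after
    p produces [D m.+1] after p; hence m is universally quantified in the induction. *)
Lemma Ck_comp k U (D : nat -> R -> R) (I : set R) p : open U ->
  (forall m t, I t -> is_derive t 1 (D m) (D m.+1 t)) ->
  (forall x, U x -> I (p x)) -> Ck k U p -> forall m, Ck k U (fun x => D m (p x)).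
Proof.
move=> oU dD Ip; elim: k => [|k IH] cp m.
  split => // x Ux; apply: continuous_comp; first exact: (Ck_continuous cp Ux).
  exact: is_derive1_continuous (dD m _ (Ip x Ux)).
apply: (@CkS _ U _ (fun j x => D m.+1 (p x) * partial j p x) oU).
- move=> x Ux; apply: continuous_comp; first exact: (Ck_continuous cp Ux).
  exact: is_derive1_continuous (dD m _ (Ip x Ux)).
move=> j; split.
  move=> x Ux; exact: is_derive_comp_real (dD m _ (Ip x Ux)) (Ck_is_derive cp j Ux).
apply: CkM => //; last exact: Ck_partial.
by apply: IH; exact: Ck_le.
Qed.

Lemma CkV k U f : open U -> (forall x, U x -> f x != 0) -> Ck k U f ->
  Ck k U (fun x => (f x)^-1).
Proof.
move=> oU f0; elim: k => [|k IH] cf.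
  split => // x Ux; apply: continuousV; first exact: f0.
  exact: (Ck_continuous cf Ux).
apply: (@CkS _ U _ (fun j x => - ((f x)^-1 * (f x)^-1) * partial j f x) oU).
- move=> x Ux; apply: continuousV; first exact: f0.
  exact: (Ck_continuous cf Ux).
move=> j; split.
  move=> x Ux; have [df _] := Ck_is_derive cf j Ux.
  split; first exact: derivableV (f0 x Ux) df.
  by rewrite deriveV ?f0 // -invfM -expr2.
apply: CkM => //; last exact: Ck_partial.
by apply: CkN => //; apply: CkM => //; apply: IH; exact: Ck_le.
Qed.

Lemma Ck_sqrt k U f : open U -> (forall x, U x -> 0 < f x) -> Ck k U f ->
  Ck k U (fun x => Num.sqrt (f x)).
Proof.
move=> oU f0; elim: k => [|k IH] cf.
  split => // x Ux; apply: continuous_comp; first exact: (Ck_continuous cf Ux).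
  exact: sqrt_continuous.
apply: (@CkS _ U _ (fun j x => (2 * Num.sqrt (f x))^-1 * partial j f x) oU).
- move=> x Ux; apply: continuous_comp; first exact: (Ck_continuous cf Ux).
  exact: sqrt_continuous.
move=> j; split.
  move=> x Ux; exact: is_derive_comp_real (is_derive1_sqrt (f0 x Ux)) (Ck_is_derive cf j Ux).
apply: CkM => //; last exact: Ck_partial.
apply: CkV => //; last by apply: CkMl => //; apply: IH; exact: Ck_le.
by move=> x Ux; rewrite mulf_neq0 // lt0r_neq0 // sqrtr_gt0 f0.
Qed.

Lemma is_derive_along x v f s c (d : R) : is_derive x v f d -> x = s *: v + c ->
  is_derive s 1 (fun r : R => f (r *: v + c)) d.
Proof.
move=> /is_derive_line h xE.
have h0 : is_derive (s - s) 1 (fun r : R => f (r *: v + x)) d by rewrite subrr.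
have h1 : is_derive s (1 : R) (id - cst s) (1 - 0) by exact: is_deriveB.
have := @is_derive1_comp R (fun r : R => f (r *: v + x)) (id - cst s) s _ _ h0 h1.
rewrite subr0 mulr1.
congr (is_derive _ _ _ _); apply/funext => r.
by rewrite /= !fctE xE addrA -scalerDl subrK.
Qed.

(* Mean value theorem in both variables for the mixed second difference over a
   parallelogram, whose symmetry in i and j gives Schwarz's theorem. *)
Let mixed_difference U f i j x e : open U -> U x -> Ck 2 U f -> 0 < e ->
  exists2 d, 0 < d & forall h : R, 0 < h < d -> exists2 z, U z &
    `|partial j (partial i f) z - partial j (partial i f) x| < e /\
    f (h *: delta_mx 0 i + (h *: delta_mx 0 j + x)) - f (h *: delta_mx 0 i + x)
     - f (h *: delta_mx 0 j + x) + f x = h * h * partial j (partial i f) z.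
Proof.
move=> oU Ux cf e0.
have swap (p q r s : R) : p - q - r + s = p - q - (r - s) by ring.
have cg := Ck_continuous (Ck_partial j (Ck_partial i cf)) Ux.
have nb : \forall z \near x,
    U z /\ `|partial j (partial i f) x - partial j (partial i f) z| < e.
  by apply: filterI; [exact: open_near|move/cvgrPdist_lt : cg; exact].
have [d0 /= d00 hd0] := (nbhs_ballP _ _).1 nb.
set vi : V := delta_mx 0 i; set vj : V := delta_mx 0 j.
(* For h < d0 / kap the closed parallelogram stays in the ball of radius d0; the 1 keeps kap
   positive. *)
pose kap : R := `|vi| + `|vj| + 1.
have kap0 : 0 < kap by rewrite ltr_wpDl // addr_ge0.
exists (d0 / kap); first by rewrite divr_gt0.
move=> h /andP[h0 hd].
have inB s t : 0 <= s <= h -> 0 <= t <= h ->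
    ball x d0 (s *: vi + (t *: vj + x)).
  move=> /andP[s0 sh] /andP[t0 th].
  rewrite -ball_normE /= addrA opprD addrCA subrr addr0 normrN; apply: le_lt_trans (ler_normD _ _) _.
  rewrite !normrZ !ger0_norm //.
  apply: le_lt_trans (_ : h * kap < d0); last by rewrite -ltr_pdivlMr.
  rewrite /kap; have := ler_wpM2r (normr_ge0 vi) sh.
  have := ler_wpM2r (normr_ge0 vj) th; lra.
have z0 : 0 <= (0 : R) <= h by apply/andP; split => //; exact: ltW.
have hh : 0 <= h <= h by apply/andP; split => //; exact: ltW.
have Fi s t : 0 <= s <= h -> 0 <= t <= h -> is_derive s 1
    (fun r => f (r *: vi + (t *: vj + x))) (partial i f (s *: vi + (t *: vj + x))).
  move=> sh th; apply: is_derive_along (erefl _).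
  by apply: Ck_is_derive cf _ _ _; case: (hd0 _ (inB s t sh th)).
have Fj s t : 0 <= s <= h -> 0 <= t <= h -> is_derive t 1
    (fun r => partial i f (s *: vi + (r *: vj + x)))
    (partial j (partial i f) (s *: vi + (t *: vj + x))).
  move=> sh th.
  have /is_derive_along D : is_derive (s *: vi + (t *: vj + x)) vj (partial i f)
      (partial j (partial i f) (s *: vi + (t *: vj + x))).
    by apply: Ck_is_derive (Ck_partial i cf) _ _ _; case: (hd0 _ (inB s t sh th)).
  have := D t (s *: vi + x) (addrCA _ _ _).
  by congr (is_derive _ _ _ _); apply/funext => r; rewrite addrCA.
have sub s : s \in `]0, h[ -> 0 <= s <= h.
  by rewrite in_itv /= => /andP[s0 sh]; rewrite !ltW.
pose phi r := f (r *: vi + (h *: vj + x)) - f (r *: vi + (0 *: vj + x)).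
have dphi s : 0 <= s <= h -> is_derive s 1 phi
   (partial i f (s *: vi + (h *: vj + x)) - partial i f (s *: vi + (0 *: vj + x))).
  by move=> sh; exact: is_deriveB (Fi s h sh hh) (Fi s 0 sh z0).
have mvt (g dg : R -> R) : (forall r, 0 <= r <= h -> is_derive r 1 g (dg r)) ->
    exists2 r, 0 <= r <= h & g h - g 0 = dg r * h.
  move=> dgr; have [||r rI E] := @MVT R g dg 0 h h0.
  - by move=> r /sub; exact: dgr.
  - apply/continuous_in_subspaceT => r; rewrite inE /= in_itv /= => rh.
    exact: is_derive1_continuous (dgr r rh).
  by exists r; [exact: sub|rewrite E subr0].
have [s sI E1] := mvt phi _ dphi.
have [t tI E2] := mvt _ _ (fun t th => Fj s t sI th).
exists (s *: vi + (t *: vj + x)); first by case: (hd0 _ (inB s t sI tI)).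
split; first by rewrite distrC; case: (hd0 _ (inB s t sI tI)).
move: E1; rewrite E2 /phi !scale0r !add0r => E1.
have -> : h * h * partial j (partial i f) (s *: vi + (t *: vj + x))
  = partial j (partial i f) (s *: vi + (t *: vj + x)) * h * h by ring.
by rewrite -E1 swap.
Qed.

Lemma partialC U f i j x : open U -> U x -> Ck 2 U f ->
  partial i (partial j f) x = partial j (partial i f) x.
Proof.
move=> oU Ux cf.
have swap (p q r s : R) : p - q - r + s = p - r - q + s by ring.
have fin (a b z : R) : `|z - b| < `|a - b| / 2 -> `|z - a| < `|a - b| / 2 -> False.
  have := ler_normB (z - b) (z - a).
  have -> : z - b - (z - a) = a - b by ring.
  lra.
apply/eqP/negPn/negP => neq.
(* Half the gap: for one h below both thresholds, the second difference divided by h^2 would be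
   closer than e to both mixed derivatives at x. *)
pose e := `|partial i (partial j f) x - partial j (partial i f) x| / 2.
have e0 : 0 < e by rewrite divr_gt0 // normr_gt0 subr_eq0.
have [d1 d10 h1] := mixed_difference i j oU Ux cf e0.
have [d2 d20 h2] := mixed_difference j i oU Ux cf e0.
pose h := Num.min d1 d2 / 2.
have m0 : 0 < Num.min d1 d2 by rewrite lt_min d10.
have h0 : 0 < h by rewrite divr_gt0.
have hm : h < Num.min d1 d2 by rewrite ltr_pdivrMr // ltr_pMr // ltr1n.
move: hm; rewrite lt_min => /andP[hd1 hd2].
have [|z1 _ [b1 E1]] := h1 h; first by rewrite h0.
have [|z2 _ [b2 E2]] := h2 h; first by rewrite h0.
have EE : partial j (partial i f) z1 = partial i (partial j f) z2.
  apply: (mulfI (lt0r_neq0 (mulr_gt0 h0 h0))).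
  apply: etrans (etrans (esym E1) _) E2.
  by rewrite swap (addrCA (h *: delta_mx 0 i) (h *: delta_mx 0 j) x).
by rewrite EE in b1; exact: fin b1 b2.
Qed.

End CkTheory.

(** * Symbol classes *)

Section Families.
Context {R : realType} {n : nat}.
Local Notation V := 'rV[R]_n.
Variable U : set V.
Hypothesis oU : open U.
Implicit Types (w : R -> R) (f g : R -> V -> R) (M : R) (k : nat) (x : V).

(* A semiclassical symbol class: each derivative may cost one factor tau. *)
Fixpoint Bd k M w f : Prop :=
  (forall tau, 1 <= tau -> forall x, U x ->
     {for x, continuous (f tau)} /\ `|f tau x| <= M * w tau) /\
  match k with
  | 0 => True
  | k'.+1 => forall j : 'I_n,
      (forall tau, 1 <= tau -> forall x, U x -> derivable (f tau) x (delta_mx 0 j)) /\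
      Bd k' M (fun tau => tau * w tau) (fun tau => partial j (f tau))
  end.

Lemma Bd0 k M w f : Bd k M w f -> forall tau, 1 <= tau -> forall x, U x ->
  {for x, continuous (f tau)} /\ `|f tau x| <= M * w tau.
Proof. by case: k => [[]|k []]. Qed.

Lemma Bd_partial k M w f j : Bd k.+1 M w f ->
  Bd k M (fun tau => tau * w tau) (fun tau => partial j (f tau)).
Proof. by move=> [_ /(_ j)[]]. Qed.

Lemma Bd_is_derive k M w f : Bd k.+1 M w f -> forall j tau, 1 <= tau ->
  forall x, U x -> is_derive x (delta_mx 0 j) (f tau) (partial j (f tau) x).
Proof. by move=> [_ h] j tau t1 x Ux; apply: partialP; apply: (h j).1. Qed.

Lemma Bd_Ck k M w f tau : 1 <= tau -> Bd k M w f -> Ck k U (f tau).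
Proof.
move=> t1; elim: k w f => [|k IH] w f [h1 h2]; split => //.
- by move=> x Ux; case: (h1 tau t1 x Ux).
- by move=> x Ux; case: (h1 tau t1 x Ux).
move=> j; have [h3 h4] := h2 j; split; first by move=> x Ux; exact: h3.
exact: IH h4.
Qed.

Lemma Bd_mono k M w M' w' f g :
  (forall tau, 1 <= tau -> M * w tau <= M' * w' tau) ->
  (forall tau, 1 <= tau -> forall x, U x -> f tau x = g tau x) ->
  Bd k M w f -> Bd k M' w' g.
Proof.
elim: k w w' f g => [|k IH] w w' f g ww fg [h1 h2].
  split => // tau t1 x Ux; have [h3 h4] := h1 tau t1 x Ux; split.
    exact: continuous_eq_open oU Ux (fg tau t1) h3.
  by rewrite -fg //; apply: le_trans h4 _; exact: ww.
split => [tau t1 x Ux|j].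
  have [h3 h4] := h1 tau t1 x Ux; split.
    exact: continuous_eq_open oU Ux (fg tau t1) h3.
  by rewrite -fg //; apply: le_trans h4 _; exact: ww.
have [h3 h4] := h2 j; split.
  move=> tau t1 x Ux; apply: near_eq_derivable (h3 tau t1 x Ux).
  exact: near_open_eq oU Ux (fg tau t1).
apply: IH h4 => [tau t1|tau t1 x Ux].
  rewrite !(mulrCA _ tau); apply: ler_wpM2l; first exact: le_trans t1.
  exact: ww.
exact: partial_eq_open oU Ux (fg tau t1).
Qed.

Lemma Bd_le k M w f : Bd k.+1 M w f ->
  (forall tau, 1 <= tau -> 0 <= M * w tau) -> Bd k M w f.
Proof.
elim: k w f => [|k IH] w f [h1 h2] M0; split => // j.
have [h3 h4] := h2 j; split => //; apply: IH h4 _ => tau t1.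
by rewrite mulrCA mulr_ge0 ?M0 // (le_trans _ t1).
Qed.

Lemma BdS k M w f (g : 'I_n -> R -> V -> R) :
  (forall tau, 1 <= tau -> forall x, U x ->
     {for x, continuous (f tau)} /\ `|f tau x| <= M * w tau) ->
  (forall j, (forall tau, 1 <= tau -> forall x, U x ->
     is_derive x (delta_mx 0 j) (f tau) (g j tau x)) /\
     Bd k M (fun tau => tau * w tau) (g j)) -> Bd k.+1 M w f.
Proof.
move=> h1 h2; split => // j; have [h3 h4] := h2 j; split.
  by move=> tau t1 x Ux; have [] := h3 tau t1 x Ux.
by apply: Bd_mono h4 => // tau t1 x Ux; rewrite (partial_val (h3 tau t1 x Ux)).
Qed.

Lemma BdD k M1 M2 w f g : Bd k M1 w f -> Bd k M2 w g ->
  Bd k (M1 + M2) w (fun tau x => f tau x + g tau x).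
Proof.
elim: k w f g => [|k IH] w f g hf hg.
  split => // tau t1 x Ux.
  have [h1 h2] := Bd0 hf t1 Ux; have [h3 h4] := Bd0 hg t1 Ux.
  split; first exact: (continuousD h1 h3).
  by rewrite mulrDl; apply: le_trans (ler_normD _ _) (lerD h2 h4).
apply: (@BdS _ _ _ _ (fun j tau x => partial j (f tau) x + partial j (g tau) x)).
  move=> tau t1 x Ux.
  have [h1 h2] := Bd0 hf t1 Ux; have [h3 h4] := Bd0 hg t1 Ux.
  split; first exact: (continuousD h1 h3).
  by rewrite mulrDl; apply: le_trans (ler_normD _ _) (lerD h2 h4).
move=> j; split; last exact: IH (Bd_partial j hf) (Bd_partial j hg).
move=> tau t1 x Ux.
exact: (is_deriveD (Bd_is_derive hf j t1 Ux) (Bd_is_derive hg j t1 Ux)).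
Qed.

(** Each derivative splits a product into two terms, whence the factor [2 ^+ k]; lowering the order
    of the undifferentiated factor is where nonnegativity is used. *)
Lemma BdM k M1 M2 w1 w2 f g :
  (forall tau, 1 <= tau -> 0 <= M1 * w1 tau) ->
  (forall tau, 1 <= tau -> 0 <= M2 * w2 tau) ->
  Bd k M1 w1 f -> Bd k M2 w2 g ->
  Bd k (2 ^+ k * (M1 * M2)) (fun tau => w1 tau * w2 tau)
    (fun tau x => f tau x * g tau x).
Proof.
have base (z1 z2 : R -> R) tau F G x : Bd 0 M1 z1 F -> Bd 0 M2 z2 G -> 1 <= tau ->
    U x -> `|F tau x * G tau x| <= M1 * M2 * (z1 tau * z2 tau).
  move=> hF hG t1 Ux; have [_ h2] := Bd0 hF t1 Ux; have [_ h4] := Bd0 hG t1 Ux.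
  by rewrite normrM mulrACA; apply: ler_pM.
elim: k w1 w2 f g => [|k IH] w1 w2 f g p1 p2 hf hg.
  split => // tau t1 x Ux.
  have [h1 h2] := Bd0 hf t1 Ux; have [h3 h4] := Bd0 hg t1 Ux.
  split; first exact: (continuousM h1 h3).
  by rewrite expr0 mul1r; exact: base.
apply: (@BdS _ _ _ _ (fun j tau x => f tau x * partial j (g tau) x
    + g tau x * partial j (f tau) x)).
  move=> tau t1 x Ux.
  have [h1 h2] := Bd0 hf t1 Ux; have [h3 h4] := Bd0 hg t1 Ux.
  split; first exact: (continuousM h1 h3).
  have h5 : `|f tau x * g tau x| <= M1 * M2 * (w1 tau * w2 tau).
    by rewrite normrM mulrACA; apply: ler_pM.
  apply: le_trans h5 _; rewrite -[leRHS]mulrA; apply: ler_peMl.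
    by rewrite mulrACA mulr_ge0 ?p1 ?p2.
  by rewrite exprn_ege1 // ler1n.
move=> j; split.
  move=> tau t1 x Ux.
  exact: (is_deriveM (Bd_is_derive hf j t1 Ux) (Bd_is_derive hg j t1 Ux)).
have t0 tau : 1 <= tau -> 0 <= tau :> R by exact: le_trans.
have q1 tau : 1 <= tau -> 0 <= M1 * (tau * w1 tau).
  by move=> t1; rewrite mulrCA mulr_ge0 ?p1 ?t0.
have q2 tau : 1 <= tau -> 0 <= M2 * (tau * w2 tau).
  by move=> t1; rewrite mulrCA mulr_ge0 ?p2 ?t0.
have A := IH _ _ _ _ p1 q2 (Bd_le hf p1) (Bd_partial j hg).
have B := IH _ _ _ _ q1 p2 (Bd_partial j hf) (Bd_le hg p2).
have A' : Bd k (2 ^+ k * (M1 * M2)) (fun tau => tau * (w1 tau * w2 tau))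
    (fun tau x => f tau x * partial j (g tau) x).
  by apply: Bd_mono A => // tau t1; rewrite le_eqVlt; apply/orP; left; apply/eqP; ring.
have B' : Bd k (2 ^+ k * (M1 * M2)) (fun tau => tau * (w1 tau * w2 tau))
    (fun tau x => g tau x * partial j (f tau) x).
  apply: Bd_mono B => [tau t1|tau t1 x Ux]; last exact: mulrC.
  by rewrite le_eqVlt; apply/orP; left; apply/eqP; ring.
have -> : 2 ^+ k.+1 * (M1 * M2) = 2 ^+ k * (M1 * M2) + 2 ^+ k * (M1 * M2).
  by rewrite exprS; ring.
exact: BdD A' B'.
Qed.

(** A function that is C^k around a compact closure has bounded derivatives there, and for tau >= 1
    the weights tau^j of the derivatives only help. The constants are added up because [Bd] uses a
    single one for all orders. *)
Lemma Ck_Bd k (W : set V) (f : V -> R) : open W -> compact (closure U) ->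
  closure U `<=` W -> Ck k W f ->
  exists2 M, 0 <= M & Bd k M (fun=> 1) (fun=> f).
Proof.
move=> oW cU UW; have UW' x : U x -> W x by move=> Ux; exact/UW/subset_closure.
have bound (g : V -> R) : (forall x, W x -> {for x, continuous g}) ->
    exists2 M, 0 <= M & forall x, U x -> `|g x| <= M.
  move=> cg; have [U0|/set0P U0] := eqVneq (closure U) set0.
    exists 0 => // x /subset_closure; by rewrite U0.
  have [|c _ hc] := @compact_EVT_max V R (fun x => `|g x|) (closure U) U0 cU.
    apply/continuous_in_subspaceT => x; rewrite inE => /UW /cg cgx.
    by apply: continuous_comp; [exact: cgx|exact: norm_continuous].
  exists `|g c| => // x Ux; apply: hc; rewrite inE; exact: subset_closure.
elim: k f => [|k IH] f cf.
  have [M M0 hM] := bound f (fun x Wx => Ck_continuous cf Wx).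
  exists M => //; split => // tau t1 x Ux; rewrite mulr1; split; last exact: hM.
  exact: (Ck_continuous cf (UW' x Ux)).
have [M M0 hM] := bound f (fun x Wx => Ck_continuous cf Wx).
have /choice[Mj hMj] : forall j, exists Mj, 0 <= Mj /\ Bd k Mj (fun=> 1) (fun=> partial j f).
  by move=> j; have [Mj ? ?] := IH _ (Ck_partial j cf); exists Mj.
pose S := M + \sum_j Mj j.
have S0 : 0 <= \sum_j Mj j by apply: sumr_ge0 => j _; case: (hMj j).
exists S; first by rewrite addr_ge0.
apply: (@BdS _ _ _ _ (fun j _ => partial j f)).
  move=> tau t1 x Ux; rewrite mulr1; split.
    exact: (Ck_continuous cf (UW' x Ux)).
  by apply: le_trans (hM x Ux) _; rewrite lerDl.
move=> j; split.
  by move=> tau t1 x Ux; exact: (Ck_is_derive cf j (UW' x Ux)).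
have [Mj0 hj] := hMj j; apply: Bd_mono hj => // tau t1; rewrite !mulr1.
apply: le_trans (_ : S * 1 <= _).
  rewrite mulr1 /S (bigD1 j) //= addrCA lerDl addr_ge0 //.
  by apply: sumr_ge0 => i _; case: (hMj i).
by apply: ler_wpM2l => //; rewrite addr_ge0.
Qed.

(** A t-derivative of E costs one factor tau, as the symbol class allows. The induction passes to
    the shifted sequence with weight tau * w, multiplied by the fixed symbol [partial j p]. *)
Lemma Bd_comp k (W : set V) (p : V -> R) (I : set R) (E : nat -> R -> R -> R) w M :
  open W -> compact (closure U) -> closure U `<=` W -> (forall k, Ck k W p) ->
  (forall x, U x -> I (p x)) -> 0 <= M -> (forall tau, 1 <= tau -> 0 <= w tau) ->
  (forall m tau t, (m <= k)%N -> 1 <= tau -> I t ->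
     is_derive t 1 (E m tau) (E m.+1 tau t) /\
     `|E m tau t| <= M * (tau ^+ m * w tau)) ->
  exists2 M', 0 <= M' & Bd k M' w (fun tau x => E 0 tau (p x)).
Proof.
move=> oW cU UW cp pI M0; have UW' x : U x -> W x by move=> Ux; exact/UW/subset_closure.
elim: k E w => [|k IH] E w w0 hE.
  exists M => //; split => // tau t1 x Ux.
  have [h1 h2] := hE 0%N tau (p x) isT t1 (pI x Ux).
  split; last by move: h2; rewrite expr0 mul1r.
  apply: continuous_comp; last exact: is_derive1_continuous h1.
  exact: (Ck_continuous (cp 0%N) (UW' x Ux)).
have tw tau : 1 <= tau -> 0 <= tau * w tau.
  by move=> t1; rewrite mulr_ge0 ?w0 // (le_trans _ t1).
have [|M1 M10 B1] := IH (fun m => E m.+1) (fun tau => tau * w tau) tw.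
  move=> m tau t mk t1 It; have [h1 h2] := hE m.+1 tau t mk t1 It.
  by split=> //; apply: le_trans h2 _; rewrite exprSr -[X in M * X]mulrA.
have /choice[Mj hMj] : forall j, exists Mj, 0 <= Mj /\ Bd k Mj (fun=> 1) (fun=> partial j p).
  move=> j; have [Mj ? ?] := Ck_Bd oW cU UW (Ck_partial j (cp k.+1)).
  by exists Mj.
pose S := M + \sum_j 2 ^+ k * (M1 * Mj j).
have P0 j : 0 <= 2 ^+ k * (M1 * Mj j).
  by rewrite mulr_ge0 ?exprn_ge0 // mulr_ge0 //; case: (hMj j).
have S0 : 0 <= \sum_j 2 ^+ k * (M1 * Mj j) by exact: sumr_ge0.
exists S; first by rewrite addr_ge0.
apply: (@BdS _ _ _ _ (fun j tau x => E 1%N tau (p x) * partial j p x)).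
  move=> tau t1 x Ux.
  have [h1 h2] := hE 0%N tau (p x) isT t1 (pI x Ux); split.
    apply: continuous_comp; last exact: is_derive1_continuous h1.
    exact: (Ck_continuous (cp 0%N) (UW' x Ux)).
  apply: le_trans h2 _; rewrite expr0 mul1r; apply: ler_wpM2r; first exact: w0.
  by rewrite lerDl.
move=> j; split.
  move=> tau t1 x Ux; have [h1 _] := hE 0%N tau (p x) isT t1 (pI x Ux).
  exact: (is_derive_comp_real h1 (Ck_is_derive (cp 1%N) j (UW' x Ux))).
have [Mj0 hj] := hMj j.
have p1 tau : 1 <= tau -> 0 <= M1 * (tau * w tau) by move=> t1; rewrite mulr_ge0 ?tw.
have p2 (tau : R) : 1 <= tau -> 0 <= Mj j * (1 : R) by rewrite mulr1.
have H := BdM p1 p2 B1 hj; apply: (Bd_mono _ _ H) => // tau t1; rewrite mulr1.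
apply: ler_wpM2r; first exact: tw.
rewrite /S (bigD1 j) //= addrCA lerDl addr_ge0 //.
by apply: sumr_ge0 => i _.
Qed.

End Families.

(** * Complex-valued functions of class C^k and complex symbols *)

Section ComplexCk.
Context {R : realType} {n : nat}.
Local Notation V := 'rV[R]_n.
Variable U : set V.
Hypothesis oU : open U.
Implicit Types (F G : V -> R[i]) (k : nat).

Lemma cCkM k F G : cCk k U F -> cCk k U G -> cCk k U (fun x => F x * G x).
Proof.
move=> [f1 f2] [g1 g2]; split.
  apply: Ck_eq oU _ (CkD oU (CkM oU f1 g1) (CkN oU (CkM oU f2 g2))) => x _.
  by rewrite cReM.
apply: Ck_eq oU _ (CkD oU (CkM oU f1 g2) (CkM oU f2 g1)) => x _.
by rewrite cImM.
Qed.

Lemma cCkD k F G : cCk k U F -> cCk k U G -> cCk k U (fun x => F x + G x).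
Proof.
move=> [f1 f2] [g1 g2]; split.
  by apply: Ck_eq oU _ (CkD oU f1 g1) => x _; rewrite cReD.
by apply: Ck_eq oU _ (CkD oU f2 g2) => x _; rewrite cImD.
Qed.

Lemma cCk_cst k (z : R[i]) : cCk k U (fun=> z).
Proof. by split; exact: Ck_cst. Qed.

Lemma cCk_real k (f : V -> R) : Ck k U f -> cCk k U (fun x => (f x)%:C).
Proof. by move=> cf; split => //; exact: Ck_cst. Qed.

End ComplexCk.

Section ComplexFamilies.
Context {R : realType} {n : nat}.
Local Notation V := 'rV[R]_n.
Variables U W : set V.
Hypotheses (oU : open U) (oW : open W) (cU : compact (closure U)).
Hypothesis UW : closure U `<=` W.
Implicit Types (w : R -> R) (F G : R -> V -> R[i]) (k : nat).

Definition nneg_weight w := forall tau, 1 <= tau -> 0 <= w tau.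

Definition cBd k w F := exists2 M, 0 <= M &
  Bd U k M w (fun tau x => complex.Re (F tau x)) /\
  Bd U k M w (fun tau x => complex.Im (F tau x)).

Lemma cBd_join k w F M1 M2 : nneg_weight w -> 0 <= M1 -> 0 <= M2 ->
  Bd U k M1 w (fun tau x => complex.Re (F tau x)) ->
  Bd U k M2 w (fun tau x => complex.Im (F tau x)) -> cBd k w F.
Proof.
move=> w0 M10 M20 h1 h2; exists (M1 + M2); first exact: addr_ge0.
split; [apply: (Bd_mono oU _ _ h1) => //|apply: (Bd_mono oU _ _ h2) => //];
  move=> tau t1; apply: ler_wpM2r; by [exact: w0|rewrite ?lerDl ?lerDr].
Qed.

Lemma cBd_eq k w F G : (forall tau, 1 <= tau -> forall x, U x -> F tau x = G tau x) ->
  cBd k w F -> cBd k w G.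
Proof.
move=> FG [M M0 [h1 h2]]; exists M => //.
by split; [apply: (Bd_mono oU _ _ h1) => //|apply: (Bd_mono oU _ _ h2) => //];
  move=> tau t1 x Ux; rewrite FG.
Qed.

Lemma cBd_weaken k w w' F : (forall tau, 1 <= tau -> w tau <= w' tau) ->
  cBd k w F -> cBd k w' F.
Proof.
move=> ww [M M0 [h1 h2]]; exists M => //.
by split; [apply: (Bd_mono oU _ _ h1) => //|apply: (Bd_mono oU _ _ h2) => //];
  move=> tau t1; apply: ler_wpM2l => //; exact: ww.
Qed.

Lemma cBdD k w F G : cBd k w F -> cBd k w G ->
  cBd k w (fun tau x => F tau x + G tau x).
Proof.
move=> [M M0 [h1 h2]] [M' M'0 [h3 h4]]; exists (M + M'); first exact: addr_ge0.
by split; [apply: (Bd_mono oU _ _ (BdD oU h1 h3)) => //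
  |apply: (Bd_mono oU _ _ (BdD oU h2 h4)) => //]; move=> tau t1 x Ux;
  rewrite ?cReD ?cImD.
Qed.

Lemma BdN k M w (f : R -> V -> R) : Bd U k M w f -> Bd U k M w (fun tau x => - f tau x).
Proof.
elim: k w f => [|k IH] w f hf.
  split => // tau t1 x Ux; have [h1 h2] := Bd0 hf t1 Ux.
  by split; [exact: (continuousN h1)|rewrite normrN].
apply: (@BdS _ _ _ oU _ _ _ _ (fun j tau x => - partial j (f tau) x)).
  move=> tau t1 x Ux; have [h1 h2] := Bd0 hf t1 Ux.
  by split; [exact: (continuousN h1)|rewrite normrN].
move=> j; split; last exact: IH (Bd_partial j hf).
by move=> tau t1 x Ux; exact: (is_deriveN (Bd_is_derive hf j t1 Ux)).
Qed.

Lemma cBdM k w1 w2 F G : nneg_weight w1 -> nneg_weight w2 ->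
  cBd k w1 F -> cBd k w2 G ->
  cBd k (fun tau => w1 tau * w2 tau) (fun tau x => F tau x * G tau x).
Proof.
move=> p1 p2 [M M0 [h1 h2]] [M' M'0 [h3 h4]].
have q1 tau : 1 <= tau -> 0 <= M * w1 tau by move=> t1; rewrite mulr_ge0 ?p1.
have q2 tau : 1 <= tau -> 0 <= M' * w2 tau by move=> t1; rewrite mulr_ge0 ?p2.
set K := 2 ^+ k * (M * M').
have K0 : 0 <= K by rewrite mulr_ge0 ?exprn_ge0 // mulr_ge0.
exists (K + K); first exact: addr_ge0.
have A := BdD oU (BdM oU q1 q2 h1 h3) (BdN (BdM oU q1 q2 h2 h4)).
have B := BdD oU (BdM oU q1 q2 h1 h4) (BdM oU q1 q2 h2 h3).
by split; [apply: (Bd_mono oU _ _ A) => //|apply: (Bd_mono oU _ _ B) => //];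
  move=> tau t1 x Ux; rewrite ?cReM ?cImM.
Qed.

Lemma cBd_Ck k w F tau : 1 <= tau -> cBd k w F -> cCk k U (F tau).
Proof. by move=> t1 [M M0 [h1 h2]]; split; [exact: (Bd_Ck t1 h1)|exact: (Bd_Ck t1 h2)]. Qed.

Lemma cBd_cst k (G : V -> R[i]) : cCk k W G -> cBd k (fun=> 1) (fun=> G).
Proof.
move=> [h1 h2]; have [M1 M10 b1] := Ck_Bd oU oW cU UW h1.
have [M2 M20 b2] := Ck_Bd oU oW cU UW h2.
exact: (cBd_join (fun _ _ => ler01) M10 M20 b1 b2).
Qed.

Lemma Bd_scalar k w (s : R -> R) : nneg_weight w ->
  (forall tau, 1 <= tau -> `|s tau| <= w tau) -> Bd U k 1 w (fun tau _ => s tau).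
Proof.
move=> w0 sw; have cc (d : R) (x : V) : {for x, continuous (fun _ : V => d)}.
  exact: cst_continuous.
elim: k w s w0 sw => [|k IH] w s w0 sw.
  by split => // tau t1 x Ux; split; [exact: cc|rewrite mul1r; exact: sw].
apply: (@BdS _ _ _ oU _ _ _ _ (fun _ _ _ => 0)).
  by move=> tau t1 x Ux; split; [exact: cc|rewrite mul1r; exact: sw].
move=> j; split; first by move=> tau t1 x Ux; exact: is_derive_cst.
have tw tau : 1 <= tau -> 0 <= tau * w tau.
  by move=> t1; rewrite mulr_ge0 ?w0 // (le_trans _ t1).
by apply: IH => // tau t1; rewrite normr0 tw.
Qed.

Lemma cBd_scale k w w' (s : R -> R) F : nneg_weight w -> nneg_weight w' ->
  (forall tau, 1 <= tau -> `|s tau| <= w' tau) -> cBd k w F ->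
  cBd k (fun tau => w' tau * w tau) (fun tau x => (s tau)%:C * F tau x).
Proof.
move=> w0 w0' sw hF; apply: cBdM => //.
have z0 : forall tau : R, 1 <= tau -> `|0 : R| <= w' tau.
  by move=> tau t1; rewrite normr0 w0'.
by exists 1 => //; split; [exact: Bd_scalar|exact: (@Bd_scalar k w' (fun=> 0))].
Qed.

Lemma cBd_comp k (p : V -> R) (I : set R) (E : R -> nat -> R -> R[i]) w M :
  (forall k, Ck k W p) -> (forall x, U x -> I (p x)) -> 0 <= M -> nneg_weight w ->
  (forall m tau t, (m <= k)%N -> 1 <= tau -> I t ->
     cder t 1 (E tau m) (E tau m.+1 t) /\
     cnorm (E tau m t) <= M * (tau ^+ m * w tau)) ->
  cBd k w (fun tau x => E tau 0%N (p x)).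
Proof.
move=> cp pI M0 w0 hE.
have [|M1 M10 B1] := @Bd_comp _ _ _ oU k W p I
    (fun m tau t => complex.Re (E tau m t)) w M oW cU UW cp pI M0 w0.
  move=> m tau t mk t1 It; have [[h1 h2] h3] := hE m tau t mk t1 It; split=> //.
  by apply: le_trans h3; rewrite /cnorm lerDl.
have [|M2 M20 B2] := @Bd_comp _ _ _ oU k W p I
    (fun m tau t => complex.Im (E tau m t)) w M oW cU UW cp pI M0 w0.
  move=> m tau t mk t1 It; have [[h1 h2] h3] := hE m tau t mk t1 It; split=> //.
  by apply: le_trans h3; rewrite /cnorm lerDr.
exact: cBd_join B1 B2.
Qed.

(** [cBd] with the constant exposed, for bounds that must be uniform over components and
    multi-indices. *)
Definition cBd_with k M w F :=
  Bd U k M w (fun tau x => complex.Re (F tau x)) /\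
  Bd U k M w (fun tau x => complex.Im (F tau x)).

Lemma cBd_with_cpartial k M w F j : cBd_with k.+1 M w F ->
  cBd_with k M (fun tau => tau * w tau) (fun tau => cpartial j (F tau)).
Proof. by move=> [h1 h2]; split; [exact: Bd_partial h1|exact: Bd_partial h2]. Qed.

Lemma cBd_with_iter k m M w F j : cBd_with (m + k) M w F ->
  cBd_with k M (fun tau => tau ^+ m * w tau) (fun tau => iter m (cpartial j) (F tau)).
Proof.
elim: m k => [|m IH] k h.
  rewrite (_ : (fun tau => tau ^+ 0 * w tau) = w) //.
  by apply/funext => tau; rewrite expr0 mul1r.
rewrite addSnnS in h; have := cBd_with_cpartial j (IH _ h).
rewrite (_ : (fun tau => tau * (tau ^+ m * w tau)) = (fun tau => tau ^+ m.+1 * w tau)) //.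
by apply/funext => tau; rewrite exprS mulrA.
Qed.

Lemma cBd_with_cderiv k (al : 'I_n -> nat) M w F : cBd_with (mi_order al + k) M w F ->
  cBd_with k M (fun tau => tau ^+ mi_order al * w tau) (fun tau => cderiv al (F tau)).
Proof.
(* The order is rewritten as a sum over the list on which [cderiv] folds, so that both unfold
   together in the induction. *)
rewrite /mi_order /cderiv -[\sum_i al i]big_enum /= => h.
have {h} : cBd_with (\sum_(i <- enum 'I_n) al i + k) M w F by [].
elim: (enum 'I_n) k => [|j s IH] k.
  rewrite big_nil add0n => h.
  rewrite (_ : (fun tau => tau ^+ 0 * w tau) = w) //.
  by apply/funext => tau; rewrite expr0 mul1r.
rewrite big_cons => h; rewrite (addnC (al j)) -addnA in h.
have := cBd_with_iter j (IH _ h).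
rewrite (_ : (fun tau => tau ^+ al j * (tau ^+ (\sum_(j <- s) al j) * w tau)) =
   (fun tau => tau ^+ (al j + \sum_(j <- s) al j) * w tau)) //.
by apply/funext => tau; rewrite exprD mulrA.
Qed.

End ComplexFamilies.

(** The integral of a nonnegative function is a supremum over the simple functions below it, so
    monotonicity holds for arbitrary integrands, in particular for the norms of the remainder. *)
Lemma le_integralT {d} {T : measurableType d} {R : realType}
    (mu : {measure set T -> \bar R}) (f g : T -> \bar R) :
  (forall x, 0 <= f x)%E -> (forall x, f x <= g x)%E ->
  (\int[mu]_x f x <= \int[mu]_x g x)%E.
Proof.
move=> f0 fg; have g0 x : (0 <= g x)%E by exact: le_trans (fg x).
rewrite !ge0_integralTE //; apply: ereal_sup_le => _ [h hf <-].
by exists h => // x; apply: le_trans (fg x); exact: hf.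
Qed.

(** * From pointwise bounds to L^2 norms *)

Section L2.
Context {R : realType}.
Local Notation V := 'rV[R]_3.

(** U lies in the cube [-B, B]^3, whose volume is (2 B)^3, and the squared integrand is at most c^2
    there. *)
Lemma L2norm_le (U : set V) p q (F : V -> 'M[R[i]]_(p, q)) (c B : R) :
  0 <= c -> 0 <= B -> (forall x, U x -> forall i, `|x 0 i| <= B) ->
  (forall x, U x -> frobenius (F x) <= c) ->
  (L2norm U F <= (c * Num.sqrt ((2 * B) ^+ 3))%:E)%E.
Proof.
move=> c0 B0 UB Fc; rewrite /L2norm unlock /=.
pose Q : set (measurableTypeR R * measurableTypeR R * measurableTypeR R) :=
  (`[- B, B] `*` `[- B, B]) `*` `[- B, B].
have mI : measurable (`[- B, B] : set (measurableTypeR R)) by exact: measurable_itv.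
have mQ : measurable Q by apply: measurableX => //; exact: measurableX.
have lI : lebesgue_measure (`[- B, B] : set (measurableTypeR R)) = (2 * B)%:E.
  (* The length formula separates degenerate intervals, here the case B = 0. *)
  rewrite lebesgue_measure_itv /= lte_fin; case: ltP => h.
    by rewrite -EFinB opprK -mulr2n mulr_natl.
  have -> : B = 0 by lra.
  by rewrite mulr0.
have muQ : leb3 Q = ((2 * B) ^+ 3)%:E.
  apply: etrans (product_measure1E _ _ (measurableX mI mI) mI) _.
  transitivity (((2 * B)%:E * (2 * B)%:E) * (2 * B)%:E)%E.
    congr (_ * _)%E; last exact: lI.
    by apply: etrans (product_measure1E _ _ mI mI) _; congr (_ * _)%E; exact: lI.
  by rewrite -!EFinM; congr _%:E; ring.
have -> : (c * Num.sqrt ((2 * B) ^+ 3))%:E = (((c ^+ 2)%:E * leb3 Q) `^ 2^-1)%E.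
  rewrite muQ -EFinM poweR_EFin powR12_sqrt; last first.
    by rewrite mulr_ge0 ?sqr_ge0 // exprn_ge0 // mulr_ge0.
  by rewrite (sqrtrM _ (sqr_ge0 c)) sqrtr_sqr ger0_norm.
have I0 (y : \bar R) : (0 <= y)%E -> y \in `[0%E, +oo%E].
  by move=> y0; rewrite in_itv /= y0 leey.
apply: gt0_ler_poweR => //.
- by apply/I0/integral_ge0 => x _; rewrite lee_fin powR_ge0.
- by apply: I0; rewrite mule_ge0 // lee_fin sqr_ge0.
rewrite -integral_cst // integral_mkcond.
apply: le_integralT => [z|z]; first by rewrite lee_fin powR_ge0.
have [Uz|Uz] := pselect (U (coord3 z)); last first.
  rewrite indicE memNset // mul0r normr0 powR0 //.
  by rewrite /patch; case: ifPn => // _; rewrite lee_fin sqr_ge0.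
have zQ : z \in Q.
  rewrite inE /Q /=; have h := UB _ Uz.
  rewrite !in_itv /= -!ler_norml.
  have := h 0; have := h 1; have := h (2%:R); rewrite /coord3 !mxE.
  by rewrite !(tnth_nth 0) /= => -> -> ->.
rewrite /patch zQ indicE mem_set // mul1r lee_fin powR_mulrn //.
rewrite ger0_norm; last exact: sqrtr_ge0.
by rewrite !expr2; apply: ler_pM => //; try exact: sqrtr_ge0; exact: Fc.
Qed.

End L2.

(** * Complex partial derivatives *)

Section CPartial.
Context {R : realType} {n : nat}.
Local Notation V := 'rV[R]_n.
Implicit Types (f g : V -> R[i]) (x : V) (j : 'I_n).

Lemma cpartial_val j f x d : cder x (delta_mx 0 j) f d -> cpartial j f x = d.
Proof.
move=> [h1 h2]; rewrite /cpartial (partial_val h1) (partial_val h2).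
by case: d {h1 h2}.
Qed.

Lemma cpartial_eq_open (U : set V) j f g x : open U -> U x ->
  (forall y, U y -> f y = g y) -> cpartial j f x = cpartial j g x.
Proof.
move=> oU Ux fg; rewrite /cpartial.
by congr (_ +i* _); apply: (partial_eq_open j oU Ux) => y /fg ->.
Qed.

Lemma cCk_cder k (U : set V) f j x : cCk k.+1 U f -> U x ->
  cder x (delta_mx 0 j) f (cpartial j f x).
Proof.
move=> [h1 h2] Ux.
by split; [exact: (Ck_is_derive h1 j Ux)|exact: (Ck_is_derive h2 j Ux)].
Qed.

Lemma cCk_cpartial k (U : set V) f j : cCk k.+1 U f -> cCk k U (cpartial j f).
Proof. by move=> [h1 h2]; split; [exact: (Ck_partial j h1)|exact: (Ck_partial j h2)]. Qed.

Lemma cpartialC (U : set V) f i j x : open U -> U x -> cCk 2 U f ->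
  cpartial i (cpartial j f) x = cpartial j (cpartial i f) x.
Proof.
move=> oU Ux [h1 h2].
exact (f_equal2 (fun a b => a +i* b) (partialC i j oU Ux h1) (partialC i j oU Ux h2)).
Qed.

End CPartial.

(** The second derivative in one direction, regrouped for summation: a, b are the partial
    derivatives of al and be, t is tau^2, and f, f1, f2, f12 are the profile and its derivatives in
    al and be. The coefficients of f1 and f2 are transport terms, that of f12 an orthogonality
    term. *)
Lemma wave_second_derivative {K : comNzRingType} (a b a' b' f f1 f2 f12 h h' h'' t qa qb : K) :
  (a' * f1 + a * (a * ((t + qa) * f) + b * f12)
   + (b' * f2 + b * (a * f12 + b * ((- t + qb) * f)))) * h + (a * f1 + b * f2) * h'
  + ((a * f1 + b * f2) * h' + f * h'') =
  f1 * (a' * h + 2 * a * h') + f2 * (b' * h + 2 * b * h') + 2 * f12 * h * (a * b)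
  + f * (a ^+ 2 * (t + qa) * h + b ^+ 2 * (- t + qb) * h + h'').
Proof. by ring. Qed.

(** * Separated waves *)

(* The eikonal equations for al + i be, the transport equations along both gradients
   and the equation for H separate the Helmholtz equation for
   e^(tau (al + ct + i be)) X(al) Z(be) H into one equation for X and one for Z. *)
Section Wave.
Context {R : realType}.
Local Notation V := 'rV[R]_3.
Variables (U : set V) (al be : V -> R) (H : 'I_3 -> V -> R) (m : V -> R).
Variables (qa qb : R -> R) (k2 tau ct : R) (X0 X1 Z0 Z1 : R -> R[i]).
Local Notation pd := partial.
Local Notation ii := (0 +i* 1 : R[i]).
Hypothesis oU : open U.
Hypotheses (al_smooth : Ck 2 U al) (be_smooth : Ck 2 U be).
Hypothesis H_smooth : forall i, Ck 2 U (H i).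
Hypothesis eik_al : forall x, U x -> \sum_j pd j al x ^+ 2 = m x.
Hypothesis eik_be : forall x, U x -> \sum_j pd j be x ^+ 2 = m x.
Hypothesis eik_ort : forall x, U x -> \sum_j pd j al x * pd j be x = 0.
Hypothesis trans_al : forall x i, U x ->
  2 * (\sum_j pd j al x * pd j (H i) x) + H i x * \sum_j pd j (pd j al) x = 0.
Hypothesis trans_be : forall x i, U x ->
  2 * (\sum_j pd j be x * pd j (H i) x) + H i x * \sum_j pd j (pd j be) x = 0.
Hypothesis lap_H : forall x i, U x ->
  \sum_j pd j (pd j (H i)) x + k2 * H i x
  = - (m x * (qa (al x) + qb (be x)) * H i x).
Hypothesis al_H : forall x, U x -> \sum_i pd i al x * H i x = 0.
Hypothesis be_H : forall x, U x -> \sum_i pd i be x * H i x = 0.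
Hypothesis div_H : forall x, U x -> \sum_i pd i (H i) x = 0.
Hypothesis dX0 : forall x, U x -> cder (al x) 1 X0 (X1 (al x)).
Hypothesis dX1 : forall x, U x -> cder (al x) 1 X1
  (- (2 * tau)%:C * X1 (al x) + (qa (al x))%:C * X0 (al x)).
Hypothesis dZ0 : forall x, U x -> cder (be x) 1 Z0 (Z1 (be x)).
Hypothesis dZ1 : forall x, U x -> cder (be x) 1 Z1
  (- (2 * tau)%:C * ii * Z1 (be x) + (qb (be x))%:C * Z0 (be x)).

Let E (x : V) : R[i] := cexp ((tau * (al x + ct)) +i* (tau * be x)).
Let T : R[i] := tau%:C.
Let A j x : R[i] := (pd j al x)%:C.
Let B j x : R[i] := (pd j be x)%:C.

Let i2 : ii * ii = -1.
Proof. by rewrite /GRing.mul /=; congr (_ +i* _); ring. Qed.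

Let dal j x : U x -> is_derive x (delta_mx 0 j) al (pd j al x).
Proof. by move=> Ux; exact: (Ck_is_derive al_smooth j Ux). Qed.

Let dbe j x : U x -> is_derive x (delta_mx 0 j) be (pd j be x).
Proof. by move=> Ux; exact: (Ck_is_derive be_smooth j Ux). Qed.

Let dE j x : U x -> cder x (delta_mx 0 j) E (E x * (T * A j x + T * ii * B j x)).
Proof.
move=> Ux.
have h1 : is_derive x (delta_mx 0 j) (fun y => expR (tau * (al y + ct)))
   (expR (tau * (al x + ct)) * (tau * pd j al x)).
  apply: (is_derive_comp_real (is_derive_expR _)).
  have h := is_deriveZ tau (is_deriveD (dal j Ux) (is_derive_cst ct x (delta_mx 0 j))).
  by apply: is_derive_eq h _; rewrite addr0.
have h0 : is_derive x (delta_mx 0 j) (fun y => tau * be y) (tau * pd j be x).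
  by have h := is_deriveZ tau (dbe j Ux); apply: is_derive_eq h _.
have h2 : is_derive x (delta_mx 0 j) (fun y => cos (tau * be y))
   (- sin (tau * be x) * (tau * pd j be x)).
  exact: (is_derive_comp_real (is_derive_cos _) h0).
have h3 : is_derive x (delta_mx 0 j) (fun y => sin (tau * be y))
   (cos (tau * be x) * (tau * pd j be x)).
  exact: (is_derive_comp_real (is_derive_sin _) h0).
have h4 : cder x (delta_mx 0 j) (fun y => cos (tau * be y) +i* sin (tau * be y))
  ((- sin (tau * be x) * (tau * pd j be x)) +i* (cos (tau * be x) * (tau * pd j be x))).
  by split.
apply: cder_eq (cderM (cder_real h1) h4) _.
rewrite /E /cexp /T /A /B /=.
by apply: complex_ext; rewrite ?cReD ?cImD !(cReM, cImM, cReD, cImD) /=; ring.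
Qed.

(** [F1], [F2] and [F12] are derivatives of [F] in al and be taken as independent variables. The
    equations for X and Z are made so that the pure second derivatives are multiples of [F]: the
    exponential absorbs the first-order terms. *)
Let F x := E x * X0 (al x) * Z0 (be x).
Let F1 x := E x * (T * X0 (al x) + X1 (al x)) * Z0 (be x).
Let F2 x := E x * X0 (al x) * (T * ii * Z0 (be x) + Z1 (be x)).
Let F12 x := E x * (T * X0 (al x) + X1 (al x)) * (T * ii * Z0 (be x) + Z1 (be x)).

Let dX0x j x : U x -> cder x (delta_mx 0 j) (fun y => X0 (al y)) (X1 (al x) * A j x).
Proof. by move=> Ux; exact: cder_comp (dX0 Ux) (dal j Ux). Qed.
Let dX1x j x : U x -> cder x (delta_mx 0 j) (fun y => X1 (al y))
  ((- (2 * tau)%:C * X1 (al x) + (qa (al x))%:C * X0 (al x)) * A j x).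
Proof. by move=> Ux; exact: cder_comp (dX1 Ux) (dal j Ux). Qed.
Let dZ0x j x : U x -> cder x (delta_mx 0 j) (fun y => Z0 (be y)) (Z1 (be x) * B j x).
Proof. by move=> Ux; exact: cder_comp (dZ0 Ux) (dbe j Ux). Qed.
Let dZ1x j x : U x -> cder x (delta_mx 0 j) (fun y => Z1 (be y))
  ((- (2 * tau)%:C * ii * Z1 (be x) + (qb (be x))%:C * Z0 (be x)) * B j x).
Proof. by move=> Ux; exact: cder_comp (dZ1 Ux) (dbe j Ux). Qed.

Let T2 : (2 * tau)%:C = 2 * T.
Proof. by rewrite rmorphM rmorph_nat. Qed.

Let dF j x : U x -> cder x (delta_mx 0 j) F (A j x * F1 x + B j x * F2 x).
Proof.
move=> Ux; apply: cder_eq (cderM (cderM (dE j Ux) (dX0x j Ux)) (dZ0x j Ux)) _.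
by rewrite /F1 /F2; ring.
Qed.

Let dF1 j x : U x -> cder x (delta_mx 0 j) F1
  (A j x * ((T ^+ 2 + (qa (al x))%:C) * F x) + B j x * F12 x).
Proof.
move=> Ux.
have h := cderD (cderMl T (dX0x j Ux)) (dX1x j Ux).
apply: cder_eq (cderM (cderM (dE j Ux) h) (dZ0x j Ux)) _.
by rewrite /F /F12 T2; ring.
Qed.

Let dF2 j x : U x -> cder x (delta_mx 0 j) F2
  (A j x * F12 x + B j x * ((- T ^+ 2 + (qb (be x))%:C) * F x)).
Proof.
move=> Ux.
have h := cderD (cderMl (T * ii) (dZ0x j Ux)) (dZ1x j Ux).
apply: cder_eq (cderM (cderM (dE j Ux) (dX0x j Ux)) h) _.
rewrite /F /F12 T2.
have -> : - T ^+ 2 = T ^+ 2 * (ii * ii) by rewrite i2; ring.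
ring.
Qed.

Let Hc i x : R[i] := (H i x)%:C.
Definition wave i (x : V) : R[i] := E x * X0 (al x) * Z0 (be x) * (H i x)%:C.

Let dH i j x : U x -> cder x (delta_mx 0 j) (Hc i) (pd j (H i) x)%:C.
Proof. by move=> Ux; apply: cder_real; exact: (Ck_is_derive (H_smooth i) j Ux). Qed.

Let dwave i j x : U x -> cder x (delta_mx 0 j) (wave i)
  ((A j x * F1 x + B j x * F2 x) * Hc i x + F x * (pd j (H i) x)%:C).
Proof. by move=> Ux; exact: cderM (dF j Ux) (dH i j Ux). Qed.

Let ddwave i j x : U x -> cpartial j (cpartial j (wave i)) x =
  F1 x * ((pd j (pd j al) x)%:C * Hc i x + 2 * A j x * (pd j (H i) x)%:C)
  + F2 x * ((pd j (pd j be) x)%:C * Hc i x + 2 * B j x * (pd j (H i) x)%:C)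
  + 2 * F12 x * Hc i x * (A j x * B j x)
  + F x * (A j x ^+ 2 * (T ^+ 2 + (qa (al x))%:C) * Hc i x
   + B j x ^+ 2 * (- T ^+ 2 + (qb (be x))%:C) * Hc i x + (pd j (pd j (H i)) x)%:C).
Proof.
move=> Ux; rewrite (cpartial_eq_open j oU Ux (fun y Uy => cpartial_val (dwave i j Uy))).
apply: cpartial_val.
have dA : cder x (delta_mx 0 j) (A j) (pd j (pd j al) x)%:C.
  by apply: cder_real; exact: (Ck_is_derive (Ck_partial j al_smooth) j Ux).
have dB : cder x (delta_mx 0 j) (B j) (pd j (pd j be) x)%:C.
  by apply: cder_real; exact: (Ck_is_derive (Ck_partial j be_smooth) j Ux).
have ddH : cder x (delta_mx 0 j) (fun y => (pd j (H i) y)%:C) (pd j (pd j (H i)) x)%:C.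
  by apply: cder_real; exact: (Ck_is_derive (Ck_partial j (H_smooth i)) j Ux).
have h := cderD (cderM (cderD (cderM dA (dF1 j Ux)) (cderM dB (dF2 j Ux))) (dH i j Ux))
  (cderM (dF j Ux) ddH).
apply: cder_eq h _.
exact: wave_second_derivative.
Qed.

(** After summation over j the terms in [F1], [F2] and [F12] vanish, and T^2 cancels against - T^2
    because both gradients have the same length; [lap_H] disposes of the rest. *)
Lemma lap_wave i x : U x -> lap (wave i) x = - k2%:C * wave i x.
Proof.
move=> Ux; rewrite /lap; under eq_bigr => j _ do rewrite ddwave //.
rewrite !big_split /= -!mulr_sumr.
have r1 : \sum_j ((pd j (pd j al) x)%:C * Hc i x + 2 * A j x * (pd j (H i) x)%:C) = 0.
  rewrite -[RHS](rmorph0 (real_complex R)) -(trans_al i Ux) addrC.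
  rewrite rmorphD !rmorphM !rmorph_sum rmorph_nat /= big_split /= mulr_sumr mulr_sumr.
  congr (_ + _); apply: eq_bigr => j _; first by rewrite mulrC.
  by rewrite rmorphM mulrA.
have r2 : \sum_j ((pd j (pd j be) x)%:C * Hc i x + 2 * B j x * (pd j (H i) x)%:C) = 0.
  rewrite -[RHS](rmorph0 (real_complex R)) -(trans_be i Ux) addrC.
  rewrite rmorphD !rmorphM !rmorph_sum rmorph_nat /= big_split /= mulr_sumr mulr_sumr.
  congr (_ + _); apply: eq_bigr => j _; first by rewrite mulrC.
  by rewrite rmorphM mulrA.
have r3 : \sum_j A j x * B j x = 0.
  rewrite -[RHS](rmorph0 (real_complex R)) -(eik_ort Ux) rmorph_sum.
  by apply: eq_bigr => j _; rewrite rmorphM.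
have r4 : \sum_j A j x ^+ 2 = (m x)%:C.
  by rewrite -(eik_al Ux) rmorph_sum; apply: eq_bigr => j _; rewrite rmorphXn.
have r5 : \sum_j B j x ^+ 2 = (m x)%:C.
  by rewrite -(eik_be Ux) rmorph_sum; apply: eq_bigr => j _; rewrite rmorphXn.
have r6 : \sum_j (pd j (pd j (H i)) x)%:C
   = - ((m x)%:C * ((qa (al x))%:C + (qb (be x))%:C) * Hc i x) - k2%:C * Hc i x.
  rewrite -rmorph_sum /= /Hc -!(rmorphM, rmorphD, rmorphN) /=; congr _%:C.
  by have := lap_H i Ux; lra.
rewrite r1 r2 r3 !mulr0 !add0r !big_split /= -!mulr_suml r4 r5 r6.
rewrite /wave -/(Hc i x) -/(F x); generalize (F x) (Hc i x) (m x)%:C.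
by move=> f h mm; ring.
Qed.

Lemma div_wave x : U x -> \sum_i cpartial i (wave i) x = 0.
Proof.
move=> Ux.
have e i : cpartial i (wave i) x = F1 x * (A i x * Hc i x) + F2 x * (B i x * Hc i x)
    + F x * (pd i (H i) x)%:C.
  rewrite (cpartial_val (dwave i i Ux)) mulrDl.
  by rewrite (mulrC (A i x)) (mulrC (B i x)) -!mulrA.
have r1 : \sum_i A i x * Hc i x = 0.
  rewrite -[RHS](rmorph0 (real_complex R)) -(al_H Ux) rmorph_sum.
  by apply: eq_bigr => j _; rewrite rmorphM.
have r2 : \sum_i B i x * Hc i x = 0.
  rewrite -[RHS](rmorph0 (real_complex R)) -(be_H Ux) rmorph_sum.
  by apply: eq_bigr => j _; rewrite rmorphM.
have r3 : \sum_i (pd i (H i) x)%:C = 0 by rewrite -rmorph_sum /= div_H.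
under eq_bigr => i _ do rewrite e.
by rewrite !big_split /= -!mulr_sumr r1 r2 r3 !mulr0 !addr0.
Qed.

End Wave.

(** * The remainder estimates *)

Section Norms.
Context {R : realType}.
Local Notation V := 'rV[R]_3.

Lemma frobenius_le p q (A : 'M[R[i]]_(p, q)) (b : R) : 0 <= b ->
  (forall i j, `|complex.Re (A i j)| <= b /\ `|complex.Im (A i j)| <= b) ->
  frobenius A <= Num.sqrt (p * q * 2)%:R * b.
Proof.
move=> b0 Ab; rewrite /frobenius.
have -> : Num.sqrt (p * q * 2)%:R * b = Num.sqrt ((p * q * 2)%:R * b ^+ 2).
  by rewrite (sqrtrM _ (ler0n _ _)) sqrtr_sqr ger0_norm.
apply: ler_wsqrtr.
apply: le_trans (_ : \sum_(i < p) \sum_(j < q) 2 * b ^+ 2 <= _).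
  apply: ler_sum => i _; apply: ler_sum => j _; have [h1 h2] := Ab i j.
  rewrite -(real_normK (num_real (complex.Re (A i j)))).
  rewrite -(real_normK (num_real (complex.Im (A i j)))).
  rewrite mulr_natl mulr2n; apply: lerD; rewrite !expr2; exact: ler_pM.
have -> : \sum_(i < p) \sum_(j < q) 2 * b ^+ 2 = p%:R * (q%:R * (2 * b ^+ 2)).
  by rewrite !sumr_const !card_ord !mulr_natl.
have -> : (p * q * 2)%:R * b ^+ 2 = p%:R * (q%:R * (2 * b ^+ 2)) by rewrite !natrM !mulrA.
by [].
Qed.

Definition decay3 (tau : R) : R := tau^-1 ^+ 3.

Variables (U : set V) (p : nat) (F : R -> V -> 'cV[R[i]]_p) (M B : R).
Hypothesis M0 : 0 <= M.
Hypothesis B0 : 0 <= B.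
Hypothesis UB : forall x, U x -> forall i, `|x 0 i| <= B.
Hypothesis FM : forall i, cBd_with U 3 M decay3 (fun tau x => F tau x i 0).

Let decay_pow (tau : R) k : 1 <= tau -> tau ^+ k * decay3 tau = tau ^ (k%:Z - 3).
Proof.
move=> t1; have t0 : tau != 0 by rewrite lt0r_neq0 // (lt_le_trans _ t1).
by rewrite /decay3 expfzDr // exprVn.
Qed.

Let cBd_with_bound k w G tau x : cBd_with U k M w G -> 1 <= tau -> U x ->
  `|complex.Re (G tau x)| <= M * w tau /\ `|complex.Im (G tau x)| <= M * w tau.
Proof. by move=> [h1 h2] t1 Ux; split; [case: (Bd0 h1 t1 Ux)|case: (Bd0 h2 t1 Ux)]. Qed.

Let cBd_with_le k w G : nneg_weight w -> cBd_with U k.+1 M w G -> cBd_with U k M w G.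
Proof.
by move=> w0 [h1 h2]; split; [apply: Bd_le h1 _|apply: Bd_le h2 _] => tau t1;
  rewrite mulr_ge0 ?w0.
Qed.

Let decay_ge0 : nneg_weight decay3.
Proof. by move=> tau t1; rewrite exprn_ge0 // invr_ge0 (le_trans _ t1). Qed.

Let FMk k i : (k <= 3)%N -> cBd_with U k M decay3 (fun tau x => F tau x i 0).
Proof.
(* Induction on the number of derivatives given up, counted down from 3. *)
move=> k3; rewrite -(subKn k3); elim: (3 - k)%N => [|m IH]; first by rewrite subn0.
have [m3|m3] := leqP 3 m; first by move: IH; rewrite !(eqP m3) // (eqP (leqW m3)).
by rewrite subnS; apply: cBd_with_le => //; rewrite prednK // subn_gt0.
Qed.

Lemma remainder_L2 (al : 'I_3 -> nat) tau : (mi_order al <= 2)%N -> 1 <= tau ->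
  (L2norm U (mderiv al (F tau)) <=
   (Num.sqrt (p * 1 * 2)%:R * M * Num.sqrt ((2 * B) ^+ 3)
     * tau ^ ((mi_order al)%:Z - 3))%:E)%E.
Proof.
move=> al2 t1; rewrite -decay_pow //.
have b0 : 0 <= M * (tau ^+ mi_order al * decay3 tau).
  by rewrite mulr_ge0 // mulr_ge0 ?decay_ge0 // exprn_ge0 // (le_trans _ t1).
have -> : Num.sqrt (p * 1 * 2)%:R * M * Num.sqrt ((2 * B) ^+ 3)
    * (tau ^+ mi_order al * decay3 tau) =
  Num.sqrt (p * 1 * 2)%:R * (M * (tau ^+ mi_order al * decay3 tau))
    * Num.sqrt ((2 * B) ^+ 3) by ring.
apply: L2norm_le => //; first by rewrite mulr_ge0 // sqrtr_ge0.
move=> x Ux; apply: frobenius_le => // i j; rewrite mxE (ord1 j).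
have h : cBd_with U (mi_order al + 0) M decay3 (fun tau y => F tau y i 0).
  by rewrite addn0; apply: FMk; exact: leq_trans al2 _.
exact: cBd_with_bound (cBd_with_cderiv h) t1 Ux.
Qed.

(** The Jacobian and at most two further derivatives cost at most tau^3, which the decay tau^(-3)
    just compensates. *)
Lemma remainder_H (U0 : set V) tau : U0 `<=` U -> 1 <= tau ->
  (Hnorm 2 U0 (jacobian_mx (F tau)) <=
   (Num.sqrt (#|{: {ffun 'I_3 -> 'I_3}}|%:R *
     (Num.sqrt (p * 3 * 2)%:R * M * Num.sqrt ((2 * B) ^+ 3)) ^+ 2))%:E)%E.
Proof.
move=> U0U t1; set c := _ * _ * _.
have c0 : 0 <= c by rewrite !mulr_ge0 // sqrtr_ge0.
have L (al : {ffun 'I_3 -> 'I_3}) : (mi_order (fun i => al i) <= 2)%N ->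
    (L2norm U0 (mderiv (fun i => al i) (jacobian_mx (F tau))) <= c%:E)%E.
  move=> al2; apply: L2norm_le => //; first by rewrite mulr_ge0 // sqrtr_ge0.
    by move=> x /U0U; exact: UB.
  move=> x /U0U Ux; apply: frobenius_le => // i j; rewrite mxE.
  have b := cBd_with_cpartial j (FM i).
  have b2 : cBd_with U (mi_order (fun i => al i) + 0) M (fun tau => tau * decay3 tau)
      (fun tau => cpartial j (fun y => F tau y i 0)).
    rewrite addn0; move: al2; case: (mi_order _) => [|[|[|//]]] _ //.
      do 2! (apply: cBd_with_le; first by move=> s s1; rewrite mulr_ge0 ?decay_ge0 // (le_trans _ s1)).
      exact: b.
    apply: cBd_with_le; first by move=> s s1; rewrite mulr_ge0 ?decay_ge0 // (le_trans _ s1).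
    exact: b.
  have [b3 b4] := cBd_with_bound (cBd_with_cderiv b2) t1 Ux.
  have le1 : M * (tau ^+ mi_order (fun i => al i) * (tau * decay3 tau)) <= M.
    rewrite -[leRHS]mulr1; apply: ler_wpM2l => //.
    rewrite mulrA -exprSr decay_pow //.
    have -> : 1 = tau ^ 0 by [].
    apply: ler_weXz2l => //.
    by rewrite lerBlDr add0r lez_nat.
  have jE : (fun y => jacobian_mx (F tau) y i j) = cpartial j (fun y => F tau y i 0).
    by apply/funext => y; rewrite mxE.
  by rewrite jE; split; apply: le_trans le1.
rewrite /Hnorm.
have -> : (Num.sqrt ((#|{: {ffun 'I_3 -> 'I_3}}|)%:R * c ^+ 2))%:E =
    (((#|{: {ffun 'I_3 -> 'I_3}}|)%:R * c ^+ 2)%:E `^ 2^-1)%E.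
  by rewrite poweR_EFin powR12_sqrt // mulr_ge0 // sqr_ge0.
have I0 (y : \bar R) : (0 <= y)%E -> y \in `[0%E, +oo%E].
  by move=> y0; rewrite in_itv /= y0 leey.
apply: gt0_ler_poweR => //.
- by apply/I0/sume_ge0 => al _; rewrite expe2; apply: mule_ge0; exact: Lnorm_ge0.
- by apply: I0; rewrite lee_fin mulr_ge0 // sqr_ge0.
(* The sum is extended to all exponents in {0, 1, 2}^3, the additional terms being 0 and hence at
   most c^2; this explains the cardinal in the bound. *)
rewrite big_mkcond /=.
apply: le_trans (_ : (\sum_(al : {ffun 'I_3 -> 'I_3}) (c ^+ 2)%:E <= _)%E).
  apply: lee_sum => al _; case: ifPn => [al2|_]; last by rewrite lee_fin sqr_ge0.
  have l0 : (0 <= L2norm U0 (mderiv (fun i => al i) (jacobian_mx (F tau))))%E.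
    exact: Lnorm_ge0.
  by rewrite expr2 EFinM; apply: lee_pmul => //; exact: L.
by rewrite sumEFin sumr_const mulr_natl.
Qed.

End Norms.

(** * Smoothness of compositions with cosine, sine and exponential *)

Section Smooth.
Context {R : realType} {n : nat}.
Local Notation V := 'rV[R]_n.
Variable U : set V.
Hypothesis oU : open U.

(** The m-th derivative of cos is cos shifted by m pi / 2: one formula for all orders, as [Ck_comp]
    requires. *)
Lemma is_derive_cos_shift (t : R) m :
  is_derive t 1 (fun s => cos (s + m%:R * (pi / 2))) (cos (t + m.+1%:R * (pi / 2))).
Proof.
have h : is_derive t (1 : R) (id + cst (m%:R * (pi / 2))) (1 + 0).
  exact: is_deriveD.
have := @is_derive1_comp R cos (id + cst (m%:R * (pi / 2))) t _ _ (is_derive_cos _) h.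
rewrite addr0 mulr1; congr (is_derive _ _ _ _).
by rewrite !fctE -cosDpihalf -natr1; congr cos; ring.
Qed.

Lemma Ck_cos k (p : V -> R) : Ck k U p -> Ck k U (fun x => cos (p x)).
Proof.
move=> cp; have := @Ck_comp _ _ k U (fun m s => cos (s + m%:R * (pi / 2))) setT p oU
  (fun m t _ => is_derive_cos_shift t m) (fun _ _ => I) cp 0%N.
by apply: Ck_eq => // x _; rewrite mul0r addr0.
Qed.

Lemma Ck_sin k (p : V -> R) : Ck k U p -> Ck k U (fun x => sin (p x)).
Proof.
move=> cp; have := Ck_cos (CkD oU cp (Ck_cst k (- (pi / 2)) oU)).
by apply: Ck_eq => // x _; exact: cosBpihalf.
Qed.

Lemma Ck_exp k (p : V -> R) : Ck k U p -> Ck k U (fun x => expR (p x)).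
Proof.
move=> cp; exact: (@Ck_comp _ _ k U (fun _ => expR) setT p oU
  (fun m t _ => is_derive_expR t) (fun _ _ => I) cp 0%N).
Qed.

Lemma cCk_cexp k (p q : V -> R) : Ck k U p -> Ck k U q ->
  cCk k U (fun x => cexp (p x +i* q x)).
Proof.
move=> cp cq; apply: cCkM => //; first by apply: cCk_real => //=; exact: Ck_exp.
by split; [exact: Ck_cos|exact: Ck_sin].
Qed.

End Smooth.

(** The end points are the extreme values of p on K. They lie in the interval I, hence so does the
    segment between them, on which the differential equation will be solved. *)
Lemma exists_segment {R : realType} {n : nat} (K W : set 'rV[R]_n) (p : 'rV[R]_n -> R)
    (I : set R) :
  K !=set0 -> compact K -> K `<=` W -> Ck 0 W p -> is_interval I ->
  (forall x, W x -> I (p x)) ->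
  exists a b, [/\ a <= b, forall x, K x -> a <= p x <= b &
    forall t, a <= t <= b -> I t].
Proof.
move=> K0 cK KW cp iI pI.
have cpK : {within K, continuous p}.
  by apply/continuous_in_subspaceT => x; rewrite inE => /KW Wx; exact: (Ck_continuous cp Wx).
have [c + hc] := compact_EVT_max K0 cK cpK; rewrite inE => Kc.
have [d + hd] := compact_EVT_min K0 cK cpK; rewrite inE => Kd.
exists (p d), (p c); split.
- by apply: hc; rewrite inE.
- by move=> x Kx; rewrite hc ?hd // inE.
move=> t tdc; apply: (iI (p d) (p c)) => //; exact/pI/KW.
Qed.

Lemma compact_closure_bounded {R : realType} {n : nat} (U : set 'rV[R]_n) :
  bounded_set U -> compact (closure U) /\
  exists2 B, 0 <= B & forall x, U x -> forall i, `|x 0 i| <= B.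
Proof.
move=> [M [Mr hM]]; have hU x : U x -> `|x| <= `|M| + 1.
  by move=> Ux; apply: hM => //; rewrite ltr_pwDr // ler_norm.
have cl : closure U `<=` [set x | `|x| <= `|M| + 1].
  move=> x; rewrite closureE => /(_ (closed_ball_ Num.norm 0 (`|M| + 1))) /=.
  rewrite /closed_ball_ /= sub0r normrN; apply; split.
    exact: (@closed_closed_ball_ _ _ 0).
  by move=> y /hU; rewrite /= sub0r normrN.
split.
  apply: bounded_closed_compact; last exact: closed_closure.
  exists (`|M| + 1); split; first exact: num_real.
  by move=> r rM x /cl /= xM; apply: le_trans xM (ltW rM).
exists (`|M| + 1); first by rewrite addr_ge0.
move=> x /hU hx i; apply: le_trans hx.
have /mapP[j Hj ->] : `|x 0 i| \in [seq `|x y.1 y.2| | y : 'I_1 * 'I_n].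
  by apply/mapP; exists (0, i) => //=; rewrite mem_enum.
by rewrite [leRHS]/Num.norm /= mx_normrE; apply/bigmax_geP; right => /=; exists j.
Qed.

Lemma cder_sum {R : realType} {V : normedModType R} (x v : V) (I : Type)
    (r : seq I) (f : I -> V -> R[i]) (d : I -> R[i]) :
  (forall i, cder x v (f i) (d i)) ->
  cder x v (fun y => \sum_(i <- r) f i y) (\sum_(i <- r) d i).
Proof.
move=> df; elim: r => [|i r IH].
  have -> : (fun y => \sum_(i <- [::]) f i y) = (fun=> 0).
    by apply/funext => y; rewrite big_nil.
  by rewrite big_nil; exact: cder_cst.
have -> : (fun y => \sum_(j <- i :: r) f j y) = (fun y => f i y + \sum_(j <- r) f j y).
  by apply/funext => y; rewrite big_cons.
by rewrite big_cons; exact: cderD.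
Qed.

(** * Gradient, divergence, curl and Laplacian *)

Section VectorCalculus.
Context {R : realType}.
Local Notation V := 'rV[R]_3.
Variable U : set V.
Hypothesis oU : open U.
Implicit Types (w : V -> 'cV[R[i]]_3) (f : V -> R[i]).

Lemma cpartial0 j (x : V) : cpartial j (fun=> 0 : R[i]) x = 0.
Proof. exact: cpartial_val (cder_cst _ _ _). Qed.

Lemma cpartialZ k c f j x : cCk k.+1 U f -> U x ->
  cpartial j (fun y => c * f y) x = c * cpartial j f x.
Proof. by move=> cf Ux; apply: cpartial_val; apply: cderMl; exact: cCk_cder cf Ux. Qed.

Lemma lapZ c f x : cCk 2 U f -> U x -> lap (fun y => c * f y) x = c * lap f x.
Proof.
move=> cf Ux; rewrite /lap mulr_sumr; apply: eq_bigr => j _.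
rewrite (cpartial_eq_open j oU Ux (fun y Uy => cpartialZ c j cf Uy)).
exact: cpartialZ (cCk_cpartial j cf) Ux.
Qed.

Lemma grad_eq_open f g x : U x -> (forall y, U y -> f y = g y) -> grad f x = grad g x.
Proof.
by move=> Ux fg; apply/colP => j; rewrite !mxE; exact: (cpartial_eq_open j oU Ux fg).
Qed.

Lemma grad0 (x : V) : grad (fun=> 0 : R[i]) x = 0.
Proof. by apply/colP => j; rewrite !mxE cpartial0. Qed.

Lemma curl_curl w x : U x -> (forall i, cCk 2 U (fun y => w y i 0)) ->
  curl (curl w) x = grad (divergence w) x - vlap w x.
Proof.
move=> Ux cw; pose W i y := w y i 0.
have dW i j y : U y -> cder y (delta_mx 0 j) (W i) (cpartial j (W i) y).
  by move=> Uy; exact: cCk_cder (cw i) Uy.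
have ddW i j k : cder x (delta_mx 0 k) (cpartial j (W i)) (cpartial k (cpartial j (W i)) x).
  by apply: cCk_cder Ux; exact: cCk_cpartial (cw i).
have C i j k : cpartial j (cpartial k (W i)) x = cpartial k (cpartial j (W i)) x.
  exact: cpartialC oU Ux (cw i).
have gd i : cpartial i (divergence w) x = \sum_k cpartial i (cpartial k (W k)) x.
  by apply: cpartial_val; apply: cder_sum => k; exact: ddW.
have cc i j : cpartial j (fun y => curl w y i 0) x
   = cpartial j (cpartial (i + 1) (W (i + 2))) x
   - cpartial j (cpartial (i + 2) (W (i + 1))) x.
  have -> : (fun y => curl w y i 0) = (fun y => cpartial (i + 1) (W (i + 2)) y
      + (-1) * cpartial (i + 2) (W (i + 1)) y).
    by apply/funext => y; rewrite mxE mulN1r.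
  apply: cpartial_val.
  apply: cder_eq (cderD (ddW _ _ _) (cderMl (-1) (ddW _ _ _))) _.
  by rewrite mulN1r.
(* Starting the sum at i matches the cyclic indices of [curl], so that the three components need no
   separate treatment. *)
have sum3 (F : 'I_3 -> R[i]) i : \sum_k F k = F i + F (i + 1) + F (i + 2).
  have r1 (p q r : R[i]) : p + q + r = q + r + p by ring.
  have r2 (p q r : R[i]) : p + q + r = r + p + q by ring.
  rewrite !big_ord_recr big_ord0 /= add0r.
  have fE k k' : val k = val k' -> F k = F k' by move=> /val_inj ->.
  case: i => [[|[|[|//]]]] hi; [|rewrite [LHS]r1|rewrite [LHS]r2].
  - by rewrite (fE (Ordinal hi + 1) (widen_ord (leqnSn 2) ord_max)) // (fE (Ordinal hi + 2) ord_max) //; congr (_ + _ + _); apply: fE.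
  - by congr (_ + _ + _); apply: fE.
  by congr (_ + _ + _); apply: fE.
apply/colP => i.
have -> : curl (curl w) x i 0 = cpartial (i + 1) (fun y => curl w y (i + 2) 0) x
    - cpartial (i + 2) (fun y => curl w y (i + 1) 0) x by rewrite mxE.
have -> : (grad (divergence w) x - vlap w x) i 0
    = cpartial i (divergence w) x - lap (W i) x by rewrite !mxE.
have e1 (k : 'I_3) : k + 2 + 1 = k by apply/val_inj; case: k => [[|[|[|//]]]].
have e2 (k : 'I_3) : k + 2 + 2 = k + 1 by apply/val_inj; case: k => [[|[|[|//]]]].
have e3 (k : 'I_3) : k + 1 + 1 = k + 2 by apply/val_inj; case: k => [[|[|[|//]]]].
have e4 (k : 'I_3) : k + 1 + 2 = k by apply/val_inj; case: k => [[|[|[|//]]]].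
have alg (z p q r s : R[i]) : p - q - (r - s) = z + p + s - (z + q + r) by ring.
have S1 := etrans (gd i) (sum3 (fun k => cpartial i (cpartial k (W k)) x) i).
have S2 : lap (W i) x = _ := sum3 (fun k => cpartial k (cpartial k (W i)) x) i.
have c1 := cc (i + 2) (i + 1); have c2 := cc (i + 1) (i + 2).
rewrite e1 e2 in c1; rewrite e3 e4 in c2.
rewrite S1 S2 c1 c2 (C (i + 1) i (i + 1)) (C (i + 2) i (i + 2)).
exact: alg.
Qed.

End VectorCalculus.

(** * Elastic fields from divergence-free solutions of the Helmholtz equation *)

Section DivergenceFree.
Context {R : realType}.
Local Notation V := 'rV[R]_3.
Variables (lambda0 mu0 kappa : R) (U : set V) (w : V -> 'cV[R[i]]_3).
Hypothesis mu0_gt0 : 0 < mu0.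
Hypothesis oU : open U.
Hypothesis cw : forall i, cCk 2 U (fun y => w y i 0).
Hypothesis helm : forall x, U x -> forall i,
  lap (fun y => w y i 0) x = - (kappa ^+ 2 / mu0)%:C * w x i 0.
Hypothesis div0 : forall x, U x -> divergence w x = 0.

Let g0 : V -> R[i] := fun=> 0.
Let s : R[i] := ((Num.sqrt mu0)^-1)%:C.
Let u := displacement mu0 w g0.

Let uE i : (fun y => u y i 0) = (fun y => s * w y i 0).
Proof. by apply/funext => y; rewrite /u /displacement grad0 scaler0 addr0 mxE. Qed.

Let div_u x : U x -> divergence u x = 0.
Proof.
move=> Ux; rewrite /divergence; under eq_bigr => j _ do
  rewrite uE (cpartialZ s j (cw j) Ux).
by rewrite -mulr_sumr; have := div0 Ux; rewrite /divergence => ->; rewrite mulr0.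
Qed.

Let grad_div_u x : U x -> grad (divergence u) x = 0.
Proof. by move=> Ux; rewrite (grad_eq_open oU Ux div_u) grad0. Qed.

Let grad_div_w x : U x -> grad (divergence w) x = 0.
Proof. by move=> Ux; rewrite (grad_eq_open oU Ux div0) grad0. Qed.

Let vlap_w x : U x -> vlap w x = - (kappa ^+ 2 / mu0)%:C *: w x.
Proof. by move=> Ux; apply/colP => i; rewrite mxE helm // !mxE. Qed.

Let vlap_u x : U x -> vlap u x = s *: vlap w x.
Proof. by move=> Ux; apply/colP => i; rewrite !mxE uE (lapZ oU s (cw i) Ux). Qed.

Let lap_g0 : lap g0 = fun=> 0.
Proof.
apply/funext => x; rewrite /lap; apply: big1 => j _.
have -> : cpartial j g0 = fun=> 0 by apply/funext => y; exact: cpartial0.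
exact: cpartial0.
Qed.

Lemma divergence_free_system_S : system_S lambda0 mu0 kappa U w g0.
Proof.
move=> x Ux; rewrite (vlap_w Ux) lap_g0 (div0 Ux) !mulr0 !addr0.
by rewrite -scalerDl addNr scale0r.
Qed.

Lemma divergence_free_navier : navier lambda0 mu0 kappa U u.
Proof.
move=> x Ux; rewrite (grad_div_u Ux) scaler0 addr0 (vlap_u Ux) (vlap_w Ux).
have -> : u x = s *: w x by apply/colP => i; rewrite [RHS]mxE; exact: (congr1 (@^~ x) (uE i)).
have kE : (kappa ^+ 2)%:C = mu0%:C * (kappa ^+ 2 / mu0)%:C :> R[i].
  by rewrite -rmorphM /= mulrC divfK // lt0r_neq0.
rewrite kE !scalerA -scalerDl (_ : _ + _ = 0) ?scale0r //.
ring.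
Qed.

(** Both sides of the first formula vanish, since u and w are divergence-free and g = 0; the second
    is [curl_curl] for u, a constant multiple of w. *)
Lemma divergence_free_parts x : U x ->
  elastic_p_part lambda0 mu0 kappa u x = - (kappa_p lambda0 mu0 kappa ^- 2)%:C *:
     (((Num.sqrt mu0)^-1)%:C *: grad (divergence w) x
      + (mu0^-1)%:C *: grad (lap g0) x) /\
  elastic_s_part mu0 kappa u x = (kappa_s mu0 kappa ^- 2 * (Num.sqrt mu0)^-1)%:C *:
     (grad (divergence w) x - vlap w x).
Proof.
move=> Ux; rewrite /elastic_p_part /elastic_s_part.
have gu := grad_div_u Ux; have gw := grad_div_w Ux.
have cu : curl (curl u) x = grad (divergence u) x - vlap u x.
  by apply: (curl_curl oU Ux) => i; rewrite uE; exact: cCkM (cCk_cst oU 2 s) (cw i).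
rewrite cu gu gw (vlap_u Ux) lap_g0 grad0.
split; first by rewrite !scaler0 addr0 scaler0.
by rewrite !sub0r !scalerN scalerA rmorphM.
Qed.

End DivergenceFree.

(** * From a pair of phase functions to the solutions *)

Section CGO.
Context {R : realType}.
Local Notation V := 'rV[R]_3.
Local Notation ii := (0 +i* 1 : R[i]).
Variables (lambda0 mu0 kappa : R) (Omega W : set V).
Variables (al be : V -> R) (H : 'I_3 -> V -> R) (m : V -> R) (ct : R -> R).
Variables (Da Db : nat -> R -> R) (Ia Ib : set R) (phi : R -> R -> V -> R[i]).
Hypothesis phiE : forall tau t x, phi tau t x = (tau * (al x + ct t)) +i* (tau * be x).
Hypothesis mu0_gt0 : 0 < mu0.
Hypotheses (Omega0 : Omega !=set0) (oO : open Omega) (bO : bounded_set Omega).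
Hypotheses (oW : open W) (OW : closure Omega `<=` W).
Hypotheses (al_smooth : forall k, Ck k W al) (be_smooth : forall k, Ck k W be).
Hypothesis H_smooth : forall k i, Ck k W (H i).
Hypotheses (Ia_itv : is_interval Ia) (Ib_itv : is_interval Ib).
Hypotheses (al_I : forall x, W x -> Ia (al x)) (be_I : forall x, W x -> Ib (be x)).
Hypothesis dDa : forall n t, Ia t -> is_derive t 1 (Da n) (Da n.+1 t).
Hypothesis dDb : forall n t, Ib t -> is_derive t 1 (Db n) (Db n.+1 t).
Hypothesis eik_al : forall x, W x -> \sum_j partial j al x ^+ 2 = m x.
Hypothesis eik_be : forall x, W x -> \sum_j partial j be x ^+ 2 = m x.
Hypothesis eik_ort : forall x, W x -> \sum_j partial j al x * partial j be x = 0.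
Hypothesis trans_al : forall x i, W x ->
  2 * (\sum_j partial j al x * partial j (H i) x)
  + H i x * \sum_j partial j (partial j al) x = 0.
Hypothesis trans_be : forall x i, W x ->
  2 * (\sum_j partial j be x * partial j (H i) x)
  + H i x * \sum_j partial j (partial j be) x = 0.
Hypothesis lap_H : forall x i, W x ->
  \sum_j partial j (partial j (H i)) x + kappa ^+ 2 / mu0 * H i x
  = - (m x * (Da 1 (al x) + Db 1 (be x)) * H i x).
Hypothesis al_H : forall x, W x -> \sum_i partial i al x * H i x = 0.
Hypothesis be_H : forall x, W x -> \sum_i partial i be x * H i x = 0.
Hypothesis div_H : forall x, W x -> \sum_i partial i (H i) x = 0.
Hypothesis H_neq0 : forall x, closure Omega x -> exists i, H i x != 0.

Let OW' x : Omega x -> W x.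
Proof. by move=> Ox; exact/OW/subset_closure. Qed.

Let Ck_sub k (f : V -> R) : Ck k W f -> Ck k Omega f.
Proof.
elim: k f => [|k IH] f [cf df]; split => //; do ?by move=> x /OW'; exact: cf.
by move=> j; have [h1 h2] := df j; split; [move=> x /OW'; exact: h1|exact: IH].
Qed.

(** The values of sigma in the equations for X and Z: one damps, the other oscillates. *)
Let sa : R[i] := (- 2)%:C.
Let sb : R[i] := 0 +i* (- 2).
Let ca : R[i] := sa^-1.
Let cb : R[i] := sb^-1.
Let X1 x := wkb1 ca (Da 0 (al x)).
Let X2 x := wkb2 ca (Da 0 (al x)) (Da 1 (al x)).
Let Z1 x := wkb1 cb (Db 0 (be x)).
Let Z2 x := wkb2 cb (Db 0 (be x)) (Db 1 (be x)).

Let wkb_smooth k (c : R[i]) (D : nat -> R -> R) (I : set R) p : (forall k, Ck k W p) ->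
  (forall n t, I t -> is_derive t 1 (D n) (D n.+1 t)) -> (forall x, W x -> I (p x)) ->
  cCk k W (fun x => wkb1 c (D 0 (p x))) /\
  cCk k W (fun x => wkb2 c (D 0 (p x)) (D 1 (p x))).
Proof.
move=> cp dD pI.
have cD n : Ck k W (fun x => D n (p x)) by exact: Ck_comp oW dD pI (cp k) n.
split; apply: (cCkM oW (cCk_cst oW _ _)); apply: (cCk_real oW).
  exact: cD.
apply: Ck_eq oW _ (CkD oW (CkMl 2^-1 oW (CkM oW (cD 0%N) (cD 0%N))) (CkN oW (cD 1%N))).
by move=> x _; rewrite expr2 mulrC.
Qed.

Let HC i x : R[i] := (H i x)%:C.
Let a0 (x : V) : 'cV[R[i]]_3 := \col_i HC i x.
Let a1 (x : V) : 'cV[R[i]]_3 := \col_i ((X1 x + Z1 x) * HC i x).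
Let a2 (x : V) : 'cV[R[i]]_3 := \col_i ((X2 x + X1 x * Z1 x + Z2 x) * HC i x).

Let X1s k : cCk k W X1. Proof. by case: (@wkb_smooth k ca Da Ia al). Qed.
Let X2s k : cCk k W X2. Proof. by case: (@wkb_smooth k ca Da Ia al). Qed.
Let Z1s k : cCk k W Z1. Proof. by case: (@wkb_smooth k cb Db Ib be). Qed.
Let Z2s k : cCk k W Z2. Proof. by case: (@wkb_smooth k cb Db Ib be). Qed.
Let HCs k i : cCk k W (HC i). Proof. exact: cCk_real. Qed.

Let smooth_col (F : 'I_3 -> V -> R[i]) : (forall k i, cCk k W (F i)) ->
  msmooth_on (closure Omega) (fun x => \col_i F i x).
Proof.
move=> cF i j; exists W, (F i); split; [exact: oW|exact: OW|by move=> k; exact: cF|].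
by move=> x _; rewrite mxE.
Qed.

Let smooth0 : csmooth_on (closure Omega) (fun=> 0).
Proof.
exists W, (fun=> 0); split; [exact: oW|exact: OW| |by []].
by move=> k; exact: (cCk_cst oW).
Qed.

Let Pf (tau : R) x : R[i] := 1 + (tau^-1)%:C * X1 x + (tau^-1)%:C ^+ 2 * X2 x.
Let Qf (tau : R) x : R[i] := 1 + (tau^-1)%:C * Z1 x + (tau^-1)%:C ^+ 2 * Z2 x.
(** What the product of the two expansions leaves beyond order 2: its orders 3 and 4, and every term
    containing a correction. *)
Let rho (e f : R -> V -> R[i]) (tau : R) x : R[i] :=
  (tau^-1 ^+ 3)%:C * (X1 x * Z2 x + X2 x * Z1 x) + (tau^-1 ^+ 4)%:C * (X2 x * Z2 x)
  + (e tau x * Qf tau x + Pf tau x * f tau x + e tau x * f tau x).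

Let amplitude_expansion e f tau x :
  (Pf tau x + e tau x) * (Qf tau x + f tau x) =
  1 + (tau^-1)%:C * (X1 x + Z1 x) + (tau^-1)%:C ^+ 2 * (X2 x + X1 x * Z1 x + Z2 x)
  + rho e f tau x.
Proof.
rewrite /rho /Pf /Qf !rmorphXn /=.
generalize (tau^-1)%:C (X1 x) (X2 x) (Z1 x) (Z2 x) (e tau x) (f tau x).
by move=> u p q r s a b; ring.
Qed.

Let cO : compact (closure Omega). Proof. by case: (compact_closure_bounded bO). Qed.

Let inv_le1 (tau : R) : 1 <= tau -> 0 <= tau^-1 <= 1.
Proof. by move=> t1; rewrite invr_ge0 (le_trans ler01 t1) invf_le1 // (lt_le_trans ltr01). Qed.

Let one_ge0 : nneg_weight (fun=> 1 : R). Proof. by move=> tau _; exact: ler01. Qed.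
Let decay_ge0 : nneg_weight (@decay3 R).
Proof. by move=> tau /inv_le1 /andP[u0 _]; rewrite exprn_ge0. Qed.
Let decay_le1 (tau : R) : 1 <= tau -> decay3 tau <= 1.
Proof. by move=> /inv_le1 /andP[u0 u1]; rewrite exprn_ile1. Qed.

Let fixed_family G : (forall k, cCk k W G) -> cBd Omega 3 (fun=> 1) (fun=> G).
Proof. by move=> cG; exact: (cBd_cst oO oW cO OW (cG 3%N)). Qed.

Let scaled_family (s w : R -> R) G : (forall k, cCk k W G) -> nneg_weight w ->
  (forall tau, 1 <= tau -> `|s tau| <= w tau) ->
  cBd Omega 3 w (fun tau x => (s tau)%:C * G x).
Proof.
move=> cG w0 sw; apply: (cBd_weaken oO _ (cBd_scale oO one_ge0 w0 sw (fixed_family cG))).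
by move=> tau _; rewrite mulr1.
Qed.

Let expansion_family G G' : (forall k, cCk k W G) -> (forall k, cCk k W G') ->
  cBd Omega 3 (fun=> 1)
    (fun tau x => 1 + (tau^-1)%:C * G x + (tau^-1)%:C ^+ 2 * G' x).
Proof.
move=> cG cG'.
have h1 : cBd Omega 3 (fun=> 1) (fun tau x => (tau^-1)%:C * G x).
  apply: scaled_family => // tau /inv_le1 /andP[u0 u1]; by rewrite ger0_norm.
have h2 : cBd Omega 3 (fun=> 1) (fun tau x => (tau^-1 ^+ 2)%:C * G' x).
  apply: scaled_family => // tau /inv_le1 /andP[u0 u1].
  by rewrite ger0_norm ?exprn_ge0 // exprn_ile1.
have h0 : cBd Omega 3 (fun=> 1) (fun _ _ => 1 : R[i]).
  by apply: fixed_family => k; exact: (cCk_cst oW).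
apply: (cBd_eq oO _ (cBdD oO (cBdD oO h0 h1) h2)) => tau _ x _.
by rewrite rmorphXn.
Qed.

Let rho_decay e f : cBd Omega 3 (@decay3 R) e -> cBd Omega 3 (@decay3 R) f ->
  cBd Omega 3 (@decay3 R) (rho e f).
Proof.
move=> he hf.
have cM G G' : (forall k, cCk k W G) -> (forall k, cCk k W G') ->
    forall k, cCk k W (fun x => G x * G' x) by move=> cG cG' k; exact: cCkM.
have h1 : cBd Omega 3 (@decay3 R)
    (fun tau x => (tau^-1 ^+ 3)%:C * (X1 x * Z2 x + X2 x * Z1 x)).
  apply: (scaled_family _ decay_ge0).
    by move=> k; apply: (cCkD oW); exact: cM.
  by move=> tau /decay_ge0 d0; rewrite ger0_norm.
have h2 : cBd Omega 3 (@decay3 R) (fun tau x => (tau^-1 ^+ 4)%:C * (X2 x * Z2 x)).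
  apply: (scaled_family _ decay_ge0); first exact: cM.
  move=> tau /inv_le1 /andP[u0 u1]; rewrite ger0_norm ?exprn_ge0 // exprSr.
  by apply: ler_piMr => //; exact: exprn_ge0.
have hP := expansion_family X1s X2s.
have hQ := expansion_family Z1s Z2s.
have h3 : cBd Omega 3 (@decay3 R) (fun tau x => e tau x * Qf tau x).
  apply: (cBd_weaken oO _ (cBdM oO decay_ge0 one_ge0 he hQ)) => tau _.
  by rewrite mulr1.
have h4 : cBd Omega 3 (@decay3 R) (fun tau x => Pf tau x * f tau x).
  apply: (cBd_weaken oO _ (cBdM oO one_ge0 decay_ge0 hP hf)) => tau _.
  by rewrite mul1r.
have h5 : cBd Omega 3 (@decay3 R) (fun tau x => e tau x * f tau x).
  apply: (cBd_weaken oO _ (cBdM oO decay_ge0 decay_ge0 he hf)) => tau t1.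
  by apply: ler_piMl; [exact: decay_ge0|exact: decay_le1].
exact: (cBdD oO (cBdD oO h1 h2) (cBdD oO (cBdD oO h3 h4) h5)).
Qed.

Theorem has_CGO_of_phase : has_CGO_solutions lambda0 mu0 kappa Omega phi.
Proof.
have [_ [B B0 OB]] := compact_closure_bounded bO.
have cl0 : closure Omega !=set0.
  by have [x Ox] := Omega0; exists x; exact: subset_closure.
have [aa [ba [aba alab abI]]] := exists_segment cl0 cO OW (al_smooth 0) Ia_itv al_I.
have [ab [bb [abb beab bbI]]] := exists_segment cl0 cO OW (be_smooth 0) Ib_itv be_I.
have n2 : (- 2 : R) != 0 by rewrite oppr_eq0 pnatr_eq0.
have sa0 : sa != 0 by apply: contra_neq n2 => /(congr1 (@complex.Re R)).
have sb0 : sb != 0 by apply: contra_neq n2 => /(congr1 (@complex.Im R)).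
have sa1 : complex.Re sa <= 0 by rewrite /sa /= oppr_le0.
have sb1 : complex.Re sb <= 0 by [].
have [Ma [ea [ya [Ma0 ha]]]] := wkb_solution aba (fun n t tab => dDa n (abI t tab)) sa0 sa1.
have [Mb [eb [yb [Mb0 hb]]]] := wkb_solution abb (fun n t tab => dDb n (bbI t tab)) sb0 sb1.
have Oa x : Omega x -> aa <= al x <= ba by move=> /subset_closure; exact: alab.
have Ob x : Omega x -> ab <= be x <= bb by move=> /subset_closure; exact: beab.
have fa : cBd Omega 3 (@decay3 R) (fun tau x => ea tau 0%N (al x)).
  apply: (@cBd_comp _ _ Omega W oO oW cO OW 3 al [set t | aa <= t <= ba] ea _ Ma) => //.
  move=> k tau t k3 t1 tab; have [_ _ h1 h2] := ha tau t1 t tab.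
  by split; [exact: h1|rewrite (mulrC (tau ^+ k)); exact: h2].
have fb : cBd Omega 3 (@decay3 R) (fun tau x => eb tau 0%N (be x)).
  apply: (@cBd_comp _ _ Omega W oO oW cO OW 3 be [set t | ab <= t <= bb] eb _ Mb) => //.
  move=> k tau t k3 t1 tab; have [_ _ h1 h2] := hb tau t1 t tab.
  by split; [exact: h1|rewrite (mulrC (tau ^+ k)); exact: h2].
pose ef tau x := ea tau 0%N (al x); pose ff tau x := eb tau 0%N (be x).
have rd := rho_decay fa fb; rewrite -/ef -/ff in rd.
pose r (tau : R) x : 'cV[R[i]]_3 := \col_i (rho ef ff tau x * HC i x).
pose XS tau := wkb_sum Da sa ea tau; pose ZS tau := wkb_sum Db sb eb tau.
pose wv tau t i := wave al be H tau (ct t) (XS tau) (ZS tau) i.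
pose w tau t x : 'cV[R[i]]_3 := \col_i wv tau t i x.
have wE tau t i : (fun y => w tau t y i 0) = wv tau t i.
  by apply/funext => y; rewrite mxE.
have rE tau i : (fun y => r tau y i 0) = (fun y => rho ef ff tau y * HC i y).
  by apply/funext => y; rewrite mxE.
have rC tau i : 1 <= tau -> cCk 3 Omega (fun y => r tau y i 0).
  move=> t1; rewrite rE; apply: (cCkM oO); first exact: (cBd_Ck t1 rd).
  by apply: (cCk_real oO); exact/Ck_sub.
have wC tau t i : 1 <= tau -> cCk 3 Omega (fun y => w tau t y i 0).
  move=> t1; rewrite wE; apply: (cCkM oO); last first.
    by apply: (cCk_real oO); exact/Ck_sub.
  apply: (cCkM oO).
    apply: (cCkM oO).
      apply: (cCk_cexp oO); apply: (CkMl _ oO); last exact/Ck_sub.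
      by apply: (CkD oO); [exact/Ck_sub|exact: (Ck_cst _ _ oO)].
    exact: (cBd_Ck t1 (cBdD oO (expansion_family X1s X2s) (cBd_weaken oO decay_le1 fa))).
  exact: (cBd_Ck t1 (cBdD oO (expansion_family Z1s Z2s) (cBd_weaken oO decay_le1 fb))).
pose F (tau : R) : V -> 'cV[R[i]]_(3 + 1)%N := remainder (r tau) (fun=> 0).
have FE tau i : (fun y => F tau y i 0) = match fintype.split i with
    | inl k => fun y => rho ef ff tau y * HC k y | inr _ => fun=> 0 end.
  apply/funext => y; rewrite /F /remainder -{1}(splitK i).
  case: (fintype.split i) => k /=; first by rewrite col_mxEu mxE.
  by rewrite col_mxEd mxE mul0rn.
(* A constant for each component; their sum then serves all components of the remainder at once. *)
have /choice[Mi hMi] : forall i, exists Mi, 0 <= Mi /\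
    cBd_with Omega 3 Mi (@decay3 R) (fun tau y => F tau y i 0).
  move=> i.
  have [Mi M0 hMi] : cBd Omega 3 (@decay3 R) (fun tau y => F tau y i 0).
    apply: (cBd_eq oO (F := fun tau => match fintype.split i with
      | inl k => fun y => rho ef ff tau y * HC k y | inr _ => fun=> 0 end)).
      by move=> tau _ x _; have := congr1 (@^~ x) (FE tau i); rewrite /= => ->.
    case: (fintype.split i) => k.
      have hk := fixed_family (fun l => HCs l k).
      apply: (cBd_weaken oO _ (cBdM oO decay_ge0 one_ge0 rd hk)) => tau _.
      by rewrite mulr1.
    have h0 : cBd Omega 3 (@decay3 R) (fun tau x => (0 : R)%:C * (1 : R[i])).
      apply: (@scaled_family (fun=> 0) _ (fun=> 1)) => //.
        by move=> l; exact: (cCk_cst oW).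
      by move=> tau /decay_ge0; rewrite normr0.
    by apply: (cBd_eq oO _ h0) => tau _ x _; rewrite mulr1.
  by exists Mi.
pose M := \sum_i Mi i.
have M0 : 0 <= M by apply: sumr_ge0 => i _; case: (hMi i).
have FM i : cBd_with Omega 3 M (@decay3 R) (fun tau x => F tau x i 0).
  have [_ [h1 h2]] := hMi i.
  have MiM tau : 1 <= tau -> Mi i * decay3 tau <= M * decay3 tau.
    move=> /decay_ge0 d0; apply: ler_wpM2r => //.
    rewrite /M (bigD1 i) //= lerDl; apply: sumr_ge0 => k _.
    by case: (hMi k).
  by split; [apply: (Bd_mono oO MiM _ h1)|apply: (Bd_mono oO MiM _ h2)].
exists a0, a1, a2, (fun=> 0), (fun=> 0), (fun=> 0); split.
- by split; apply: smooth_col => k i //; do ?[apply: (cCkM oW) => //];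
    do ?[apply: (cCkD oW) => //]; do ?[apply: (cCkM oW) => //].
- by split; exact: smooth0.
- move=> x /H_neq0 [i Hi]; apply: contra_neq Hi => /colP /(_ i).
  by rewrite !mxE => /(congr1 (@complex.Re R)).
(* The correction bounds hold from tau = 1 on. The parameter t only shifts the phase by the constant
   [ct t], so r does not depend on it. *)
exists 1, w, (fun tau _ => r tau), (fun _ _ _ => 0), (fun _ _ _ => 0); split.
- exact: ltr01.
- move=> tau t t1 u.
  have dX0 x : Omega x -> cder (al x) 1 (XS tau) (ya tau (al x)).
    by move=> /Oa /(ha tau t1 (al x)) [].
  have dX1 x : Omega x -> cder (al x) 1 (ya tau)
      (- (2 * tau)%:C * ya tau (al x) + (Da 1 (al x))%:C * XS tau (al x)).
    move=> /Oa /(ha tau t1 (al x)) [_ h _ _]; apply: cder_eq h _; congr (_ * _ + _).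
    by rewrite -rmorphM -rmorphN /= mulNr.
  have dZ0 x : Omega x -> cder (be x) 1 (ZS tau) (yb tau (be x)).
    by move=> /Ob /(hb tau t1 (be x)) [].
  have dZ1 x : Omega x -> cder (be x) 1 (yb tau)
      (- (2 * tau)%:C * ii * yb tau (be x) + (Db 1 (be x))%:C * ZS tau (be x)).
    move=> /Ob /(hb tau t1 (be x)) [_ h _ _]; apply: cder_eq h _; congr (_ * _ + _).
    by apply: complex_ext; rewrite !(cReM, cImM, cReN, cImN) /=; ring.
  have helm x i : Omega x -> lap (fun y => w tau t y i 0) x
      = - (kappa ^+ 2 / mu0)%:C * w tau t x i 0.
    move=> Ox; rewrite wE mxE /wv.
    exact: (@lap_wave R Omega al be H m (Da 1) (Db 1) (kappa ^+ 2 / mu0) tau (ct t)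
      (XS tau) (ya tau) (ZS tau) (yb tau) oO (Ck_sub (al_smooth 2))
      (Ck_sub (be_smooth 2)) (fun i => Ck_sub (H_smooth 2 i))
      (fun x Ox => eik_al (OW' Ox)) (fun x Ox => eik_be (OW' Ox))
      (fun x Ox => eik_ort (OW' Ox)) (fun x i Ox => trans_al i (OW' Ox))
      (fun x i Ox => trans_be i (OW' Ox)) (fun x i Ox => lap_H i (OW' Ox))
      dX0 dX1 dZ0 dZ1 i x Ox).
  have div0 x : Omega x -> divergence (w tau t) x = 0.
    move=> Ox; rewrite /divergence; under eq_bigr => i _ do rewrite wE.
    exact: (@div_wave R Omega al be H tau (ct t)
      (XS tau) (ya tau) (ZS tau) (yb tau) (Ck_sub (al_smooth 2))
      (Ck_sub (be_smooth 2)) (fun i => Ck_sub (H_smooth 2 i))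
      (fun x Ox => al_H (OW' Ox)) (fun x Ox => be_H (OW' Ox))
      (fun x Ox => div_H (OW' Ox)) dX0 dZ0 x Ox).
  have cw i : cCk 2 Omega (fun y => w tau t y i 0).
    by have [h1 h2] := wC tau t i t1; split; exact: Ck_le.
  split.
  + split.
    * by move=> i j; rewrite (ord1 j); exact: wC.
    * exact: (cCk_cst oO).
    * by move=> i j; rewrite (ord1 j); exact: rC.
    * exact: (cCk_cst oO).
  + apply: divergence_free_system_S => //; by move=> x Ox i; exact: helm.
  + move=> x Ox; split; last by rewrite !mulr0 !addr0 mulr0.
    have hx : XS tau (al x) * ZS tau (be x) = 1 + (tau^-1)%:C * (X1 x + Z1 x)
        + (tau^-1)%:C ^+ 2 * (X2 x + X1 x * Z1 x + Z2 x) + rho ef ff tau x.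
      exact: amplitude_expansion.
    apply/colP => i; rewrite !mxE phiE /wv /wave -[X in X * _]mulrA hx.
    rewrite -exprVn rmorphXn /= -/(HC i x).
    generalize (cexp (tau * (al x + ct t) +i* (tau * be x))) (tau^-1)%:C (HC i x).
    by move=> E v h; ring.
  + apply: divergence_free_navier => //; by move=> x Ox i; exact: helm.
  + by move=> x Ox; apply: (divergence_free_parts lambda0 mu0 kappa oO cw div0 Ox).
- exists (Num.sqrt (4 * 1 * 2)%:R * M * Num.sqrt ((2 * B) ^+ 3)).
  by move=> alpha a2' tau t t1; exact: (remainder_L2 M0 B0 OB FM a2' t1).
move=> O0 [_ O0O].
have O0s : O0 `<=` Omega by move=> x /subset_closure /O0O.
exists (Num.sqrt (#|{: {ffun 'I_3 -> 'I_3}}|%:R *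
     (Num.sqrt (4 * 3 * 2)%:R * M * Num.sqrt ((2 * B) ^+ 3)) ^+ 2)).
near=> tau => t; apply: (remainder_H M0 B0 OB FM O0s).
by near: tau; apply: nbhs_pinfty_ge; exact: num_real.
Unshelve. all: by end_near.
Qed.

End CGO.

(** * The two phases *)

Section FirstOrder.
Context {R : realType} {n : nat}.
Local Notation V := 'rV[R]_n.
Implicit Types (x v : V) (f g : V -> R) (a b : R).

(** This and the following rules are in pointwise form, so that an explicit formula is
    differentiated by composing proof terms. *)
Lemma is_derive_prod x v f g a b : is_derive x v f a -> is_derive x v g b ->
  is_derive x v (fun y => f y * g y) (f x * b + g x * a).
Proof. by move=> df dg; exact: (is_deriveM df dg). Qed.

Lemma is_derive_plus x v f g a b : is_derive x v f a -> is_derive x v g b ->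
  is_derive x v (fun y => f y + g y) (a + b).
Proof. by move=> df dg; exact: (is_deriveD df dg). Qed.

Lemma is_derive_opp x v f a : is_derive x v f a -> is_derive x v (fun y => - f y) (- a).
Proof. by move=> df; exact: (is_deriveN df). Qed.

Lemma is_derive_scale x v f c a : is_derive x v f a ->
  is_derive x v (fun y => c * f y) (c * a).
Proof. by move=> df; exact: (is_deriveZ c df). Qed.

Lemma is_derive_inv x v f a : f x != 0 -> is_derive x v f a ->
  is_derive x v (fun y => (f y)^-1) (- a / f x ^+ 2).
Proof.
move=> f0 df; have h := @is_deriveV R id (f x) 1 1 f0 (is_derive_id _ _).
apply: is_derive_eq (is_derive_comp_real h df) _.
by rewrite /GRing.scale /= mulr1 mulrC mulrN mulNr.
Qed.

Lemma is_derive_sum_fun x v (I : Type) (r : seq I) (F : I -> V -> R) (d : I -> R) :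
  (forall i, is_derive x v (F i) (d i)) ->
  is_derive x v (fun y => \sum_(i <- r) F i y) (\sum_(i <- r) d i).
Proof.
move=> dF; elim: r => [|i r IH].
  rewrite big_nil (_ : (fun y => _) = fun=> 0); first exact: is_derive_cst.
  by apply/funext => y; rewrite big_nil.
rewrite big_cons (_ : (fun y => _) = fun y => F i y + \sum_(j <- r) F j y).
  exact: is_derive_plus.
by apply/funext => y; rewrite big_cons.
Qed.

Lemma Ck_ln k (U : set V) f : open U -> (forall x, U x -> 0 < f x) -> Ck k U f ->
  Ck k U (fun x => ln (f x)).
Proof.
move=> oU f0; case: k => [|k] cf.
  split => // x Ux; apply: continuous_comp; first exact: (Ck_continuous cf Ux).
  exact/continuous_ln/f0.
apply: (@CkS _ _ k U _ (fun j x => (f x)^-1 * partial j f x) oU).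
  move=> x Ux; apply: continuous_comp; first exact: (Ck_continuous cf Ux).
  exact/continuous_ln/f0.
move=> j; split.
  move=> x Ux.
  exact: (is_derive_comp_real (is_derive1_ln (f0 x Ux)) (Ck_is_derive cf j Ux)).
apply: (CkM oU); last exact: Ck_partial.
by apply: (CkV oU) (Ck_le cf) => x /f0 /lt0r_neq0.
Qed.

Lemma lap_val (U : set V) f (g : 'I_n -> V -> R) (h : 'I_n -> R) x : open U -> U x ->
  (forall j y, U y -> is_derive y (delta_mx 0 j) f (g j y)) ->
  (forall j, is_derive x (delta_mx 0 j) (g j) (h j)) ->
  \sum_j partial j (partial j f) x = \sum_j h j.
Proof.
move=> oU Ux df dg; apply: eq_bigr => j _.
rewrite (partial_eq_open j oU Ux (fun y Uy => partial_val (df j y Uy))).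
exact: partial_val (dg j).
Qed.

Lemma is_derive_dot (a x0 : V) j x :
  is_derive x (delta_mx 0 j) (fun y => dot (y - x0) a) (a 0 j).
Proof.
have h i : is_derive x (delta_mx 0 j) (fun y : V => (y - x0) 0 i * a 0 i)
    (a 0 i * (i == j)%:R).
  rewrite (_ : (fun y => _) = fun y : V => a 0 i * (y 0 i + - x0 0 i)).
    apply: is_derive_scale; apply: is_derive_eq (is_derive_plus (is_derive_coord j i x)
      (is_derive_cst _ _ _)) _.
    by rewrite addr0.
  by apply/funext => y; rewrite !mxE mulrC.
apply: is_derive_eq (is_derive_sum_fun _ h) _.
by rewrite (bigD1 j) //= eqxx mulr1 big1 ?addr0 // => i /negPf ->; rewrite mulr0.
Qed.

Lemma Ck_dot k (U : set V) (a x0 : V) : open U -> Ck k U (fun y => dot (y - x0) a).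
Proof.
move=> oU; apply: (Ck_sum _ oU) => i; apply: (CkM oU); last exact: (Ck_cst _ _ oU).
apply: Ck_eq oU _ (CkD oU (Ck_coord k i oU) (Ck_cst k (- x0 0 i) oU)).
by move=> x _; rewrite !mxE.
Qed.

End FirstOrder.

(** * Cross products in coordinates *)

Section Cross.
Context {R : realType}.
Implicit Types a b c : 'I_3 -> R.

Definition cross a b (i : 'I_3) : R := a (i + 1) * b (i + 2) - a (i + 2) * b (i + 1).

Lemma sum3 (F : 'I_3 -> R) : \sum_i F i = F 0 + F 1 + F (1 + 1).
Proof.
rewrite !big_ord_recl big_ord0 addr0 -addrA.
by congr (F _ + (F _ + F _)); exact: val_inj.
Qed.

Lemma crossE a b : [/\ cross a b 0 = a 1 * b (1 + 1) - a (1 + 1) * b 1,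
  cross a b 1 = a (1 + 1) * b 0 - a 0 * b (1 + 1) &
  cross a b (1 + 1) = a 0 * b 1 - a 1 * b 0].
Proof. by rewrite /cross; split; congr (a _ * b _ - a _ * b _); exact: val_inj. Qed.

Lemma dot_cross_l a b : \sum_i a i * cross a b i = 0.
Proof. by rewrite sum3; have [-> -> ->] := crossE a b; ring. Qed.

Lemma dot_cross_r a b : \sum_i b i * cross a b i = 0.
Proof. by rewrite sum3; have [-> -> ->] := crossE a b; ring. Qed.

Lemma cross_id a i : cross a a i = 0.
Proof. by rewrite /cross mulrC subrr. Qed.

Lemma lagrange_identity a b : \sum_i cross a b i ^+ 2 =
  (\sum_i a i ^+ 2) * (\sum_i b i ^+ 2) - (\sum_i a i * b i) ^+ 2.
Proof. by rewrite !sum3; have [-> -> ->] := crossE a b; ring. Qed.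

Lemma sum_delta a i : \sum_j a j * (i == j)%:R = a i.
Proof.
rewrite (bigD1 i) //= eqxx mulr1 big1 ?addr0 // => j.
by rewrite eq_sym => /negPf ->; rewrite mulr0.
Qed.

(** Linearity in the second factor. The values of [cross a] at unit vectors are the partial
    derivatives of the rotation field about a, and [div_cross] is the divergence of that field. *)
Lemma cross_delta a b i : \sum_j b j * cross a (fun k => (k == j)%:R) i = cross a b i.
Proof.
rewrite /cross -(sum_delta b (i + 2)) -(sum_delta b (i + 1)) !mulr_sumr -sumrB.
by apply: eq_bigr => j _; ring.
Qed.

Lemma div_cross a : \sum_i cross a (fun k => (k == i)%:R) i = 0.
Proof.
by apply: big1 => i _; rewrite /cross; case: i => [[|[|[|//]]] i3]; rewrite !mulr0 subr0.
Qed.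

End Cross.

(** * The linear phase *)

Section LinearPhase.
Context {R : realType}.
Local Notation V := 'rV[R]_3.

Lemma unit_sphere_dot (a : V) : unit_sphere a -> \sum_i a 0 i ^+ 2 = 1.
Proof.
rewrite /unit_sphere /= /enorm => a1.
have d0 : 0 <= dot a a by apply: sumr_ge0 => i _; rewrite -expr2 sqr_ge0.
have : dot a a = 1 by rewrite -(sqr_sqrtr d0) a1 expr1n.
by rewrite /dot => <-; apply: eq_bigr => i _; rewrite expr2.
Qed.

Theorem linear_phase_CGO (lambda0 mu0 kappa : R) (Omega : set V) (rho rhop : V) :
  0 < mu0 -> Omega !=set0 -> open Omega -> bounded_set Omega ->
  unit_sphere rho -> unit_sphere rhop -> dot rho rhop = 0 ->
  has_CGO_solutions lambda0 mu0 kappa Omega (linear_phase rho rhop).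
Proof.
move=> mu0_gt0 O0 oO bO /unit_sphere_dot n1 /unit_sphere_dot n2 ort.
pose a i := rho 0 i; pose b i := rhop 0 i; pose k2 := kappa ^+ 2 / mu0.
pose al (c : V) (x : V) := dot (x - 0) c.
have oT : open [set: V] by exact: openT.
have d1 c j x : is_derive x (delta_mx 0 j) (al c) (c 0 j) by exact: is_derive_dot.
have p1 c j x : partial j (al c) x = c 0 j by exact: partial_val.
have p2 c x : \sum_j partial j (partial j (al c)) x = 0.
  rewrite (lap_val (g := fun j _ => c 0 j) (h := fun=> 0) oT I) ?big1 //.
have ph i j x : partial j (fun=> cross a b i) x = 0.
  by apply: partial_val; exact: is_derive_cst.
(* The whole constant k2 is assigned to the equation for Z: [Db 1] is - k2 and [Db 0] an
   antiderivative of it, while the equation for X gets potential 0. *)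
pose Db n : R -> R := nth (fun=> 0) [:: fun t => - k2 * t; fun=> - k2] n.
apply: (@has_CGO_of_phase R lambda0 mu0 kappa Omega setT (al rho) (al rhop)
  (fun i _ => cross a b i) (fun=> 1) -%R (fun _ _ => 0) Db setT setT (linear_phase rho rhop)) => //.
- by move=> tau t x; rewrite /linear_phase /al subr0.
- by move=> k; exact: Ck_dot.
- by move=> k; exact: Ck_dot.
- by move=> k i; exact: Ck_cst.
- move=> [|[|n]] t _; rewrite /Db /=.
  + have h := @is_deriveZ _ _ _ id (- k2) t 1 1 (is_derive_id _ _).
    by apply: is_derive_eq h _; rewrite /GRing.scale /= mulr1.
  + exact: is_derive_cst.
  + by rewrite !nth_nil; exact: is_derive_cst.
- by move=> x _; under eq_bigr do rewrite p1.
- by move=> x _; under eq_bigr do rewrite p1.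
- by move=> x _; under eq_bigr do rewrite !p1.
- move=> x i _; rewrite p2 mulr0 addr0 big1 ?mulr0 // => j _.
  by rewrite ph mulr0.
- move=> x i _; rewrite p2 mulr0 addr0 big1 ?mulr0 // => j _.
  by rewrite ph mulr0.
- move=> x i _; rewrite big1 ?add0r => [|j _]; last first.
    have -> : partial j (fun=> cross a b i) = fun=> 0 by apply/funext => y; exact: ph.
    by apply: partial_val; exact: is_derive_cst.
  by rewrite /Db /= mul1r mulNr opprK.
- by move=> x _; under eq_bigr do rewrite p1; exact: dot_cross_l.
- by move=> x _; under eq_bigr do rewrite p1; exact: dot_cross_r.
- by move=> x _; apply: big1 => i _; exact: ph.
(* The amplitude rho x rhop has length 1 by Lagrange's identity, so some component is nonzero. *)
- move=> x _; have := lagrange_identity a b; rewrite n1 n2.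
  rewrite (_ : \sum_i a i * b i = 0) // expr0n subr0 mulr1 => h.
  apply: contrapT => /forallNP H; move: h; rewrite big1 => [/esym/eqP|i _].
    by rewrite oner_eq0.
  by have := H i; move/negP; rewrite negbK => /eqP ->; rewrite expr0n.
Qed.

End LinearPhase.

(** * Derivatives of the cotangent *)

Section Cotangent.
Context {R : realType}.

Definition cotan (t : R) : R := cos t / sin t.

Lemma is_derive_cotan (t : R) : sin t != 0 ->
  is_derive t 1 cotan (- (1 + cotan t ^+ 2)).
Proof.
move=> s0; have h := @is_deriveV R sin t (cos t) 1 s0 (is_derive_sin t).
apply: is_derive_eq (is_deriveM (is_derive_cos t) h) _.
rewrite /GRing.scale /= /cotan; generalize (cos t) (sin t) s0 => c s s_neq0.
by field.
Qed.

(* [cot_poly n] evaluated at cot t is the n-th derivative of - (3/4) cot t. *)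
Definition cot_poly n : {poly R} :=
  iter n (fun p => - (1 + 'X ^+ 2) * p^`()) (- (3 / 4) *: 'X).

Lemma is_derive_cot_poly n (t : R) : sin t != 0 ->
  is_derive t 1 (fun s => (cot_poly n).[cotan s]) (cot_poly n.+1).[cotan t].
Proof.
move=> s0.
have := is_derive1_comp (is_derive_poly (cot_poly n) (cotan t)) (is_derive_cotan s0).
move/is_derive_eq; apply.
by rewrite /= !hornerE mulrC.
Qed.

(** At cot t this is 3 / (4 sin^2 t), the potential in the equation for Z of the logarithmic
    case. *)
Lemma cot_poly1 (t : R) : (cot_poly 1).[t] = 3 / 4 * (1 + t ^+ 2).
Proof. by rewrite /cot_poly /= derivZ derivX !hornerE /=; field. Qed.

End Cotangent.

Lemma ln_sqrt {R : realType} (a : R) : ln (Num.sqrt a) = 1 / 2 * ln a.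
Proof.
(* For a <= 0 both logarithms take the default value 0. *)
have [a0|a0] := leP a 0; first by rewrite (ler0_sqrtr a0) !ln0 // mulr0.
rewrite -[in RHS](sqr_sqrtr (ltW a0)) lnXn ?sqrtr_gt0 //.
by generalize (ln (Num.sqrt a)) => l; field.
Qed.

(* On the line, A and its closure have the same trace, which is therefore clopen, hence
   empty as the line contains x0. *)
Lemma line_misses_closure {R : realType} (A : set 'rV[R]_3) (x0 w0 x : 'rV[R]_3) (m : R) :
  open A -> ~ A x0 ->
  [set y | exists m : R, y - x0 = m *: w0] `&` boundary A = set0 ->
  closure A x -> x - x0 <> m *: w0.
Proof.
move=> oA Ax0 lA cx xm.
have clA y : (exists l : R, y - x0 = l *: w0) -> closure A y -> A y.
  move=> ly cy; apply: contrapT => Ay.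
  have : ([set y | exists m : R, y - x0 = m *: w0] `&` boundary A) y.
    by split => //; split => // /interior_subset.
  by rewrite lA.
pose p (l : R) : 'rV[R]_3 := l *: w0 + x0.
have lp l : exists k : R, p l - x0 = k *: w0 by exists l; rewrite addrK.
have cp : continuous p.
  by move=> l; apply: cvgD; [apply: cvgZr_tmp; exact: cvg_id|exact: cvg_cst].
have pE : p @^-1` A = p @^-1` closure A.
  by apply/seteqP; split => l /= hl; [exact: (@subset_closure _ A)|exact: clA (lp l) hl].
have AT : p @^-1` A = setT.
  have /connected_intervalP cT : is_interval [set: R] by [].
  apply: (cT (p @^-1` A)).
  - exists m; rewrite /preimage /= /p -xm subrK; apply: clA => //.
    by exists m.
  - exists (p @^-1` A); last by rewrite setTI.
    by apply: open_comp => // l _; exact: cp.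
  exists (p @^-1` A); last by rewrite setTI.
  rewrite pE; apply: closed_comp; last exact: closed_closure.
  by move=> l _; exact: cp.
have : (p @^-1` A) 0 by rewrite AT.
by rewrite /preimage /= /p scale0r add0r.
Qed.

(** * The logarithmic phase *)

Section LogPhase.
Context {R : realType}.
Local Notation V := 'rV[R]_3.
Variables (x0 w0 : V).
Hypothesis w01 : \sum_i w0 0 i ^+ 2 = 1.
Implicit Types (x : V) (i j : 'I_3).

(* In cylindrical coordinates about the axis x0 + R w0, with height z and distance r
   to the axis, N generates the rotations and H = r^(-3/2) N. *)
Let e i : R := w0 0 i.
Let Y i x : R := x 0 i - x0 0 i.
Let z x : R := dot (x - x0) w0.
Let q x : R := dot (x - x0) (x - x0).
Let P x : R := q x - z x ^+ 2.
(** The complement of the axis: [P] is the squared distance to it, a polynomial, which makes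
    openness immediate. *)
Let W : set V := [set x | 0 < P x].
Let N i x : R := cross e (Y ^~ x) i.
Let D i j : R := cross e (fun k => (k == j)%:R) i.
Let r x : R := Num.sqrt (P x).
(** This is r^(-3/2), written with exp and ln because [Ck_exp] and [Ck_ln] then give its
    smoothness. *)
Let h x : R := expR (- (3 / 4) * ln (P x)).
(** The component of x - x0 orthogonal to the axis, which is half the gradient of [P]. *)
Let n j x : R := Y j x - z x * e j.
Let H i x : R := h x * N i x.
Let al x : R := - (1 / 2) * ln (q x).
Let u x : R := (Num.sqrt (q x))^-1 * z x.
Let be x : R := - acos (u x).

Let zE x : z x = \sum_i Y i x * e i.
Proof. by apply: eq_bigr => i _; rewrite !mxE. Qed.

Let qE x : q x = \sum_i Y i x ^+ 2.
Proof. by apply: eq_bigr => i _; rewrite !mxE expr2. Qed.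

Let PE x : P x = \sum_i N i x ^+ 2.
Proof.
rewrite /N lagrange_identity w01 mul1r -qE /P zE; congr (_ - _ ^+ 2).
by apply: eq_bigr => i _; rewrite mulrC.
Qed.

Let q_gt0 x : W x -> 0 < q x.
Proof. by rewrite /W /= /P subr_gt0; apply: le_lt_trans; exact: sqr_ge0. Qed.

Let q_neq0 x : W x -> q x != 0. Proof. by move=> /q_gt0 /lt0r_neq0. Qed.

Let r_gt0 x : W x -> 0 < r x. Proof. by move=> Wx; rewrite sqrtr_gt0. Qed.

Let r_neq0 x : W x -> r x != 0. Proof. by move=> /r_gt0 /lt0r_neq0. Qed.

Let r2 x : W x -> r x ^+ 2 = P x. Proof. by move=> /ltW; exact: sqr_sqrtr. Qed.

Let qrz x : W x -> q x = r x ^+ 2 + z x ^+ 2.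
Proof. by move=> /r2 ->; rewrite /P subrK. Qed.

Let dY i j x : is_derive x (delta_mx 0 j) (Y i) (i == j)%:R.
Proof.
apply: is_derive_eq (is_derive_plus (is_derive_coord j i x) (is_derive_cst _ _ _)) _.
by rewrite addr0.
Qed.

Let dz j x : is_derive x (delta_mx 0 j) z (e j).
Proof. exact: is_derive_dot. Qed.

Let dq j x : is_derive x (delta_mx 0 j) q (2 * Y j x).
Proof.
have -> : q = fun y => \sum_i Y i y * Y i y.
  by apply/funext => y; rewrite qE; apply: eq_bigr => i _; rewrite expr2.
apply: is_derive_eq (is_derive_sum_fun _ (fun i => is_derive_prod (dY i j x) (dY i j x))) _.
rewrite (bigD1 j) //= eqxx big1 => [|i /negPf ->]; first by rewrite !mulr1 addr0; ring.
by rewrite mulr0 addr0.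
Qed.

Let dP j x : is_derive x (delta_mx 0 j) P (2 * n j x).
Proof.
have -> : P = fun y => q y + - (z y * z y).
  by apply/funext => y; rewrite /P expr2.
apply: is_derive_eq (is_derive_plus (dq j x) (is_derive_opp (is_derive_prod (dz j x) (dz j x)))) _.
by rewrite /n; ring.
Qed.

Let dN i j x : is_derive x (delta_mx 0 j) (N i) (D i j).
Proof.
apply: is_derive_eq (is_derive_plus (is_derive_scale (e (i + 1)) (dY (i + 2) j x))
  (is_derive_opp (is_derive_scale (e (i + 2)) (dY (i + 1) j x)))) _.
by [].
Qed.

Let dn j x : is_derive x (delta_mx 0 j) (n j) (1 - e j ^+ 2).
Proof.
have -> : n j = fun y => Y j y + - (e j * z y).
  by apply/funext => y; rewrite /n mulrC.
apply: is_derive_eq (is_derive_plus (dY j j x) (is_derive_opp (is_derive_scale (e j) (dz j x)))) _.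
by rewrite eqxx expr2.
Qed.

Let dq' j x : W x -> is_derive x (delta_mx 0 j) (fun y => (q y)^-1)
  (- (2 * Y j x * (q x)^-1 ^+ 2)).
Proof.
move=> Wx; apply: is_derive_eq (is_derive_inv (q_neq0 Wx) (dq j x)) _.
by rewrite exprVn mulNr.
Qed.

Let dr' j x : W x -> is_derive x (delta_mx 0 j) (fun y => (r y)^-1)
  (- (n j x * (r x)^-1 ^+ 3)).
Proof.
move=> Wx; have dr := is_derive_comp_real (is_derive1_sqrt Wx) (dP j x).
apply: is_derive_eq (is_derive_inv (r_neq0 Wx) dr) _.
rewrite -/(r x); have := r_neq0 Wx; generalize (r x) (n j x) => s m s0.
by field.
Qed.

Let dh j x : W x -> is_derive x (delta_mx 0 j) h
  (- (3 / 2) * h x * (r x)^-1 ^+ 2 * n j x).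
Proof.
move=> Wx; have dl := is_derive_comp_real (is_derive1_ln Wx) (dP j x).
apply: is_derive_eq (is_derive_comp_real (is_derive_expR _) (is_derive_scale _ dl)) _.
rewrite -/(h x) exprVn r2 //; have := lt0r_neq0 Wx.
by generalize (P x) (n j x) (h x) => s m k s0; field.
Qed.

Let dal j x : W x -> is_derive x (delta_mx 0 j) al (- (Y j x * (q x)^-1)).
Proof.
move=> Wx; have dl := is_derive_comp_real (is_derive1_ln (q_gt0 Wx)) (dq j x).
apply: is_derive_eq (is_derive_scale _ dl) _.
by generalize (q x)^-1 (Y j x) => s m; field.
Qed.

Let u2 x : W x -> 1 - u x ^+ 2 = (r x / Num.sqrt (q x)) ^+ 2.
Proof.
move=> Wx; have s0 : Num.sqrt (q x) != 0 by rewrite lt0r_neq0 // sqrtr_gt0 q_gt0.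
have s2 : Num.sqrt (q x) ^+ 2 = r x ^+ 2 + z x ^+ 2 by rewrite sqr_sqrtr ?ltW ?q_gt0 // qrz.
rewrite /u exprMn expr_div_n exprVn s2.
have : r x ^+ 2 + z x ^+ 2 != 0 by rewrite -s2 expf_neq0.
by generalize (r x) (z x) => a b ab; field.
Qed.

Let sqrt_u x : W x -> Num.sqrt (1 - u x ^+ 2) = r x / Num.sqrt (q x).
Proof.
move=> Wx; rewrite u2 // sqrtr_sqr ger0_norm // divr_ge0 ?sqrtr_ge0 //.
Qed.

Let u_itv x : W x -> -1 < u x < 1.
Proof.
move=> Wx; rewrite -ltr_norml -(@ltr_sqr _ `|u x|) ?nnegrE ?normr_ge0 ?ler01 //.
rewrite real_normK ?num_real // expr1n -subr_gt0 u2 // exprn_gt0 // divr_gt0 ?r_gt0 //.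
by rewrite sqrtr_gt0 q_gt0.
Qed.

Let du j x : W x -> is_derive x (delta_mx 0 j) u
  ((Num.sqrt (q x))^-1 * (e j - z x * Y j x * (q x)^-1)).
Proof.
move=> Wx; have s0 : Num.sqrt (q x) != 0 by rewrite lt0r_neq0 // sqrtr_gt0 q_gt0.
have ds := is_derive_comp_real (is_derive1_sqrt (q_gt0 Wx)) (dq j x).
apply: is_derive_eq (is_derive_prod (is_derive_inv s0 ds) (dz j x)) _.
move: (esym (sqr_sqrtr (ltW (q_gt0 Wx)))) s0.
generalize (Num.sqrt (q x)) (z x) (Y j x) (e j) => s a b c -> s0.
by field.
Qed.

Let dbe j x : W x -> is_derive x (delta_mx 0 j) be
  ((e j - z x * Y j x * (q x)^-1) * (r x)^-1).
Proof.
move=> Wx; have s0 : Num.sqrt (q x) != 0 by rewrite lt0r_neq0 // sqrtr_gt0 q_gt0.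
have := is_derive_opp (is_derive_comp_real (is_derive1_acos (u_itv Wx)) (du j Wx)).
move/is_derive_eq; apply; rewrite sqrt_u //.
generalize (e j - z x * Y j x * (q x)^-1) (Num.sqrt (q x)) s0 (r x) (r_neq0 Wx).
by move=> a s s1 b b0; field; rewrite b0.
Qed.

Let dH i j x : W x -> is_derive x (delta_mx 0 j) (H i)
  (h x * D i j + N i x * (- (3 / 2) * h x * (r x)^-1 ^+ 2 * n j x)).
Proof. by move=> Wx; exact: (is_derive_prod (dh j Wx) (dN i j x)). Qed.

Let cY k i : Ck k setT (Y i).
Proof. exact: (CkD openT (Ck_coord k i openT) (Ck_cst k _ openT)). Qed.

Let cq k : Ck k setT q.
Proof.
apply: Ck_eq openT _ (Ck_sum (index_enum _) openT (fun i => CkM openT (cY k i) (cY k i))).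
by move=> y _; rewrite qE; apply: eq_bigr => i _; rewrite expr2.
Qed.

Let cz k : Ck k setT z. Proof. exact: (Ck_dot k w0 x0 openT). Qed.

Let cP k : Ck k setT P.
Proof.
apply: Ck_eq openT _ (CkD openT (cq k) (CkN openT (CkM openT (cz k) (cz k)))).
by move=> y _; rewrite /P expr2.
Qed.

Let oW : open W.
Proof.
apply: (@open_comp _ _ P [set t | 0 < t]); last exact: open_gt.
by move=> x _; exact: (Ck_continuous (cP 0)).
Qed.

Let CkW k (f : V -> R) : Ck k setT f -> Ck k W f.
Proof.
elim: k f => [|k IH] f [cf df]; split => //; do ?by move=> x _; exact: cf.
by move=> j; have [h1 h2] := df j; split; [move=> x _; exact: h1|exact: IH].
Qed.

Let cqV k : Ck k W (fun x => (q x)^-1).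
Proof. exact: (CkV oW q_neq0 (CkW (cq k))). Qed.

Let crV k : Ck k W (fun x => (r x)^-1).
Proof. exact: (CkV oW r_neq0 (Ck_sqrt oW (fun _ => id) (CkW (cP k)))). Qed.

Let cal k : Ck k W al.
Proof. exact: (CkMl _ oW (Ck_ln oW q_gt0 (CkW (cq k)))). Qed.

Let cH k i : Ck k W (H i).
Proof.
apply: (CkM oW).
  exact: (Ck_exp oW (CkMl _ oW (Ck_ln oW (fun _ => id) (CkW (cP k))))).
apply: (CkD oW); last apply: (CkN oW); by apply: (CkMl _ oW); exact/CkW/cY.
Qed.

(** Only the first derivative of acos enters: the gradient of [be] is a formula in z, q, r and the
    coordinates, already known to be smooth. The order is raised by one so that [CkS] covers k = 0
    as well. *)
Let cbe k : Ck k W be.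
Proof.
apply: Ck_le; apply: (CkS oW) => [x Wx|j].
  apply: continuousN; apply: continuous_comp; last exact/continuous_acos/u_itv.
  have cu : Ck 0 W u.
    apply: (CkM oW); last exact/CkW/cz.
    apply: (CkV oW) (Ck_sqrt oW q_gt0 (CkW (cq 0))) => y /q_gt0 qy.
    by rewrite lt0r_neq0 // sqrtr_gt0.
  exact: (Ck_continuous cu Wx).
split; first by move=> x; exact: dbe.
apply: (CkM oW) (crV k); apply: (CkD oW) (Ck_cst k (e j) oW) (CkN oW _).
by apply: (CkM oW) (cqV k); apply: (CkM oW); apply: CkW.
Qed.

(** All sums over j below are of this shape, with coefficients free of j. Summed against Y the
    derivatives [D i j] give back N i, and against e they give e x e = 0. *)
Let quad_sum i x (a b c d f g : R) :
  \sum_j (a * Y j x ^+ 2 + b * (Y j x * e j) + c * e j ^+ 2 + d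
          + f * (Y j x * D i j) + g * (e j * D i j))
  = a * q x + b * z x + c + 3 * d + f * N i x.
Proof.
rewrite !big_split /= -!mulr_sumr -qE -zE w01 mulr1.
rewrite /D (cross_delta e (Y ^~ x)) (cross_delta e e) cross_id mulr0 addr0.
by rewrite sumr_const card_ord mulr_natl.
Qed.

Let pal j x : W x -> partial j al x = - (Y j x * (q x)^-1).
Proof. by move=> Wx; exact: partial_val (dal j Wx). Qed.

Let pbe j x : W x -> partial j be x = (e j - z x * Y j x * (q x)^-1) * (r x)^-1.
Proof. by move=> Wx; exact: partial_val (dbe j Wx). Qed.

Let pH i j x : W x -> partial j (H i) x =
  h x * D i j + N i x * (- (3 / 2) * h x * (r x)^-1 ^+ 2 * n j x).
Proof. by move=> Wx; exact: partial_val (dH i j Wx). Qed.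

(** With the coefficients supplied by hand, the first premise is an algebraic identity for each j
    and the second one in q, z and N i. *)
Let sum_quad (F : 'I_3 -> R) i x (a b c d f g s : R) :
  (forall j, F j = a * Y j x ^+ 2 + b * (Y j x * e j) + c * e j ^+ 2 + d
     + f * (Y j x * D i j) + g * (e j * D i j)) ->
  a * q x + b * z x + c + 3 * d + f * N i x = s -> \sum_j F j = s.
Proof. by move=> FE <-; rewrite -(quad_sum i x a b c d f g); apply: eq_bigr => j _; exact: FE. Qed.

(** Once q is replaced by r^2 + z^2, the remaining r and z can be treated as independent variables
    and [field] concludes. *)
Let inv_qr x : W x -> [/\ q x = r x ^+ 2 + z x ^+ 2, r x != 0 & r x ^+ 2 + z x ^+ 2 != 0].
Proof. by move=> Wx; split; [exact: qrz|exact: r_neq0|rewrite -qrz // q_neq0]. Qed.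

Let eik_al x : W x -> \sum_j partial j al x ^+ 2 = (q x)^-1.
Proof.
move=> Wx; under eq_bigr do rewrite pal //.
(* No [D i j] occurs, so the index 0 is a dummy. *)
apply: (@sum_quad _ 0 x ((q x)^-1 ^+ 2) 0 0 0 0 0) => [j|]; first by ring.
by have := q_neq0 Wx; generalize (q x) (z x) (N 0 x) => a b c a0; field.
Qed.

Let eik_be x : W x -> \sum_j partial j be x ^+ 2 = (q x)^-1.
Proof.
move=> Wx; under eq_bigr do rewrite pbe //.
apply: (@sum_quad _ 0 x (z x ^+ 2 * (q x)^-1 ^+ 2 * (r x)^-1 ^+ 2)
  (- (2 * z x * (q x)^-1 * (r x)^-1 ^+ 2)) ((r x)^-1 ^+ 2) 0 0 0) => [j|]; first by ring.
have [-> r0] := inv_qr Wx; move: r0.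
by generalize (r x) (z x) (N 0 x) => a b c a0 ab0; field; apply/andP.
Qed.

Let eik_ort x : W x -> \sum_j partial j al x * partial j be x = 0.
Proof.
move=> Wx; under eq_bigr do rewrite pal // pbe //.
apply: (@sum_quad _ 0 x (z x * (q x)^-1 ^+ 2 * (r x)^-1)
  (- ((q x)^-1 * (r x)^-1)) 0 0 0 0) => [j|]; first by ring.
have [-> r0] := inv_qr Wx; move: r0.
by generalize (r x) (z x) (N 0 x) => a b c a0 ab0; field; apply/andP.
Qed.

Let lap_al x : W x -> \sum_j partial j (partial j al) x = - (q x)^-1.
Proof.
move=> Wx; have lapE := (lap_val oW Wx (fun j y => @dal j y)
  (fun j => is_derive_opp (is_derive_prod (dY j j x) (dq' j Wx)))).
apply: (etrans lapE); apply: (@sum_quad _ 0 x (2 * (q x)^-1 ^+ 2) 0 0 (- (q x)^-1) 0 0) => [j|].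
  by rewrite eqxx mulr1; ring.
by have := q_neq0 Wx; generalize (q x) (z x) (N 0 x) => a b c a0; field.
Qed.

Let lap_be x : W x -> \sum_j partial j (partial j be) x = - (z x * (q x)^-1 * (r x)^-1).
Proof.
move=> Wx; have lapE := (lap_val oW Wx (fun j y => @dbe j y)
  (fun j => is_derive_prod (is_derive_plus (is_derive_cst (e j) x _)
     (is_derive_opp (is_derive_prod (is_derive_prod (dz j x) (dY j j x)) (dq' j Wx))))
     (dr' j Wx))).
apply: (etrans lapE); apply: (@sum_quad _ 0 x
  (z x * (q x)^-1 * (r x)^-1 ^+ 3 + (r x)^-1 * (2 * z x * (q x)^-1 ^+ 2))
  (- ((r x)^-1 ^+ 3) - z x ^+ 2 * (q x)^-1 * (r x)^-1 ^+ 3 - (r x)^-1 * (q x)^-1)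
  (z x * (r x)^-1 ^+ 3) (- ((r x)^-1 * (q x)^-1 * z x)) 0 0) => [j|].
  by rewrite eqxx mulr1 /n /cst; ring.
have [-> r0] := inv_qr Wx; move: r0.
by generalize (r x) (z x) (N 0 x) => a b c a0 ab0; field; apply/andP.
Qed.

Let trans_al x i : W x ->
  2 * (\sum_j partial j al x * partial j (H i) x)
  + H i x * \sum_j partial j (partial j al) x = 0.
Proof.
move=> Wx; rewrite lap_al //; under eq_bigr do rewrite pal // pH //.
rewrite (@sum_quad _ i x (3 / 2 * N i x * h x * (q x)^-1 * (r x)^-1 ^+ 2)
  (- (3 / 2 * N i x * h x * (q x)^-1 * (r x)^-1 ^+ 2 * z x))
  0 0 (- (h x * (q x)^-1)) 0 _ _ (erefl _)) => [|j]; last by rewrite /n; ring.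
rewrite /H; have [-> r0] := inv_qr Wx; move: r0.
by generalize (r x) (z x) (N i x) (h x) => a b c k a0 ab0; field; apply/andP.
Qed.

Let trans_be x i : W x ->
  2 * (\sum_j partial j be x * partial j (H i) x)
  + H i x * \sum_j partial j (partial j be) x = 0.
Proof.
move=> Wx; rewrite lap_be //; under eq_bigr do rewrite pbe // pH //.
rewrite (@sum_quad _ i x
  (3 / 2 * N i x * h x * (r x)^-1 ^+ 3 * z x * (q x)^-1)
  (- (3 / 2 * N i x * h x * (r x)^-1 ^+ 3) * (1 + z x ^+ 2 * (q x)^-1))
  (3 / 2 * N i x * h x * (r x)^-1 ^+ 3 * z x) 0
  (- (h x * (r x)^-1 * z x * (q x)^-1)) (h x * (r x)^-1) _ _ (erefl _)) => [|j].
  rewrite /H; have [-> r0] := inv_qr Wx; move: r0.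
  by generalize (r x) (z x) (N i x) (h x) => a b c k a0 ab0; field; apply/andP.
by rewrite /n; ring.
Qed.

Let lap_H x i : W x ->
  \sum_j partial j (partial j (H i)) x = - (3 / 4) * (r x)^-1 ^+ 2 * H i x.
Proof.
move=> Wx.
have dr2 j : is_derive x (delta_mx 0 j) (fun y => (r y)^-1 ^+ 2)
    (- (2 * n j x * (r x)^-1 ^+ 4)).
  have -> : (fun y => (r y)^-1 ^+ 2) = fun y => (r y)^-1 * (r y)^-1.
    by apply/funext => y; rewrite expr2.
  apply: is_derive_eq (is_derive_prod (dr' j Wx) (dr' j Wx)) _.
  by generalize (r x)^-1 => s; ring.
have lapE := (lap_val oW Wx (fun j y => @dH i j y) (fun j => is_derive_plus
  (is_derive_prod (dh j Wx) (is_derive_cst (D i j) x _))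
  (is_derive_prod (dN i j x) (is_derive_prod (is_derive_prod (is_derive_scale _ (dh j Wx))
     (dr2 j)) (dn j x))))).
(* The 9/4 comes from differentiating h twice, the 3 from the derivative of r^(-2) times 3/2. *)
apply: (etrans lapE); apply: (@sum_quad _ i x
  (N i x * h x * (r x)^-1 ^+ 4 * (9 / 4 + 3))
  (- 2 * z x * N i x * h x * (r x)^-1 ^+ 4 * (9 / 4 + 3))
  (z x ^+ 2 * N i x * h x * (r x)^-1 ^+ 4 * (9 / 4 + 3) + 3 / 2 * N i x * h x * (r x)^-1 ^+ 2)
  (- (3 / 2) * N i x * h x * (r x)^-1 ^+ 2)
  (- 3 * h x * (r x)^-1 ^+ 2) (3 * h x * (r x)^-1 ^+ 2 * z x)) => [j|].
  by rewrite /n /cst; generalize (r x)^-1 => s; field.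
rewrite /H; have [-> r0] := inv_qr Wx; move: r0.
by generalize (r x) (z x) (N i x) (h x) => a b c k a0 ab0; field.
Qed.

(** If [P x] were 0, the orthogonal component would have squared length q - z^2 = 0, which puts x on
    the axis at height z. *)
Let N_neq0 x : (forall l : R, x - x0 <> l *: w0) -> W x.
Proof.
move=> xl; rewrite /W /= lt_neqAle PE; apply/andP; split; last first.
  by apply: sumr_ge0 => i _; exact: sqr_ge0.
apply/eqP => /esym s0; apply: (xl (z x)); apply/rowP => j; rewrite !mxE.
have N0 i : N i x = 0.
  have h0 k : true -> 0 <= N k x ^+ 2 by move=> _; exact: sqr_ge0.
  by apply/eqP; rewrite -sqrf_eq0 (psumr_eq0P h0 s0).
have n0 : \sum_k n k x ^+ 2 = 0.
  rewrite (@sum_quad _ j x 1 (- (2 * z x)) (z x ^+ 2) 0 0 0 0) => [//|k|].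
    by rewrite /n; ring.
  have -> : q x = z x ^+ 2.
    by apply/eqP; rewrite -subr_eq0 -/(P x) PE; apply/eqP/big1 => k _; rewrite N0 expr0n.
  by ring.
have h0 k : true -> 0 <= n k x ^+ 2 by move=> _; exact: sqr_ge0.
have : n j x ^+ 2 = 0 by exact: psumr_eq0P h0 n0 j isT.
by move/eqP; rewrite sqrf_eq0 subr_eq0 => /eqP.
Qed.

Let H_neq0 x : W x -> exists i, H i x != 0.
Proof.
rewrite /W /= PE => W0; apply: contrapT => /forallNP H0.
move: W0; rewrite big1 ?ltxx // => i _; apply/eqP; rewrite sqrf_eq0.
by have := H0 i; move/negP; rewrite negbK mulf_eq0 (gt_eqF (expR_gt0 _)).
Qed.

Let be_itv x : W x -> - pi < be x < 0.
Proof.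
move=> /u_itv /andP[ux1 ux2]; rewrite ltrN2 oppr_lt0.
by rewrite acos_gt0 ?acos_ltpi ?ux1 ?ux2 ?(ltW ux1) ?(ltW ux2).
Qed.

Let sin_neq0 (t : R) : - pi < t < 0 -> sin t != 0.
Proof.
move=> /andP[t1 t2]; rewrite -(opprK t) sinN oppr_eq0 lt0r_neq0 // sin_gt0_pi //.
by rewrite oppr_gt0 t2 ltrNl.
Qed.

Let cotan_be x : W x -> cotan (be x) = - (z x / r x).
Proof.
move=> Wx; have /andP[ux1 ux2] := u_itv Wx.
rewrite /cotan cosN sinN acosK ?in_itv /= ?(ltW ux1) ?(ltW ux2) //.
rewrite sin_acos ?(ltW ux1) ?(ltW ux2) // sqrt_u // /u.
have : Num.sqrt (q x) != 0 by rewrite lt0r_neq0 // sqrtr_gt0 q_gt0.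
have := r_neq0 Wx; generalize (Num.sqrt (q x)) (r x) (z x) => a b c b0 a0.
by field; rewrite b0.
Qed.

Theorem log_phase_CGO (lambda0 mu0 kappa : R) (Omega : set V) :
  0 < mu0 -> Omega !=set0 -> open Omega -> bounded_set Omega -> ~ Omega x0 ->
  [set x | exists m : R, x - x0 = m *: w0] `&` boundary Omega = set0 ->
  has_CGO_solutions lambda0 mu0 kappa Omega (log_phase x0 w0).
Proof.
move=> mu0_gt0 O0 oO bO Ox0 line.
have OW : closure Omega `<=` W.
  by move=> x cx; apply: N_neq0 => l; exact: (line_misses_closure oO Ox0 line cx).
pose k2 := kappa ^+ 2 / mu0.
(* Since e^(-2 al) = q, the potential [Da 1] at al is - k2 q, and the factor m = 1 / q turns it into
   the constant - k2; [Da 0] is an antiderivative. *)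
pose Da (n : nat) (t : R) : R := (- 2) ^+ n * (k2 / 2) * expR (- 2 * t).
pose Db n (t : R) : R := (cot_poly n).[cotan t].
apply: (@has_CGO_of_phase R lambda0 mu0 kappa Omega W al be H (fun x => (q x)^-1) id
  Da Db setT [set t | - pi < t < 0] (log_phase x0 w0)) => //.
- move=> tau t x; rewrite /log_phase /enorm ln_sqrt -/(q x).
  have -> : dist_sphere ((enorm (x - x0))^-1 *: (x - x0)) w0 = acos (u x).
    rewrite /dist_sphere; congr acos; rewrite /dot /u /z /dot mulr_sumr.
    by apply: eq_bigr => i _; rewrite !mxE mulrA.
  by congr (_ +i* _); rewrite /al /be; ring.
- move=> a b /andP[a1 _] /andP[_ b2] t /andP[ta tb] /=.
  by rewrite (lt_le_trans a1 ta) (le_lt_trans tb b2).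
- move=> n' t _; have hD := is_derive1_comp (is_derive_expR (- 2 * t))
    (@is_deriveZ _ _ _ id (- 2) t 1 1 (is_derive_id _ _)).
  apply: is_derive_eq (is_deriveZ ((- 2) ^+ n' * (k2 / 2)) hD) _.
  rewrite /Da exprS /GRing.scale /=.
  by generalize ((-2) ^+ n' : R) (expR (-2 * t)) => a b; field.
- by move=> n' t /sin_neq0; exact: is_derive_cot_poly.
- move=> x i Wx; rewrite lap_H // /Db cot_poly1 cotan_be // /Da /al.
  have -> : expR (- 2 * (- (1 / 2) * ln (q x))) = q x.
    rewrite (_ : - 2 * _ = ln (q x)) ?lnK ?posrE ?q_gt0 //.
    by generalize (ln (q x)) => l; field.
  rewrite -/k2; have [-> r0] := inv_qr Wx; move: r0.
  by generalize (r x) (z x) (H i x) k2 => a b c k a0 ab0; field; apply/andP.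
- move=> x Wx; under eq_bigr do rewrite pal //.
  rewrite (eq_bigr (fun i => - ((q x)^-1 * h x) * (Y i x * N i x))) => [|i _].
    by rewrite -mulr_sumr dot_cross_r mulr0.
  by rewrite /H; ring.
- move=> x Wx; under eq_bigr do rewrite pbe //.
  rewrite (eq_bigr (fun i => (r x)^-1 * h x * (e i * N i x)
    - z x * (q x)^-1 * (r x)^-1 * h x * (Y i x * N i x))) => [|i _].
    by rewrite sumrB -!mulr_sumr dot_cross_r dot_cross_l !mulr0 subr0.
  by rewrite /H; ring.
- move=> x Wx; under eq_bigr do rewrite pH //.
  rewrite (eq_bigr (fun i => h x * D i i - 3 / 2 * h x * (r x)^-1 ^+ 2 * (Y i x * N i x)
    + 3 / 2 * h x * (r x)^-1 ^+ 2 * z x * (e i * N i x))) => [|i _].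
    rewrite big_split sumrB /= -!mulr_sumr dot_cross_r dot_cross_l div_cross.
    by rewrite !mulr0 subr0 addr0.
  by rewrite /n; ring.
by move=> x /OW; exact: H_neq0.
Qed.

End LogPhase.

Theorem proposition3p4 (R : realType) (lambda0 mu0 kappa : R)
    (mu0_gt0 : 0 < mu0) (lame_gt0 : 0 < 2 * mu0 + 3 * lambda0)
    (kappa_gt0 : 0 < kappa)
    (Omega : set 'rV[R]_3) (domOmega : bounded_C2_domain Omega) :
  (forall rho rhop : 'rV[R]_3,
     unit_sphere rho -> unit_sphere rhop -> dot rho rhop = 0 ->
     has_CGO_solutions lambda0 mu0 kappa Omega (linear_phase rho rhop)) /\
  (forall x0 omega0 : 'rV[R]_3,
     ~ closure (convex_hull Omega) x0 ->
     unit_sphere omega0 ->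
     [set x | exists m : R, x - x0 = m *: omega0] `&` boundary Omega = set0 ->
     has_CGO_solutions lambda0 mu0 kappa Omega (log_phase x0 omega0)).
Proof.
have [neO oO _ bO _] := domOmega.
split=> [rho rhop n1 n2 ort|x0 w0 x0O /unit_sphere_dot w01 line].
  exact: linear_phase_CGO.
apply: log_phase_CGO => // Ox0; apply/x0O/subset_closure.
by move=> B [_ OB]; exact: OB.
Qed.
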